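(* Let $\mathbf A$ be a finite algebra belonging to a congruence modular variety that decomposes into a direct product $\mathbf N\times\mathbf D$, where $\mathbf N$ is a supernilpotent algebra and $\mathbf D$ is a subdirect product of $2$-element algebras each of which is polynomially equivalent to the $2$-element lattice. Then for every quotient $\mathbf A'$ of $\mathbf A$ the problem $\mathrm{CSAT}(\mathbf A')$ is solvable in polynomial time.
   Context: A polynomial of an algebra $\mathbf A$ is an operation obtained by composing fundamental operations, projections and constants from $A$. A circuit over $\mathbf A$ is a directed acyclic graph whose input nodes are labelled by variables or by constants from $A$, and whose gates are labelled by fundamental operations of $\mathbf A$ (with ordered inputs of matching arity); each gate computes a polynomial of $\mathbf A$; its size is the size of the graph. $\mathrm{CSAT}(\mathbf A)$: given a circuit over $\mathbf A$ with two output gates $g_1,g_2$, decide whether there is an input tuple $\bar a$ with $g_1(\bar a)=g_2(\bar a)$; running time is measured in the size of the circuit. ''Belongs to a congruence modular variety'' means the variety generated by $\mathbf A$ is congruence modular. Supernilpotency is in the sense of higher commutators (Bulatov, Aichinger–Mudrinski): $\mathbf A$ is $k$-supernilpotent if the $(k+1)$-ary higher commutator $[1_A,\dots,1_A]$ equals $0_A$, and supernilpotent if it is $k$-supernilpotent for some $k$. An algebra is polynomially equivalent to the $2$-element lattice if it has universe $\{0,1\}$ and the same polynomial operations as $(\{0,1\},\wedge,\vee)$. *)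

(* Defs.v *)
From mathcomp Require Import all_boot.
From Corelib Require Import BinNums.
Set Implicit Arguments. Unset Strict Implicit. Unset Printing Implicit Defensive.

Definition ops_t (I : Type) (ar : I -> nat) (T : Type) :=
  forall i : I, ('I_(ar i) -> T) -> T.

(* Terms with constants from C and variables from V.
   Terms with C = void are ordinary terms; terms with C = carrier of an
   algebra are polynomials of that algebra. *)
Inductive pterm (I : Type) (ar : I -> nat) (C V : Type) : Type :=
| PVar of V
| PConst of C
| POp (i : I) of ('I_(ar i) -> pterm ar C V).

Fixpoint peval (I : Type) (ar : I -> nat) (C V T : Type) (o : ops_t ar T)
  (c : C -> T) (e : V -> T) (t : pterm ar C V) : T :=
  match t with
  | PVar v => e v
  | PConst a => c a
  | POp i ts => o i (fun j => peval o c e (ts j))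
  end.

(* Finite algebras: finite universe, finitely many fundamental operations
   (the signature I is a finType in the main theorem). *)
Record falg (I : Type) (ar : I -> nat) := FAlg {
  fcar : finType;
  fop : ops_t ar fcar }.
Arguments fcar {I ar} f.
Arguments fop {I ar} f i _.

Definition is_hom (I : Type) (ar : I -> nat) (T1 T2 : Type)
  (o1 : ops_t ar T1) (o2 : ops_t ar T2) (h : T1 -> T2) : Prop :=
  forall i (x : 'I_(ar i) -> T1), h (o1 i x) = o2 i (fun j => h (x j)).

Definition surj (T1 T2 : Type) (h : T1 -> T2) : Prop :=
  forall y, exists x, h x = y.

Definition is_congruence (I : Type) (ar : I -> nat) (T : Type) (o : ops_t ar T)
  (th : T -> T -> Prop) : Prop :=
  [/\ (forall x, th x x),
      (forall x y, th x y -> th y x),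
      (forall x y z, th x y -> th y z -> th x z) &
      (forall i (x y : 'I_(ar i) -> T), (forall j, th (x j) (y j)) ->
          th (o i x) (o i y))].

Definition cmeet (T : Type) (a b : T -> T -> Prop) : T -> T -> Prop :=
  fun x y => a x y /\ b x y.

Definition cjoin (I : Type) (ar : I -> nat) (T : Type) (o : ops_t ar T)
  (a b : T -> T -> Prop) : T -> T -> Prop :=
  fun x y => forall th, is_congruence o th ->
    (forall u v, a u v -> th u v) -> (forall u v, b u v -> th u v) -> th x y.

Definition cong_modular (I : Type) (ar : I -> nat) (T : Type) (o : ops_t ar T) : Prop :=
  forall a b c, is_congruence o a -> is_congruence o b -> is_congruence o c ->
    (forall x y, a x y -> c x y) ->
    forall x y, cjoin o a (cmeet b c) x y <-> cmeet (cjoin o a b) c x y.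

(* (T, o) satisfies every identity satisfied by A, i.e. (by Birkhoff)
   (T, o) belongs to the variety generated by A. *)
Definition satisfies_ids_of (I : Type) (ar : I -> nat) (A : falg ar)
  (T : Type) (o : ops_t ar T) : Prop :=
  forall t1 t2 : pterm ar void nat,
    (forall e : nat -> fcar A,
        peval (fop A) (@of_void _) e t1 = peval (fop A) (@of_void _) e t2) ->
    forall e : nat -> T, peval o (@of_void _) e t1 = peval o (@of_void _) e t2.

Definition gen_variety_cong_modular (I : Type) (ar : I -> nat) (A : falg ar) : Prop :=
  forall (T : Type) (o : ops_t ar T), satisfies_ids_of A o -> cong_modular o.

(* term_cond o [:: a_1; ...; a_m] d  is the term condition
   C(a_1, ..., a_m; d): for every polynomial f whose variables are split
   into m blocks (variable (i,j) = j-th argument of block i), and all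
   tuples a_i, b_i with a_i a_i-related to b_i (componentwise):
   if f(x_1,...,x_{m-1}, a_m) d f(x_1,...,x_{m-1}, b_m) for all
   (x_1,...,x_{m-1}) in {a_1,b_1} x ... x {a_{m-1},b_{m-1}} other than
   (b_1,...,b_{m-1}), then f(b_1,...,b_{m-1},a_m) d f(b_1,...,b_{m-1},b_m).
   Variables of blocks i >= m (unused) are evaluated at a. *)
Definition term_cond (I : Type) (ar : I -> nat) (T : Type) (o : ops_t ar T)
  (alphas : seq (T -> T -> Prop)) (d : T -> T -> Prop) : Prop :=
  let m := size alphas in
  forall (f : pterm ar T (nat * nat)) (a b : nat -> nat -> T),
    (forall i j, i < m -> nth (fun _ _ => True) alphas i (a i j) (b i j)) ->
    let env (s : nat -> bool) (t : bool) (v : nat * nat) : T :=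
      let: (i, j) := v in
      if i < m.-1 then (if s i then b i j else a i j)
      else if (i == m.-1) && (0 < m) then (if t then b i j else a i j)
      else a i j in
    let ev s t := peval o id (env s t) f in
    (forall s : nat -> bool, (exists2 i, i < m.-1 & s i = false) ->
        d (ev s false) (ev s true)) ->
    d (ev (fun _ => true) false) (ev (fun _ => true) true).

(* the higher commutator [a_1, ..., a_m]: the smallest congruence d
   with C(a_1, ..., a_m; d), i.e. the intersection of all of them *)
Definition hcomm (I : Type) (ar : I -> nat) (T : Type) (o : ops_t ar T)
  (alphas : seq (T -> T -> Prop)) : T -> T -> Prop :=
  fun x y => forall d, is_congruence o d -> term_cond o alphas d -> d x y.

Definition total_rel (T : Type) : T -> T -> Prop := fun _ _ => True.

Definition k_supernilpotent (I : Type) (ar : I -> nat) (T : Type) (o : ops_t ar T)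
  (k : nat) : Prop :=
  forall x y, hcomm o (nseq k.+1 (@total_rel T)) x y -> x = y.

Definition supernilpotent (I : Type) (ar : I -> nat) (T : Type) (o : ops_t ar T) : Prop :=
  exists k, k_supernilpotent o k.

Definition lat_ar : bool -> nat := fun _ => 2.
Definition lat_ops : ops_t lat_ar bool :=
  fun (i : bool) (x : 'I_2 -> bool) =>
    if i then x ord0 && x ord_max else x ord0 || x ord_max.

(* g : (nat -> T) -> T is a polynomial operation of (T, o)
   (finitary, since a term has finitely many variables) *)
Definition poly_fun (I : Type) (ar : I -> nat) (T : Type) (o : ops_t ar T)
  (g : (nat -> T) -> T) : Prop :=
  exists t : pterm ar T nat, forall e, peval o id e t = g e.

Definition polyeq_2lattice (I : Type) (ar : I -> nat) (T : Type) (o : ops_t ar T) : Prop :=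
  exists (phi : T -> bool) (psi : bool -> T),
    [/\ cancel phi psi, cancel psi phi &
        forall g : (nat -> bool) -> bool,
          poly_fun o (fun e : nat -> T => psi (g (fun n => phi (e n)))) <->
          poly_fun lat_ops g].

Definition subdirect_2lattices (I : Type) (ar : I -> nat) (D : falg ar) : Prop :=
  exists (J : Type) (B : J -> Type) (oB : forall j, ops_t ar (B j))
         (h : forall j, fcar D -> B j),
    [/\ forall j, is_hom (fop D) (oB j) (h j),
        forall j, surj (h j),
        forall x y, (forall j, h j x = h j y) -> x = y &
        forall j, polyeq_2lattice (oB j)].

Definition iso_product (I : Type) (ar : I -> nat) (A N D : falg ar) : Prop :=
  exists (hN : fcar A -> fcar N) (hD : fcar A -> fcar D),
    [/\ is_hom (fop A) (fop N) hN, is_hom (fop A) (fop D) hD &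
        bijective (fun x => (hN x, hD x))].

(* A circuit is a list of nodes in topological order; a gate refers to
   its (ordered) inputs by their positions in the list. *)
Inductive cnode (I : Type) (ar : I -> nat) (T : Type) : Type :=
| CVar of nat
| CConst of T
| CGate (i : I) of ('I_(ar i) -> nat).

Record circuit (I : Type) (ar : I -> nat) (T : Type) := Circuit {
  cnodes : seq (cnode ar T);
  cout1 : nat;
  cout2 : nat }.

Definition wf_circuit (I : Type) (ar : I -> nat) (T : Type) (c : circuit ar T) : Prop :=
  [/\ cout1 c < size (cnodes c), cout2 c < size (cnodes c) &
      forall k, k < size (cnodes c) ->
        match nth (CVar ar T 0) (cnodes c) k with
        | CGate i ch => forall j, ch j < k
        | _ => True
        end].

Definition node_val (I : Type) (ar : I -> nat) (T : Type) (o : ops_t ar T)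
  (e : nat -> T) (prev : seq T) (n : cnode ar T) : T :=
  match n with
  | CVar v => e v
  | CConst a => a
  | CGate i ch => o i (fun j => nth (e 0) prev (ch j))
  end.

Definition circuit_vals (I : Type) (ar : I -> nat) (T : Type) (o : ops_t ar T)
  (e : nat -> T) (c : circuit ar T) : seq T :=
  foldl (fun prev n => rcons prev (node_val o e prev n)) [::] (cnodes c).

Definition csat (I : Type) (ar : I -> nat) (T : Type) (o : ops_t ar T)
  (c : circuit ar T) : Prop :=
  exists e : nat -> T,
    nth (e 0) (circuit_vals o e c) (cout1 c) = nth (e 0) (circuit_vals o e c) (cout2 c).

(* Encoding circuits as strings over the alphabet option bool          *)
(* (Some b = bit, None = separator); numbers in binary.                *)

Fixpoint pos_bits (p : positive) : seq bool :=
  match p with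
  | xH => [:: true]
  | xO p' => false :: pos_bits p'
  | xI p' => true :: pos_bits p'
  end.

Definition nat_bits (n : nat) : seq bool :=
  match bin_of_nat n with
  | N0 => [::]
  | Npos p => pos_bits p
  end.

Definition enc_nat (n : nat) : seq (option bool) := map Some (nat_bits n) ++ [:: None].

Definition enc_node (I : finType) (ar : I -> nat) (T : finType) (n : cnode ar T)
  : seq (option bool) :=
  match n with
  | CVar v => enc_nat 0 ++ enc_nat v
  | CConst a => enc_nat 1 ++ enc_nat (enum_rank a)
  | CGate i ch => enc_nat 2 ++ enc_nat (enum_rank i) ++
                  flatten [seq enc_nat (ch j) | j <- enum 'I_(ar i)]
  end.

Definition enc_circuit (I : finType) (ar : I -> nat) (T : finType) (c : circuit ar T)
  : seq (option bool) :=
  enc_nat (cout1 c) ++ enc_nat (cout2 c) ++ flatten (map (@enc_node I ar T) (cnodes c)).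

Inductive move := MoveL | MoveR | Stay.

(* configuration: state, tape left of the head (reversed), tape from the
   head rightwards (blank beyond the end); halting states are fixed points *)
Definition tm_step (Q G : Type) (blank : G) (halt : Q -> option bool)
  (delta : Q -> G -> Q * G * move) (cfg : Q * seq G * seq G) : Q * seq G * seq G :=
  let: (q, l, r) := cfg in
  if halt q is Some _ then cfg else
  let: (q', a, mv) := delta q (head blank r) in
  let r1 := a :: behead r in
  match mv with
  | MoveL => if l is b :: l' then (q', l', b :: r1) else (q', [::], r1)
  | MoveR => (q', a :: l, behead r)
  | Stay => (q', l, r1)
  end.

Definition poly_time_decides_on (S X : Type) (enc : X -> seq S)
  (dom : X -> Prop) (P : X -> Prop) : Prop :=
  exists (Q G : finType) (inp : S -> G) (blank : G) (q0 : Q)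
         (halt : Q -> option bool) (delta : Q -> G -> Q * G * move) (c k : nat),
    forall x, dom x ->
      let w := enc x in
      let cfg := iter (c * size w ^ k + c) (tm_step blank halt delta)
                      (q0, [::], map inp w) in
      match halt cfg.1.1 with
      | Some b => (b : Prop) <-> P x
      | None => False
      end.

Definition CSAT_in_P (I : finType) (ar : I -> nat) (A' : falg ar) : Prop :=
  poly_time_decides_on (@enc_circuit I ar (fcar A'))
    (@wf_circuit I ar (fcar A')) (csat (fop A')).

(* Main.v *)
Require Import Defs.
From mathcomp Require Import all_boot zify.
From HB Require Import structures.
From Stdlib Require Import FunctionalExtensionality ProofIrrelevance.
From Stdlib Require Import Relation_Operators.
Set Implicit Arguments. Unset Strict Implicit. Unset Printing Implicit Defensive.

(** A congruence modular variety has Gumm terms, in particular a term [p] with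
    [p x x z = z] whose diagonal [y |-> p x y y] is joined to the constant [x] by terms
    [j] with [j x y x = x].  Along such a chain nilpotency of [z |-> j x x z] and of
    [y |-> j x y y] carry over to each other in a supernilpotent algebra, because nested
    [j]s give cubes that are constant off one vertex.  Hence on [N] some iterate of
    [y |-> p x y y] is the constant [x], which yields a Maltsev polynomial, while on [D],
    where polynomials are monotone, [p x y y = y].  The iterate is therefore a term that
    takes the [N]-component of one argument and the [D]-component of the other, so
    congruences of [N x D] are not skew.

    On [D], a system solved with common value [c] is solved by the constant tuple [c].
    On [N], the Maltsev polynomial makes one vertex of a cube of values determined by
    the others; by Ramsey's theorem a long solution contains variables on which the
    values depend only on how many of them are reset to a fixed element, and this
    dependence is periodic.  So there is a constant [d] such that a solvable system over
    a quotient has a solution that is constant off at most [d] variables.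

    The Turing machine tries all those assignments.  It is built from sweeps over the
    tape that never change its length, and evaluates one node per sweep. *)

(** * Congruences and free algebras *)

(** The quotient shapes the argument. A congruence of a direct product need not split along the
    factors, so a solution over [A'] lifts a priori only to two values in [A] that [h] identifies.
    Their [D]-components may differ, and then the constant tuples that reproduce them on [D] differ
    for the two outputs. The mixing term repairs this: an assignment with prescribed [N]-part whose
    [D]-part is taken from [u] is a term in [u], so its image under [h] depends on [h u] only, and
    both outputs see the same assignment. On [N] the two values may differ as well; deleting
    variables therefore has to preserve each of the two values, not just an equation between them,
    and works with pairs throughout.

    The lattice factor has no Maltsev operation, so none can be asked of [A]; this is why the terms
    come from modularity alone and become Maltsev only on [N].

    The bound [d] depends on the size of [N] and its degree of supernilpotency, through Ramsey's
    theorem. It is the number of nested loops of the machine, each over the variable occurrences of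
    the circuit, while the values to be tried are boundedly many. *)

Section Evaluation.
Variables (I : Type) (ar : I -> nat).

Lemma eq_peval (C V T : Type) (o : ops_t ar T) (c c' : C -> T) (e e' : V -> T)
    (t : pterm ar C V) :
  c =1 c' -> e =1 e' -> peval o c e t = peval o c' e' t.
Proof.
move=> ec ee; elim: t => [v|a|i ts IH] /=; [exact: ee|exact: ec|].
by congr (o i _); apply: functional_extensionality => j; apply: IH.
Qed.

Lemma peval_hom (C V T1 T2 : Type) (o1 : ops_t ar T1) (o2 : ops_t ar T2)
    (h : T1 -> T2) (c : C -> T1) (e : V -> T1) (t : pterm ar C V) :
  is_hom o1 o2 h -> h (peval o1 c e t) = peval o2 (h \o c) (h \o e) t.
Proof.
move=> hh; elim: t => [v|a|i ts IH] //=.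
by rewrite hh; congr (o2 i _); apply: functional_extensionality => j; apply: IH.
Qed.

Lemma peval_cong (C V T : Type) (o : ops_t ar T) (th : T -> T -> Prop)
    (c : C -> T) (e e' : V -> T) (t : pterm ar C V) :
  is_congruence o th -> (forall v, th (e v) (e' v)) ->
  th (peval o c e t) (peval o c e' t).
Proof.
case=> th1 _ _ thop ee; elim: t => [v|a|i ts IH] /=; [exact: ee|exact: th1|].
by apply: thop => j; apply: IH.
Qed.

End Evaluation.

Section Joins.
Variables (I : Type) (ar : I -> nat) (T : Type) (o : ops_t ar T).

Lemma cjoin_congruence (a b : T -> T -> Prop) : is_congruence o (cjoin o a b).
Proof.
split.
- by move=> x th [].
- by move=> x y xy th Hth ha hb; case: (Hth) => _ S _ _; apply: S; apply: xy.
- move=> x y z xy yz th Hth ha hb; case: (Hth) => _ _ Tr _.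
  by apply: (Tr x y z); [apply: xy|apply: yz].
- move=> i x y xy th Hth ha hb; case: (Hth) => _ _ _ O; apply: O => j.
  exact: xy.
Qed.

Lemma cmeet_congruence (a b : T -> T -> Prop) :
  is_congruence o a -> is_congruence o b -> is_congruence o (cmeet a b).
Proof.
move=> [a1 a2 a3 a4] [b1 b2 b3 b4]; split; rewrite /cmeet.
- by move=> x; split.
- by move=> x y [? ?]; split; auto.
- by move=> x y z [? ?] [? ?]; split; [apply: a3|apply: b3]; eassumption.
- move=> i x y xy; split; [apply: a4|apply: b4] => j; by case: (xy j).
Qed.

Lemma cjoinl (a b : T -> T -> Prop) x y : a x y -> cjoin o a b x y.
Proof. by move=> axy th _ ha _; apply: ha. Qed.

Lemma cjoinr (a b : T -> T -> Prop) x y : b x y -> cjoin o a b x y.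
Proof. by move=> bxy th _ _ hb; apply: hb. Qed.

Let S (a b : T -> T -> Prop) := clos_refl_trans T (fun x y => a x y \/ b x y).

Lemma chain_congruence (a b : T -> T -> Prop) :
  is_congruence o a -> is_congruence o b -> is_congruence o (S a b).
Proof.
move=> [a1 a2 a3 a4] [b1 b2 b3 b4]; split.
- by move=> x; apply: rt_refl.
- move=> x y; elim=> [u v [uv|uv]|u|u v w _ vu _ wv].
  + by apply: rt_step; left; apply: a2.
  + by apply: rt_step; right; apply: b2.
  + exact: rt_refl.
  + exact: rt_trans wv vu.
- by move=> x y z; apply: rt_trans.
move=> i x y xy.
(* The arguments are changed from [x] to [y] one at a time: [h m] has the first [m] changed, and
   each single change runs along a chain in that argument. *)
pose h m (j : 'I_(ar i)) := if j < m then y j else x j.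
have step m : m <= ar i -> S a b (o x) (o (h m)).
  elim: m => [|m IH] lem.
    by rewrite (_ : h 0 = x); [apply: rt_refl|apply: functional_extensionality].
  apply: rt_trans (IH (ltnW lem)) _.
  pose jm := Ordinal lem.
  pose u v (j : 'I_(ar i)) := if j == jm then v else h m j.
  have -> : h m = u (x jm).
    apply: functional_extensionality => j; rewrite /u.
    by case: eqP => // ->; rewrite /h ltnn.
  have -> : h m.+1 = u (y jm).
    apply: functional_extensionality => j; rewrite /u /h ltnS leq_eqVlt.
    by rewrite -val_eqE /=; case: eqP => //= jE; congr y; apply: val_inj.
  elim: (xy jm) => [v w [vw|vw]|v|v w z _ IH1 _ IH2].
  - apply: rt_step; left; apply: a4 => j; rewrite /u; by case: ifP.
  - apply: rt_step; right; apply: b4 => j; rewrite /u; by case: ifP.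
  - exact: rt_refl.
  - exact: rt_trans IH1 IH2.
have := step _ (leqnn _).
rewrite (_ : h (ar i) = y) //.
by apply: functional_extensionality => j; rewrite /h ltn_ord.
Qed.

Lemma cjoin_chain (a b : T -> T -> Prop) x y :
  is_congruence o a -> is_congruence o b -> cjoin o a b x y ->
  clos_refl_trans T (fun x y => a x y \/ b x y) x y.
Proof.
move=> ca cb; apply; first exact: chain_congruence.
- by move=> u v uv; apply: rt_step; left.
- by move=> u v uv; apply: rt_step; right.
Qed.

End Joins.

Section FreeAlgebra.
Variables (I : Type) (ar : I -> nat) (A : falg ar).

Definition ground (e : nat -> fcar A) (t : pterm ar void nat) : fcar A :=
  peval (fop A) (@of_void _) e t.

(** The free algebra of countable rank in the variety of [A], realised by term functions, so that an
    equation between its elements is an identity of [A]. *)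
Definition free_car :=
  {f : (nat -> fcar A) -> fcar A | exists t, forall e, f e = ground e t}.

Lemma free_op_subproof (i : I) (fs : 'I_(ar i) -> free_car) :
  exists t, forall e, fop A i (fun j => sval (fs j) e) = ground e t.
Proof.
have [ts tsP] := fin_all_exists (fun j => proj2_sig (fs j)).
exists (POp ts) => e /=; rewrite /ground /=; congr (fop A i _).
by apply: functional_extensionality => j; apply: tsP.
Qed.

Definition free_op : ops_t ar free_car :=
  fun i fs => exist _ (fun e => fop A i (fun j => sval (fs j) e))
                    (free_op_subproof fs).

Lemma free_eq (f g : free_car) : (forall e, sval f e = sval g e) -> f = g.
Proof.
case: f g => [f fP] [g gP] /= fg.
have E : f = g by apply: functional_extensionality.
by subst g; congr exist; apply: proof_irrelevance.
Qed.

Lemma free_peval (env : nat -> free_car) (t : pterm ar void nat) e :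
  sval (peval free_op (@of_void _) env t) e = ground (fun n => sval (env n) e) t.
Proof.
rewrite /ground; elim: t => [v|[]|i ts IH] //=.
by congr (fop A i _); apply: functional_extensionality => j; apply: IH.
Qed.

Lemma free_satisfies : satisfies_ids_of A free_op.
Proof.
move=> t1 t2 t12 e; apply: free_eq => e'; rewrite !free_peval; exact: t12.
Qed.

Definition fclass (t : pterm ar void nat) : free_car :=
  exist _ (fun e => ground e t) (ex_intro _ t (fun e => erefl)).

(** The kernel of the endomorphism that substitutes variable [r n] for variable [n]. *)
Definition rker (r : nat -> nat) (f g : free_car) : Prop :=
  forall e, sval f (e \o r) = sval g (e \o r).

Lemma rker_congruence r : is_congruence free_op (rker r).
Proof.
split.
- by move=> x e.
- by move=> x y xy e; rewrite xy.
- by move=> x y z xy yz e; rewrite xy.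
- move=> i x y xy e /=; congr (fop A i _).
  by apply: functional_extensionality => j; apply: xy.
Qed.

End FreeAlgebra.

(** * Day terms from the modular law *)

Definition env3 (T : Type) (x y z : T) (n : nat) : T :=
  match n with 0 => x | 1 => y | _ => z end.
Definition env4 (T : Type) (x y z u : T) (n : nat) : T :=
  match n with 0 => x | 1 => y | 2 => z | _ => u end.

Section Day.
Variables (I : Type) (ar : I -> nat) (A : falg ar).
Hypothesis modA : gen_variety_cong_modular A.

Definition day_link (t t' : pterm ar void nat) : Prop :=
  [/\ (forall x y, ground (A := A) (env4 x y y x) t = x),
      (forall x y, ground (A := A) (env4 x y y x) t' = x) &
      (forall x y u, ground (A := A) (env4 x y y u) t = ground (env4 x y y u) t') \/
      (forall x u, ground (A := A) (env4 x x u u) t = ground (env4 x x u u) t')].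

(** Day's argument: [X 0] and [X 3] are connected through [rb], [ra], [rb] and are related by [rc],
    which lies above [ra]. The modular law moves the meet with [rc] inside the join, and the terms
    along the resulting chain are the Day terms. *)
Lemma day_terms : exists t,
  (forall e : nat -> fcar A, ground e t = e 3) /\
  clos_refl_trans _ day_link (PVar ar void 0) t.
Proof.
pose o := free_op (A := A).
pose ra := fun n => if n == 2 then 1 else n.
pose rb := fun n => if n == 1 then 0 else if n == 2 then 3 else n.
pose rc := fun n => if n == 3 then 0 else if n == 2 then 1 else n.
pose X n := fclass A (PVar ar void n).
have lec f g : rker (A := A) ra f g -> rker rc f g.
  move=> fg e.
  have E : e \o rc = (e \o (fun n => if n == 3 then 0 else n)) \o ra.
    apply: functional_extensionality => n /=; rewrite /rc /ra.
    by case: (n =P 3) => [->|] //=; case: (n =P 2) => //= _ /eqP/negbTE ->.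
  by rewrite E.
have C : cjoin o (rker ra) (cmeet (rker rb) (rker rc)) (X 0) (X 3).
  apply: (proj2 (modA (@free_satisfies _ _ A) (rker_congruence A ra)
    (rker_congruence A rb) (rker_congruence A rc) lec _ _)); split => //.
  case: (cjoin_congruence o (rker ra) (rker rb)) => _ _ tr _.
  apply: (tr _ (X 1)); first exact: cjoinr.
  apply: (tr _ (X 2)); [exact: cjoinl|exact: cjoinr].
have env4c (x y : fcar A) : env4 x y y x = env4 x y y x \o rc.
  by apply: functional_extensionality => -[|[|[|[|n]]]].
have env4a (x y u : fcar A) : env4 x y y u = env4 x y y u \o ra.
  by apply: functional_extensionality => -[|[|[|[|n]]]].
have env4b (x u : fcar A) : env4 x x u u = env4 x x u u \o rb.
  by apply: functional_extensionality => -[|[|[|[|n]]]].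
have := cjoin_chain (rker_congruence A ra)
     (cmeet_congruence (rker_congruence A rb) (rker_congruence A rc)) C.
(* Being [rc]-related to [X 0] is carried along the chain, since it is what gives every term the
   identity [t x y y x = x]. *)
suff H f g : clos_refl_trans (free_car A)
      (fun x y => rker ra x y \/ cmeet (rker rb) (rker rc) x y) f g ->
    rker rc (X 0) f -> rker rc (X 0) g /\
    forall t, (forall e, sval f e = ground e t) ->
    exists t', (forall e, sval g e = ground e t') /\ clos_refl_trans _ day_link t t'.
  move/H => [] // _ /(_ (PVar ar void 0)) [] // t [tE tP].
  by exists t; split => // e; rewrite -tE.
elim=> {f g} [f g fg cf|f cf|f g h _ IH1 _ IH2 cf].
- have cg : rker rc (X 0) g by move=> e; rewrite cf; case: fg => [/lec|[_]]; apply.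
  split => // t tE; have [t' tE'] := proj2_sig g; exists t'; split => //.
  apply: rt_step; split.
  + by move=> x y; rewrite -tE env4c -cf.
  + by move=> x y; rewrite -tE' env4c -cg.
  + case: fg => [fg|[fg _]]; [left|right].
      by move=> x y u; rewrite -tE -tE' env4a fg.
    by move=> x u; rewrite -tE -tE' env4b fg.
- by split=> // t tE; exists t; split => //; apply: rt_refl.
- have [cg] := IH1 cf; have [ch G H] := IH2 (IH1 cf).1.
  split => // t /H [t' [tE' tt']]; have [t'' [tE'' tt'']] := G _ tE'.
  by exists t''; split => //; apply: rt_trans tt' tt''.
Qed.

End Day.

(** * Gumm terms *)

Section Gumm.
Variables (I : Type) (ar : I -> nat) (A : falg ar).
Hypothesis modA : gen_variety_cong_modular A.

Local Notation F := (free_car A).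
Local Notation o := (free_op (A := A)).
Local Notation x := (fclass A (PVar ar void 0)).
Local Notation y := (fclass A (PVar ar void 1)).
Local Notation z := (fclass A (PVar ar void 2)).

(** Kernels of the substitutions that identify [x] with [z] ([al]), [x] with [y] ([be]), and [y]
    with [z] ([ga]). *)
Let ra n := if n == 2 then 0 else n.
Let rb n := if n == 1 then 0 else n.
Let rg n := if n == 2 then 1 else n.
Let al : F -> F -> Prop := rker ra.
Let be : F -> F -> Prop := rker rb.
Let ga : F -> F -> Prop := rker rg.
Let de : F -> F -> Prop := cjoin o (cmeet al be) (cmeet al ga).

Let m t (u1 u2 u3 u4 : F) : F := peval o (@of_void _) (env4 u1 u2 u3 u4) t.

Let m_eval t u1 u2 u3 u4 e :
  sval (m t u1 u2 u3 u4) e =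
  ground (env4 (sval u1 e) (sval u2 e) (sval u3 e) (sval u4 e)) t.
Proof.
rewrite free_peval /ground; apply: eq_peval => //.
by case=> [|[|[|n]]].
Qed.

Let m_cong th t u1 u2 u3 u4 v1 v2 v3 v4 : is_congruence o th ->
  th u1 v1 -> th u2 v2 -> th u3 v3 -> th u4 v4 ->
  th (m t u1 u2 u3 u4) (m t v1 v2 v3 v4).
Proof. by move=> cth *; apply: peval_cong => // -[|[|[|n]]]. Qed.

Let alC : is_congruence o al := rker_congruence A ra.
Let beC : is_congruence o be := rker_congruence A rb.
Let gaC : is_congruence o ga := rker_congruence A rg.
Let deC : is_congruence o de := cjoin_congruence o _ _.

Let cr th u : is_congruence o th -> th u u. Proof. by case. Qed.
Let cs th u v : is_congruence o th -> th u v -> th v u.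
Proof. by case=> _ + _ _; apply. Qed.
Let ct th v u w : is_congruence o th -> th u v -> th v w -> th u w.
Proof. by case=> _ _ + _; apply. Qed.

Let de_al u v : de u v -> al u v.
Proof. by apply; [exact: alC| |] => ? ? []. Qed.

(** Gumm's Shifting Lemma: the modular law for [de] below [al] moves the meet with [al] inside the
    join of [de] and [ka], where it is absorbed by [de]. *)
Let shift ka u v u' v' : is_congruence o ka ->
  (forall a b, al a b -> ka a b -> de a b) ->
  ka u v -> de v v' -> ka v' u' -> al u u' -> de u u'.
Proof.
move=> kaC kade uv vv' vu' uu'.
have : cjoin o de (cmeet ka al) u u'.
  apply: (proj2 (modA (@free_satisfies _ _ A) deC kaC alC de_al _ _)); split => //.
  have jC := cjoin_congruence o de ka.
  apply: (ct jC (cjoinr uv)); apply: (ct jC (cjoinl vv')); exact: cjoinr.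
by apply => // a b [kab aab]; apply: kade.
Qed.

Let be_de a b : al a b -> be a b -> de a b.
Proof. by move=> ? ?; apply: cjoinl; split. Qed.
Let ga_de a b : al a b -> ga a b -> de a b.
Proof. by move=> ? ?; apply: cjoinr; split. Qed.

(* [al] centralises the join of [be] and [ga] modulo [de]: the varying entry is
   moved from [z] to [x] through [y]. *)
Let transfer (f g : F -> F) :
  (forall th u v, is_congruence o th -> th u v -> th (f u) (f v)) ->
  (forall th u v, is_congruence o th -> th u v -> th (g u) (g v)) ->
  (forall u, al (f u) (g u)) -> de (f z) (g z) -> de (f x) (g x).
Proof.
move=> fC gC fg fgz.
have fgy : de (f y) (g y).
  by apply: (shift gaC ga_de _ fgz) => //;
    [apply: (fC _ _ _ gaC)|apply: (gC _ _ _ gaC); apply: (cs gaC)].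
by apply: (shift beC be_de _ fgy) => //;
    [apply: (fC _ _ _ beC)|apply: (gC _ _ _ beC); apply: (cs beC)].
Qed.

Local Ltac congr_m C := apply: (m_cong _ C) => //; try exact: (cr _ C).

(** For [w] equal to [x], the element [p] is the Gumm term with [p x x z = z], and [d] is the end of
    the chain of links. *)
Let reachable w := exists p d, [/\ be p z, ga p d & de d w].

(** The old witnesses are put into the two outer places of [t], where [t u v v u = u] keeps the
    [be]-class of [z]. For the [de]-step, [transfer] moves the second argument from [z] to [x]: at
    [z] both expressions equal [a]. *)
Let reach_AB t : (forall u v, m t u v v u = u) ->
  reachable (m t z z x x) -> reachable (m t z y y x).
Proof.
move=> tid [p [d [pz pd dw]]]; set a := m t z z x x in dw.
have az : al a z by rewrite -[z in al _ z](tid z z); congr_m alC.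
exists (m t p x y p), (m t d x z d); split.
- by rewrite -[z](tid z x); congr_m beC; exact: (cs beC).
- by congr_m gaC.
apply: (@ct de (m t a x z a) _ _ deC); first by congr_m deC.
apply: (@ct de (m t z x x x) _ _ deC); last first.
  apply: be_de; last by congr_m beC.
  apply: (@ct al z _ _ alC).
    by rewrite -[z in al _ z](tid z x); congr_m alC.
  by rewrite -[z in al z _](tid z y); congr_m alC.
apply: (transfer (f := fun s => m t a s z a) (g := fun s => m t z s x x)).
- by move=> th u v thC uv; congr_m thC.
- by move=> th u v thC uv; congr_m thC.
- move=> u; have ax : al a x by apply: (ct alC az); apply: (cs alC).
  by congr_m alC; apply: (cs alC).
- by rewrite tid; apply: (cr _ deC).
Qed.

(** The same construction with the third argument varied. The common value at [z] is now [b], which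
    is reached from the given element by a [ga]-step inside [al]. *)
Let reach_BA t : (forall u v, m t u v v u = u) ->
  reachable (m t z y y x) -> reachable (m t z z x x).
Proof.
move=> tid [p [d [pz pd dw]]]; set b := m t z z z x.
have bz : al b z by rewrite -[z in al _ z](tid z z); congr_m alC.
have db : de d b.
  apply: (ct deC dw); apply: ga_de; last by congr_m gaC.
  apply: (@ct al z _ _ alC); last exact: (cs alC).
  by rewrite -[z in al _ z](tid z y); congr_m alC.
exists (m t p y x p), (m t d z x d); split.
- by rewrite -[z](tid z x); congr_m beC; exact: (cs beC).
- by congr_m gaC.
apply: (@ct de (m t b z x b) _ _ deC); first by congr_m deC.
apply: (transfer (f := fun s => m t b z s b) (g := fun s => m t z z s x)).
- by move=> th u v thC uv; congr_m thC.
- by move=> th u v thC uv; congr_m thC.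
- move=> u; have bx : al b x by apply: (ct alC bz); apply: (cs alC).
  by congr_m alC.
- by rewrite tid; apply: (cr _ deC).
Qed.

Definition gumm_link (t t' : pterm ar void nat) : Prop :=
  [/\ (forall x y, ground (A := A) (env3 x y x) t = x),
      (forall x y, ground (A := A) (env3 x y x) t' = x) &
      (forall x z, ground (A := A) (env3 x x z) t = ground (env3 x x z) t') \/
      (forall x y, ground (A := A) (env3 x y y) t = ground (env3 x y y) t')].

Lemma gumm_terms : exists p d,
  [/\ (forall x z : fcar A, ground (env3 x x z) p = z),
      (forall x y : fcar A, ground (env3 x y y) p = ground (env3 x y y) d) &
      clos_refl_trans _ gumm_link (PVar ar void 0) d].
Proof.
have [t [tE tchain]] := day_terms modA.
have day_id t' : (forall x y, ground (A := A) (env4 x y y x) t' = x) ->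
    forall u v, m t' u v v u = u.
  by move=> H u v; apply: free_eq => e; rewrite m_eval H.
have reach t0 t1 : clos_refl_trans _ (day_link A) t0 t1 ->
    reachable (m t0 z y y x) -> reachable (m t1 z y y x).
  elim=> {t0 t1} [t0 t1 [id0 id1 L] R0|//|t0 t1 t2 _ IH1 _ IH2 /IH1/IH2 //].
  case: L => L.
    suff <- : m t0 z y y x = m t1 z y y x by [].
    by apply: free_eq => e; rewrite !m_eval L.
  apply: reach_AB; first exact: day_id.
  suff <- : m t0 z z x x = m t1 z z x x by apply: reach_BA => //; apply: day_id.
  by apply: free_eq => e; rewrite !m_eval L.
(* The Day chain begins at the first projection, whose value here is [z], trivially reachable, and
   ends at the last projection, whose value is [x]. *)
have [p [d [pz pd dx]]] : reachable (m t z y y x).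
  apply: (reach _ _ tchain); exists z, z; split => //; exact: (cr _ deC).
have {}dx : de x d.
  apply: (cs deC); suff <- : m t z y y x = x by [].
  by apply: free_eq => e; rewrite m_eval tE.
have env_a (a b : fcar A) : env3 a b a = env3 a b a \o ra.
  by apply: functional_extensionality => -[|[|[|n]]].
have env_b (a c : fcar A) : env3 a a c = env3 a a c \o rb.
  by apply: functional_extensionality => -[|[|[|n]]].
have env_g (a b : fcar A) : env3 a b b = env3 a b b \o rg.
  by apply: functional_extensionality => -[|[|[|n]]].
have chain := cjoin_chain (cmeet_congruence alC beC) (cmeet_congruence alC gaC) dx.
suff H f g : clos_refl_trans F (fun u v => cmeet al be u v \/ cmeet al ga u v) f g ->
    al x f -> al x g /\
    forall t, (forall e, sval f e = ground e t) ->
    exists t', (forall e, sval g e = ground e t') /\ clos_refl_trans _ gumm_link t t'.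
  have [//|_ /(_ (PVar ar void 0)) [//|td [tdE tdP]]] := H _ _ chain.
  have [tp tpE] := proj2_sig p; exists tp, td; split => //.
  - by move=> a c; rewrite -tpE env_b pz.
  - by move=> a b; rewrite -tpE -tdE env_g pd.
elim=> {f g} [f g fg cf|f cf|f g h _ IH1 _ IH2 cf].
- have cg : al x g by apply: (ct alC cf); case: fg => -[].
  split => // t0 tE0; have [t1 tE1] := proj2_sig g; exists t1; split => //.
  apply: rt_step; split.
  + by move=> a b; rewrite -tE0 env_a -cf.
  + by move=> a b; rewrite -tE1 env_a -cg.
  + case: fg => [[_ fg]|[_ fg]]; [left|right].
      by move=> a c; rewrite -tE0 -tE1 env_b fg.
    by move=> a b; rewrite -tE0 -tE1 env_g fg.
- by split=> // t0 tE0; exists t0; split => //; apply: rt_refl.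
- have [cg H] := IH1 cf; have [ch G] := IH2 cg.
  split => // t0 /H [t1 [tE1 tt1]]; have [t2 [tE2 tt2]] := G _ tE1.
  by exists t2; split => //; apply: rt_trans tt1 tt2.
Qed.

End Gumm.

(** * Supernilpotent algebras *)

Section Polynomials.
Variables (I : Type) (ar : I -> nat) (T : Type) (o : ops_t ar T).

Definition poly (V : Type) (g : (V -> T) -> T) : Prop :=
  exists f : pterm ar T V, forall e, peval o id e f = g e.

Lemma poly_var (V : Type) (v : V) : poly (fun e => e v).
Proof. by exists (PVar _ _ v). Qed.

Lemma poly_const (V : Type) (c : T) : poly (fun _ : V -> T => c).
Proof. by exists (PConst _ _ c). Qed.

Fixpoint psubst (C C' V V' : Type) (c : C -> pterm ar C' V') (s : V -> pterm ar C' V')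
    (t : pterm ar C V) : pterm ar C' V' :=
  match t with
  | PVar v => s v
  | PConst a => c a
  | POp i ts => POp (fun j => psubst c s (ts j))
  end.

Lemma peval_psubst (C C' V V' : Type) (c : C -> pterm ar C' V')
    (s : V -> pterm ar C' V') (d : C' -> T) (e : V' -> T) (t : pterm ar C V) :
  peval o d e (psubst c s t) =
  peval o (fun a => peval o d e (c a)) (fun v => peval o d e (s v)) t.
Proof.
elim: t => [v|a|i ts IH] //=.
by congr (o _); apply: functional_extensionality => j; apply: IH.
Qed.

Definition term3 (t : pterm ar void nat) (x y z : T) : T :=
  peval o (@of_void _) (env3 x y z) t.

(** A closure property in place of a term: it passes to nested and iterated compositions, from which
    the cubes below are built. *)
Definition poly_stable (J : T -> T -> T -> T) : Prop :=
  forall (V : Type) (g1 g2 g3 : (V -> T) -> T),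
    poly g1 -> poly g2 -> poly g3 -> poly (fun e => J (g1 e) (g2 e) (g3 e)).

Lemma poly_stable_term3 t : poly_stable (term3 t).
Proof.
move=> V g1 g2 g3 [f1 f1E] [f2 f2E] [f3 f3E].
exists (psubst (@of_void _) (env3 f1 f2 f3) t) => e; rewrite peval_psubst.
by apply: eq_peval => [[]|[|[|n]]] /=.
Qed.

Lemma poly_pterm (C V W : Type) (c : C -> T) (r : V -> W) (t : pterm ar C V) :
  poly (fun e => peval o c (fun v => e (r v)) t).
Proof.
exists (psubst (fun a => PConst _ _ (c a)) (fun v => PVar _ _ (r v)) t) => e.
by rewrite peval_psubst.
Qed.

End Polynomials.

Section Supernilpotent.
Variables (I : Type) (ar : I -> nat) (T : Type) (o : ops_t ar T) (k : nat).
Hypothesis snil : k_supernilpotent o k.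

(** The term condition passes to the intersection of all congruences that satisfy it, and
    supernilpotency says that this intersection is equality. *)
Lemma snil_term_cond : term_cond o (nseq k.+1 (@total_rel T)) eq.
Proof.
move=> f a b ab env ev H; apply: snil => d dC tc.
apply: (tc f a b ab) => s Hs; change (d (ev s false) (ev s true)).
by rewrite H //; case: dC.
Qed.

Definition cube_env (a b : nat -> nat -> T) (s : nat -> bool) (v : nat * nat) : T :=
  if (v.1 <= k) && s v.1 then b v.1 v.2 else a v.1 v.2.

(** The form in which supernilpotency is used from here on. The last block, singled out in the term
    condition, is treated like the others, and all values off the top are assumed equal. *)
Lemma snil_cube (g : (nat * nat -> T) -> T) (a b : nat -> nat -> T) (c : T) :
  poly o g ->
  (forall s : nat -> bool, (exists2 i, i <= k & s i = false) ->
     g (cube_env a b s) = c) ->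
  g (cube_env a b xpredT) = c.
Proof.
move=> [f fE] H.
pose env (s : nat -> bool) (t : bool) (v : nat * nat) : T :=
  let: (i, j) := v in
  if i < k then (if s i then b i j else a i j)
  else if (i == k) && true then (if t then b i j else a i j) else a i j.
have E : (forall s : nat -> bool, (exists2 i, i < k & s i = false) ->
      peval o id (env s false) f = peval o id (env s true) f) ->
    peval o id (env xpredT false) f = peval o id (env xpredT true) f.
  have := @snil_term_cond f a b; rewrite size_nseq; apply.
  by move=> i j lik; rewrite nth_nseq lik.
have envE s t : env s t = cube_env a b (fun i => if i == k then t else s i).
  apply: functional_extensionality => -[i j]; rewrite /env /cube_env /= andbT [i <= k]leq_eqVlt.
  by case: (i =P k) => [->|_] /=; rewrite ?ltnn //=; case: ltnP.
rewrite !envE !fE in E.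
have <- : cube_env a b (fun i => if i == k then true else true) = cube_env a b xpredT.
  by congr cube_env; apply: functional_extensionality => i; case: ifP.
rewrite -E.
- by apply: H; exists k; rewrite ?eqxx.
- move=> s [i lik si]; rewrite !envE !fE !H //.
  + by exists i; [apply: ltnW|rewrite ltn_eqF].
  + by exists i; [apply: ltnW|rewrite ltn_eqF].
Qed.

Section Links.
Variable J : T -> T -> T -> T.
Hypothesis Jpoly : poly_stable o J.

Lemma poly_foldr (V : Type) (K : T -> T -> T -> T) (x : T)
    (y : nat -> (V -> T) -> T) (z : (V -> T) -> T) (qs : seq nat) :
  poly_stable o K -> (forall q, poly o (y q)) -> poly o z ->
  poly o (fun e => foldr (fun q acc => K x (y q e) acc) (z e) qs).
Proof.
move=> Kp yp zp; elim: qs => [|q qs IH] //=.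
by apply: Kp => //; apply: poly_const.
Qed.

Lemma foldr_fixed (K : T -> T -> T -> T) (x : T) (y : nat -> T) (qs : seq nat) :
  (forall y, K x y x = x) -> foldr (fun q acc => K x (y q) acc) x qs = x.
Proof. by move=> Kx; elim: qs => //= q qs ->. Qed.

Hypothesis Jid : forall x y, J x y x = x.
Let V x z := J x x z.
Let U x y := J x y y.

(** The polynomial nests [k * m] copies of [J x y_q _] around [z], with [m] consecutive entries per
    block. At the top every entry equals the value inside it, which gives the iterate of [U x].
    Resetting a block to [x] creates [m] consecutive steps of [V x], which yield [x]; resetting [z]
    yields [x] too, and [J x y x = x] carries it outwards. *)
Lemma nil_VU : (exists m, forall x z, iter m (V x) z = x) ->
  exists m, forall x z, iter m (U x) z = x.
Proof.
case=> m Vm; exists (k * m) => x w.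
pose M := k * m.
pose y q (e : nat * nat -> T) := e (q %/ m, q).
pose z (e : nat * nat -> T) := e (k, 0).
pose g e := foldr (fun q acc => J x (y q e) acc) (z e) (iota 0 M).
pose a (i j : nat) := x.
pose b i j := if i == k then w else iter (M - j.+1) (U x) w.
have gp : poly o g.
  by apply: poly_foldr => //; [move=> q|]; apply: poly_var.
have top n : n <= M -> foldr (fun q acc => J x (y q (cube_env a b xpredT)) acc)
      w (iota (M - n) n) = iter n (U x) w.
  elim: n => //= n IH lenM; rewrite subnSK // IH; last exact: ltnW.
  have m0 : 0 < m by move: lenM; rewrite /M; case: (m); rewrite ?muln0.
  have lik : (M - n.+1) %/ m < k.
    by rewrite ltn_divLR // ltn_subrL /= (leq_ltn_trans _ lenM).
  by rewrite /y /cube_env /= (ltnW lik) /= /b ltn_eqF // subnSK // subKn // ltnW.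
have zE s : z (cube_env a b s) = if s k then w else x.
  by rewrite /z /cube_env leqnn /= /b eqxx.
have <- : g (cube_env a b xpredT) = iter (k * m) (U x) w.
  by rewrite /g zE -(top M) // subnn.
apply: snil_cube => // s [i lik si].
rewrite /g zE.
have [ik|nik] := eqVneq i k.
  by rewrite -ik si; apply: foldr_fixed.
have {nik}lik : i < k by rewrite ltn_neqAle nik.
have -> : iota 0 M = iota 0 (i * m) ++ iota (i * m) m ++ iota (i.+1 * m) ((k - i.+1) * m).
  rewrite (mulSn i) addnC -iotaD -iotaD; congr iota.
  by rewrite addnA -mulSnr -mulnDl subnKC.
rewrite !foldr_cat; set w0 := foldr _ _ (iota (i.+1 * m) _).
suff -> : foldr (fun q acc => J x (y q (cube_env a b s)) acc) w0 (iota (i * m) m) = x.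
  exact: foldr_fixed.
have H qs : {subset qs <= [pred q | q %/ m == i]} ->
    foldr (fun q acc => J x (y q (cube_env a b s)) acc) w0 qs = iter (size qs) (V x) w0.
  elim: qs => //= q qs IH sub.
  have /eqP qi : q \in [pred q | q %/ m == i] by apply: sub; rewrite inE eqxx.
  rewrite IH; last by move=> q' q'qs; apply: sub; rewrite inE q'qs orbT.
  by rewrite /y /cube_env /= qi si andbF.
rewrite H ?size_iota ?Vm // => q; rewrite mem_iota => /andP[l1 l2]; rewrite inE eqn_leq.
have m0 : 0 < m by move: (leq_ltn_trans l1 l2); case: (m); rewrite ?addn0 ?ltnn.
by rewrite leq_divRL // l1 andbT -ltnS ltn_divLR // mulSn addnC.
Qed.

(** [K] nests [m] copies of [J] so that [K x y y = x] holds outright, while [K x x] is still an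
    iterate of [V x]. In the cube over [k] nested copies of [K], the base value of an entry is the
    value that stands inside it at the top. *)
Lemma nil_UV : (exists m, forall x z, iter m (U x) z = x) ->
  exists m, forall x z, iter m (V x) z = x.
Proof.
case=> m Um.
pose K x y z := foldr (fun q acc => J x (iter (m - q.+1) (U x) y) acc) z (iota 0 m).
have Ux x : U x x = x by rewrite /U Jid.
have iUx n x : iter n (U x) x = x by elim: n => //= n ->.
have Kp : poly_stable o K.
  move=> W g1 g2 g3 p1 p2 p3; rewrite /K.
  elim: (iota 0 m) => //= q qs IH; apply: Jpoly => //.
  by elim: (m - q.+1) => //= n IHn; apply: Jpoly.
have Kx x y : K x y x = x by apply: foldr_fixed.
have KV x z : K x x z = iter m (V x) z.
  rewrite /K -[in RHS](size_iota 0 m); elim: (iota 0 m) => //= q qs ->.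
  by rewrite iUx.
have KU x y : K x y y = x.
  rewrite -[RHS](Um x y) /K.
  have H n : n <= m -> foldr (fun q acc => J x (iter (m - q.+1) (U x) y) acc) y
      (iota (m - n) n) = iter n (U x) y.
    elim: n => //= n IH len; rewrite subnSK // IH; last exact: ltnW.
    by rewrite subKn // ltnW.
  by have := H m; rewrite subnn => ->.
exists (k * m) => x w; rewrite iterM.
have WE : iter k (iter m (V x)) w = iter k (K x x) w by apply: eq_iter => u; rewrite KV.
rewrite WE.
pose y q (e : nat * nat -> T) := e (q, 0).
pose z (e : nat * nat -> T) := e (k, 0).
pose g e := foldr (fun q acc => K x (y q e) acc) (z e) (iota 0 k).
pose a (i j : nat) := if i == k then x else iter (k - i.+1) (K x x) w.
pose b (i j : nat) := if i == k then w else x.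
have gp : poly o g.
  by apply: poly_foldr => //; [move=> q|]; apply: poly_var.
have tail (s : nat -> bool) n : n <= k -> (forall i, k - n <= i < k -> s i) ->
    foldr (fun q acc => K x (y q (cube_env a b s)) acc) w (iota (k - n) n)
    = iter n (K x x) w.
  elim: n => //= n IH lenk sn; rewrite subnSK // IH; first last.
  - by move=> i /andP[l1 l2]; apply: sn; rewrite l2 (leq_trans _ l1) // leq_sub2l.
  - exact: ltnW.
  have lt : k - n.+1 < k by rewrite ltn_subrL /= (leq_ltn_trans _ lenk).
  by rewrite /y /cube_env /= (ltnW lt) sn ?leqnn //= /b ltn_eqF.
have zE s : z (cube_env a b s) = if s k then w else x.
  by rewrite /z /cube_env leqnn /= /a /b eqxx.
have <- : g (cube_env a b xpredT) = iter k (K x x) w.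
  by rewrite /g zE -(tail xpredT k) // subnn.
apply: snil_cube => // s [i lik si].
rewrite /g zE.
case: (boolP (s k)) => sk; last exact: foldr_fixed.
have {lik}lik : i < k.
  by rewrite ltn_neqAle lik andbT; apply: contraL sk => /eqP <-; rewrite si.
(* Inside the innermost entry left at its base value everything evaluates to that
   base value, so [KU] collapses the expression there. *)
have [i0 [lik0 si0 max]] : exists i0, [/\ i0 < k, s i0 = false & forall i, i0 < i < k -> s i].
  have ex : exists i, (i < k) && ~~ s i by exists i; rewrite lik si.
  have bd j : (j < k) && ~~ s j -> j <= k by case/andP => /ltnW.
  case: (ex_maxnP ex bd) => i0 /andP[l0 /negbTE s0] mx; exists i0; split => // j /andP[l1 l2].
  apply: contraLR l1 => nsj; rewrite -leqNgt; apply: mx; by rewrite l2.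
have -> : iota 0 k = iota 0 i0 ++ i0 :: iota i0.+1 (k - i0.+1).
  by rewrite -[i0 :: _]/(iota i0 (k - i0.+1).+1) subnSK // -iotaD subnKC // ltnW.
have := tail s (k - i0.+1) (leq_subr _ _); rewrite subKn // => tl.
rewrite foldr_cat /= tl //.
rewrite {2}/y /cube_env /= (ltnW lik0) si0 /= /a ltn_eqF // KU.
exact: foldr_fixed.
Qed.

End Links.
End Supernilpotent.

(** * Maltsev operations and cubes of values *)

Section Maltsev.
Variables (I : Type) (ar : I -> nat) (T : Type) (o : ops_t ar T).

(** On the diagonal [y = z] this is the [r]-th iterate of [y |-> p x y y], and [p x x z = z]
    survives the nesting; once that iterate is the constant [x], the result is a Maltsev
    operation. *)
Fixpoint iter_diff (p : T -> T -> T -> T) (r : nat) (x y z : T) : T :=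
  if r is r'.+1 then p x (iter_diff p r' x y y) (iter_diff p r' x y z) else z.

Lemma iter_diff_xxz p r x z : (forall x z, p x x z = z) -> iter_diff p r x x z = z.
Proof. by move=> pxxz; elim: r z => //= r IH z; rewrite !IH. Qed.

Lemma iter_diff_xyy p r x y : iter_diff p r x y y = iter r (fun y => p x y y) y.
Proof. by elim: r => //= r ->. Qed.

Lemma poly_stable_iter_diff p r : poly_stable o p -> poly_stable o (iter_diff p r).
Proof.
move=> pp V g1 g2 g3 p1 p2 p3; elim: r g3 p3 => //= r IH g3 p3.
by apply: pp => //; apply: IH.
Qed.

Definition maltsev (M : T -> T -> T -> T) : Prop :=
  [/\ poly_stable o M, forall x z, M x x z = z & forall x y, M x y y = x].

Variable k : nat.
Hypothesis snil : k_supernilpotent o k.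
Variable M : T -> T -> T -> T.
Hypothesis malM : maltsev M.

Definition vertex (bl : nat -> nat) (e0 e1 : nat -> T) (s : nat -> bool) (v : nat) : T :=
  if (bl v <= k) && s (bl v) then e1 v else e0 v.

(** Apply the cube property to [M u v c0], where [u] and [v] are the two values at a vertex and [c0]
    is the second top value. Off the top [u = v] gives [c0], so the top value [M u c0 c0 = u] is
    [c0] too. *)
Lemma cube_top_determined (C : Type) (c : C -> T) (t : pterm ar C nat)
    (bl bl' : nat -> nat) (e0 e1 e0' e1' : nat -> T) :
  (forall s : nat -> bool, (exists2 i, i <= k & s i = false) ->
     peval o c (vertex bl e0 e1 s) t = peval o c (vertex bl' e0' e1' s) t) ->
  peval o c (vertex bl e0 e1 xpredT) t = peval o c (vertex bl' e0' e1' xpredT) t.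
Proof.
case: malM => Mp Mxxz Mxyy H.
set c0 := RHS.
(* Both cubes share one family of variables, the first on even and the second on odd indices. *)
pose a (i j : nat) := if odd j then e0' j./2 else e0 j./2.
pose b (i j : nat) := if odd j then e1' j./2 else e1 j./2.
pose g e := M (peval o c (fun v => e (bl v, v.*2)) t)
              (peval o c (fun v => e (bl' v, v.*2.+1)) t) c0.
have gE s : g (cube_env k a b s) =
    M (peval o c (vertex bl e0 e1 s) t) (peval o c (vertex bl' e0' e1' s) t) c0.
  rewrite /g; congr (M _ _ _); apply: eq_peval => // v.
    by rewrite /cube_env /vertex /a /b /= odd_double doubleK.
  by rewrite /cube_env /vertex /a /b /= odd_double /= uphalf_double.
have gp : poly o g.
  by apply: Mp; [apply: (@poly_pterm _ _ _ o _ _ _ c (fun v => (bl v, v.*2)))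
    |apply: (@poly_pterm _ _ _ o _ _ _ c (fun v => (bl' v, v.*2.+1)))
    |apply: poly_const].
have := snil_cube snil (c := c0) gp (a := a) (b := b).
rewrite gE -/c0 Mxyy; apply => s /H E; by rewrite gE E Mxxz.
Qed.

(** Exchanging [e0] and [e1] on the blocks in use reflects the cube and turns its bottom into the
    top. *)
Lemma cube_bottom_determined (C : Type) (c : C -> T) (t : pterm ar C nat)
    (bl bl' : nat -> nat) (e0 e1 e0' e1' : nat -> T) :
  (forall s : nat -> bool, (exists2 i, i <= k & s i = true) ->
     peval o c (vertex bl e0 e1 s) t = peval o c (vertex bl' e0' e1' s) t) ->
  peval o c (vertex bl e0 e1 xpred0) t = peval o c (vertex bl' e0' e1' xpred0) t.
Proof.
move=> H.
pose flip (bl : nat -> nat) (e e' : nat -> T) v := if bl v <= k then e v else e' v.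
have fE bl0 f0 f1 s : vertex bl0 (flip bl0 f1 f0) f0 s =
    vertex bl0 f0 f1 (fun i => ~~ s i).
  apply: functional_extensionality => v; rewrite /vertex /flip.
  by case: leqP => //= _; case: (s _).
have := @cube_top_determined _ c t bl bl' (flip bl e1 e0) e0 (flip bl' e1' e0') e0'.
rewrite !fE; apply => s [i lik si]; rewrite !fE; apply: H.
by exists i => //; rewrite si.
Qed.

End Maltsev.

(** * Sparse solutions *)

Section Ramsey.
Variables (X : eqType) (C : finType).

Lemma pigeonhole_filter (f : X -> C) (r : nat) (s : seq X) :
  r * #|C| < size s -> exists c, r < size [seq x <- s | f x == c].
Proof.
move=> lt; apply/existsP; apply: contraLR lt => /existsPn H; rewrite -leqNgt.
have -> : size s = \sum_(c : C) size [seq x <- s | f x == c].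
  elim: s {H} => [|x s IH] /=; first by rewrite big1.
  rewrite IH (bigD1 (f x)) //= [in RHS](bigD1 (f x)) //= eqxx /= addSn.
  congr (_ + _).+1; apply: eq_bigr => c /negbTE; by rewrite eq_sym => ->.
rewrite mulnC -sum_nat_const; apply: leq_sum => c _.
by rewrite leqNgt; apply: H.
Qed.

Definition homogeneous (n : nat) (col : seq X -> C) (W : seq X) : Prop :=
  forall R R', subseq R W -> subseq R' W -> size R = n -> size R' = n -> col R = col R'.

Lemma homogeneous_sub n col W W' :
  subseq W' W -> homogeneous n col W -> homogeneous n col W'.
Proof.
move=> sub H R R' RW RW'.
by apply: H; apply: subseq_trans sub.
Qed.

(** Induction on the size of the coloured sublists: the list is thinned until the colour of [x :: R]
    depends on its first element only, and the pigeonhole principle then selects one colour. *)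
Lemma ramsey (n r : nat) : exists M, forall (col : seq X -> C) (s : seq X),
  uniq s -> M <= size s -> exists W, [/\ subseq W s, r <= size W & homogeneous n col W].
Proof.
elim: n r => [|n IHn] r.
  exists r => col s us les; exists s; split => // R R' _ _ /size0nil -> /size0nil ->.
  by [].
have E t : exists M, forall (col : seq X -> C) (s : seq X), uniq s -> M <= size s ->
    exists W (f : X -> C), [/\ subseq W s, t <= size W &
      forall x R, subseq (x :: R) W -> size R = n -> col (x :: R) = f x].
  elim: t => [|t [M HM]].
    exists 1 => col [//|x s] _ _; exists [::], (fun _ => col [::]); split => //.
  have [M' HM'] := IHn M; exists M'.+1 => col [//|x s] /= /andP[xs us]; rewrite ltnS => les.
  have [W' [W's lW' hW']] := HM' (fun R => col (x :: R)) s us les.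
  have [W [f [WW' lW fW]]] := HM col W' (subseq_uniq W's us) lW'.
  exists (x :: W).
  (* The colour attached to [x] is read off a sample, the first [n] elements of [W]; it matters only
     when [W] has that many. *)
  exists (fun y => if y == x then col (x :: take n W) else f y); split => //.
    by rewrite /= eqxx; apply: subseq_trans WW' W's.
  move=> y R yRW sR; case: eqP => [yx|/eqP yx]; last first.
    by apply: fW => //; move: yRW; rewrite /= (negbTE yx).
  move: yRW; rewrite yx /= eqxx => RW; have lenW : n <= size W.
    by rewrite -sR; apply: size_subseq.
  apply: (hW' R (take n W)) => //.
  - exact: subseq_trans RW WW'.
  - exact: subseq_trans (take_subseq _ _) WW'.
  - by rewrite size_takel.
have [M HM] := E (r * #|C|).+1; exists M => col s us les.
have [W [f [Ws lW fW]]] := HM col s us les.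
have [c ltc] := pigeonhole_filter f lW.
exists [seq x <- W | f x == c]; split.
- exact: subseq_trans (filter_subseq _ _) Ws.
- exact: ltnW.
suff col_c R : subseq R [seq x <- W | f x == c] -> size R = n.+1 -> col R = c.
  by move=> R R' h h' s1 s2; rewrite !col_c.
case: R => // x R h [sR]; rewrite fW //.
  have : x \in [seq x <- W | f x == c] by apply: (mem_subseq h); rewrite inE eqxx.
  by rewrite mem_filter => /andP[/eqP].
exact: subseq_trans h (filter_subseq _ _).
Qed.

Lemma ramsey_upto (n r : nat) : exists M, forall (col : seq X -> C) (s : seq X),
  uniq s -> M <= size s -> exists W, [/\ subseq W s, r <= size W &
    forall m, m <= n -> homogeneous m col W].
Proof.
elim: n r => [|n IH] r.
  have [M HM] := ramsey 0 r; exists M => col s us les.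
  have [W [? ? ?]] := HM col s us les; exists W; split => // m.
  by rewrite leqn0 => /eqP ->.
have [M HM] := IH r; have [M' HM'] := ramsey n.+1 M; exists M' => col s us les.
have [W [Ws lW hW]] := HM' col s us les.
have [W' [W'W lW' hW']] := HM col W (subseq_uniq Ws us) lW.
exists W'; split => //; first exact: subseq_trans W'W Ws.
move=> m; rewrite leq_eqVlt => /orP[/eqP ->|]; last by rewrite ltnS; apply: hW'.
exact: homogeneous_sub W'W hW.
Qed.

End Ramsey.

(** * Deleting variables from a solution *)

Section Sparse.
Variables (I : Type) (ar : I -> nat) (T : finType) (o : ops_t ar T) (k : nat).
Hypothesis snil : k_supernilpotent o k.
Variable M : T -> T -> T -> T.
Hypothesis malM : maltsev o M.
Variable zero : T.

Definition wipe (b : nat -> T) (R : seq nat) (v : nat) : T :=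
  if v \in R then zero else b v.

(** The variables wiped at a vertex: all of [B], and those of [X] in the directions chosen by [s],
    each variable of [X] being a direction of its own. *)
Definition subcube (B X : seq nat) (s : nat -> bool) : seq nat :=
  B ++ [seq v <- X | s (index v X)].

Lemma vertex_wipe b B X s : size X = k.+1 ->
  vertex k (index^~ X) (wipe b B) (fun _ => zero) s = wipe b (subcube B X s).
Proof.
move=> sX; apply: functional_extensionality => v.
rewrite /vertex /wipe /subcube mem_cat mem_filter -(index_mem v X) sX ltnS.
by case: (index v X <= k); case: (s _); case: (v \in B).
Qed.

Lemma size_subcube B X s : uniq X ->
  size (subcube B X s) = size B + count s (iota 0 (size X)).
Proof.
move=> uX; rewrite size_cat size_filter; congr (_ + _).
have <- : map (index^~ X) X = iota 0 (size X).
  apply: (@eq_from_nth _ 0); rewrite ?size_map ?size_iota // => i lti.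
  by rewrite (nth_map 0) // nth_iota // index_uniq.
by rewrite count_map.
Qed.

Section OneSystem.
Variables (C : Type) (c : C -> T) (t1 t2 : pterm ar C nat) (b : nat -> T).

Definition wiped_values (R : seq nat) : T * T :=
  (peval o c (wipe b R) t1, peval o c (wipe b R) t2).

Lemma wiped_top B X B' X' : size X = k.+1 -> size X' = k.+1 ->
  (forall s : nat -> bool, (exists2 i, i <= k & s i = false) ->
    wiped_values (subcube B X s) = wiped_values (subcube B' X' s)) ->
  wiped_values (subcube B X xpredT) = wiped_values (subcube B' X' xpredT).
Proof.
move=> sX sX' H.
by rewrite /wiped_values -!(vertex_wipe b) //; congr pair;
  apply: (cube_top_determined snil malM) => s /H; rewrite !vertex_wipe // => -[].
Qed.

Lemma wiped_bottom B X B' X' : size X = k.+1 -> size X' = k.+1 ->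
  (forall s : nat -> bool, (exists2 i, i <= k & s i = true) ->
    wiped_values (subcube B X s) = wiped_values (subcube B' X' s)) ->
  wiped_values (subcube B X xpred0) = wiped_values (subcube B' X' xpred0).
Proof.
move=> sX sX' H.
by rewrite /wiped_values -!(vertex_wipe b) //; congr pair;
  apply: (cube_bottom_determined snil malM) => s /H; rewrite !vertex_wipe // => -[].
Qed.

(** Beyond size [k], the value for [R] sits at the top of the cube spanned by the last [k.+1]
    elements of [R]. The other vertices wipe fewer variables, so by induction they agree for [R] and
    [R']. *)
Lemma homogeneous_all W : uniq W ->
  (forall m, m <= k -> homogeneous m wiped_values W) ->
  forall m, homogeneous m wiped_values W.
Proof.
move=> uW hW m; elim/ltn_ind: m => m IH R R' RW R'W sR sR'.
have [lemk|ltkm] := leqP m k; first exact: (hW m).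
pose B (R : seq nat) := take (m - k.+1) R; pose X (R : seq nat) := drop (m - k.+1) R.
have sX Q : size Q = m -> size (X Q) = k.+1 by move=> sQ; rewrite size_drop sQ subKn.
have sB Q : size Q = m -> size (B Q) = m - k.+1.
  by move=> sQ; rewrite size_takel // sQ leq_subr.
have full Q : subcube (B Q) (X Q) xpredT = Q by rewrite /subcube filter_predT cat_take_drop.
have sub Q s : subseq (subcube (B Q) (X Q) s) Q.
  by rewrite -{3}(cat_take_drop (m - k.+1) Q); apply: cat_subseq => //; apply: filter_subseq.
have uX Q : subseq Q W -> uniq (X Q).
  by move=> QW; apply/drop_uniq/(subseq_uniq QW).
rewrite -(full R) -(full R'); apply: wiped_top; [exact: sX|exact: sX|].
move=> s [i lik si].
have sz Q : subseq Q W -> size Q = m ->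
    size (subcube (B Q) (X Q) s) = m - k.+1 + count s (iota 0 k.+1).
  by move=> QW sQ; rewrite size_subcube ?uX // sX // sB.
apply: (IH (m - k.+1 + count s (iota 0 k.+1))); rewrite ?sz //.
- rewrite -[ltnRHS](subnK ltkm) ltn_add2l -{2}(size_iota 0 k.+1) ltn_neqAle count_size andbT.
  rewrite -all_count; apply/allPn; exists i; rewrite ?si //.
  by rewrite mem_iota.
- exact: subseq_trans (sub _ _) RW.
- exact: subseq_trans (sub _ _) R'W.
Qed.

End OneSystem.

(* On a homogeneous set the value depends on the number of wiped variables only;
   as a sequence in that number it obeys a reversible recurrence of order [k.+1],
   so it returns to its initial value. *)
Lemma wipe_some : exists Mx, forall (C : Type) (c : C -> T) (t1 t2 : pterm ar C nat)
    (b : nat -> T) (S : seq nat), uniq S -> Mx <= size S ->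
  exists R, [/\ subseq R S, 0 < size R &
    wiped_values c t1 t2 b R = wiped_values c t1 t2 b [::]].
Proof.
(* [Q] counts the possible windows of [k.+1] consecutive pairs of values. Of the [Q.+1] windows
   starting at [0], ..., [Q] two coincide, and the last of them reaches up to [Q + k]. *)
pose Q := #|{: T * T}| ^ k.+1.
have [Mx HM] := ramsey_upto nat (T * T)%type k (Q + k).
exists Mx => C c t1 t2 b S uS leS; set val := wiped_values c t1 t2 b.
have [W [WS lW hW]] := HM val S uS leS.
have uW := subseq_uniq WS uS.
have {}hW := homogeneous_all uW hW.
pose h n := val (take n W).
(* Equal windows at distance [t] can be moved down by one: the value just before a window is the
   bottom of a cube whose other vertices have their sizes inside the window. *)
have back n t : n + t + k <= size W -> (forall i, i <= k -> h (n + i) = h (n + t + i)) ->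
    h 0 = h t.
  elim: n => [|n IH] le H.
    by have := H 0 (leq0n _); rewrite !addn0.
  have len : n + t + k <= size W by apply: leq_trans le; rewrite !addSn ltnW.
  apply: IH => // -[|i] lik; last by rewrite !addnS; apply: H; apply: ltnW.
  rewrite !addn0.
  pose X n := take k.+1 (drop n W).
  have sX n' : n' + k < size W -> size (X n') = k.+1.
    by move=> l; rewrite size_takel // size_drop ltn_subRL.
  have ln : n + k < size W.
    by apply: leq_trans le; rewrite !addSn ltnS leq_add2r leq_addr.
  have lnt : n + t + k < size W by move: le; rewrite !addSn.
  have bot n' : subcube (take n' W) (X n') xpred0 = take n' W.
    by rewrite /subcube filter_pred0 cats0.
  rewrite /h -(bot n) -(bot (n + t)); apply: wiped_bottom; [exact: sX|exact: sX|].
  move=> s [i lik' si]; pose q := count s (iota 0 k.+1).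
  have q0 : 0 < q by rewrite -has_count; apply/hasP; exists i; rewrite ?mem_iota.
  have qk : q <= k.+1 by rewrite (leq_trans (count_size _ _)) ?size_iota.
  have vq n' : n' + k < size W ->
      val (subcube (take n' W) (X n') s) = h (n' + q).
    move=> l; have l' : n' + q <= size W.
      by apply: leq_trans l; rewrite -addnS leq_add2l.
    apply: (hW (n' + q)).
    - rewrite -[X in subseq _ X](cat_take_drop n' W); apply: cat_subseq => //.
      exact: subseq_trans (filter_subseq _ _) (take_subseq _ _).
    - exact: take_subseq.
    - rewrite size_subcube; last by apply/take_uniq/drop_uniq.
      by rewrite sX // size_takel // (leq_trans _ l') // leq_addr.
    - by rewrite size_takel.
  rewrite -/val !vq // -(prednK q0) !addnS -!addSn; apply: H.
  by rewrite -ltnS prednK.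
pose win (n : 'I_Q.+1) : {ffun 'I_k.+1 -> T * T} := [ffun i : 'I_k.+1 => h (n + i)].
have /injectivePn[n [n' nn' wE]] : ~~ injectiveb win.
  apply/negP => /injectiveP/leq_card; rewrite card_ffun !card_ord.
  by rewrite ltnn.
wlog lt : n n' nn' wE / n < n'.
  move=> H; case: (ltngtP n n') => [|l|/val_inj E].
  - exact: (H n n').
  - by apply: (H n' n) => //; rewrite eq_sym.
  - by rewrite E eqxx in nn'.
have t0 : 0 < n' - n by rewrite subn_gt0.
have E0 : h 0 = h (n' - n).
  apply: (back n).
    by rewrite subnKC ?(ltnW lt) // (leq_trans _ lW) // leq_add2r -ltnS.
  move=> i lik; rewrite subnKC; last exact: ltnW.
  have := congr1 (fun f : {ffun _ -> _} => f (Ordinal (lik : i < k.+1))) wE.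
  by rewrite !ffunE.
exists (take (n' - n) W); split.
- exact: subseq_trans (take_subseq _ _) WS.
- rewrite size_take_min leq_min t0 /=; apply: leq_trans t0 _.
  rewrite (leq_trans (leq_subr _ _)) // (leq_trans _ lW) //.
  by rewrite (leq_trans _ (leq_addr _ _)) // -ltnS.
- by rewrite -/(h _) -E0 /h take0.
Qed.

Definition restrict (a : nat -> T) (S : seq nat) (v : nat) : T :=
  if v \in S then a v else zero.

(** Variables outside [S] already hold [zero], so wiping part of [S] restricts the assignment to the
    rest. This can be repeated as long as [S] has more than [d] elements. *)
Lemma sparse_solution : exists d, forall (C : Type) (c : C -> T)
    (t1 t2 : pterm ar C nat) (a : nat -> T) (S : seq nat), uniq S ->
  exists S', [/\ subseq S' S, size S' <= d,
    peval o c (restrict a S') t1 = peval o c (restrict a S) t1 &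
    peval o c (restrict a S') t2 = peval o c (restrict a S) t2].
Proof.
have [d Hd] := wipe_some; exists d => C c t1 t2 a S.
have [n] := ubnP (size S); elim: n S => // n IH S; rewrite ltnS => len uS.
have [led|/ltnW ltd] := leqP (size S) d; first by exists S; split.
have [R [RS R0 RE]] := Hd C c t1 t2 (restrict a S) S uS ltd.
pose S1 := [seq v <- S | v \notin R].
have envE : restrict a S1 = wipe (restrict a S) R.
  apply: functional_extensionality => v; rewrite /restrict /wipe mem_filter.
  by case: (v \in R).
have env0 : wipe (restrict a S) [::] = restrict a S.
  exact: functional_extensionality.
have S1S : subseq S1 S by apply: filter_subseq.
have lt : size S1 < n.
  apply: leq_trans len; rewrite ltn_neqAle size_subseq // andbT.
  rewrite size_filter -all_count; apply/allPn.
  case: R RS R0 {RE envE S1S} @S1 => // v R /mem_subseq vR _.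
  by exists v; [apply: vR|]; rewrite ?negbK inE eqxx.
have [S' [S'S1 leS' E1 E2]] := IH S1 lt (subseq_uniq S1S uS).
exists S'; split => //; first exact: subseq_trans S'S1 S1S.
- by rewrite E1 envE; case: RE => ->; rewrite env0.
- by rewrite E2 envE; case: RE => _ ->; rewrite env0.
Qed.

End Sparse.

(** * Monotonicity on the lattice side *)

Lemma lattice_monotone (V : Type) (t : pterm lat_ar bool V) (e e' : V -> bool) :
  (forall v, e v ==> e' v) -> peval lat_ops id e t ==> peval lat_ops id e' t.
Proof.
move=> ee; elim: t => [v|b|i ts IH] /=; [exact: ee|exact: implybb|].
rewrite /lat_ops; have := IH ord0; have := IH ord_max.
by do 4 case: (peval _ _ _ _); case: i ts IH.
Qed.

Section Monotone.
Variables (I : Type) (ar : I -> nat) (B : Type) (o : ops_t ar B).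

Definition monotone_alg (phi : B -> bool) : Prop :=
  injective phi /\ forall i (x y : 'I_(ar i) -> B),
    (forall j, phi (x j) ==> phi (y j)) -> phi (o x) ==> phi (o y).

Lemma polyeq_2lattice_monotone : polyeq_2lattice o -> exists phi, monotone_alg phi.
Proof.
case=> phi [psi [phiK psiK eqP]]; exists phi; split=> [|i x y xy].
  exact: can_inj phiK.
pose g (e : nat -> bool) := phi (@o i (fun j => psi (e j))).
have /eqP[t tE] : poly_fun o (fun e => psi (g (fun n => phi (e n)))).
  exists (POp (fun j : 'I_(ar i) => PVar ar B (val j))) => e /=.
  rewrite /g phiK; congr (o _); apply: functional_extensionality => j.
  by rewrite phiK.
(* The finitely many arguments are padded with [false] to an assignment of all variables. *)
pose ext (x : 'I_(ar i) -> B) n := if insub n is Some j then phi (x j) else false.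
have extE x' : phi (o x') = g (ext x').
  rewrite /g; congr (phi (o _)); apply: functional_extensionality => j.
  by rewrite /ext valK phiK.
rewrite !extE -!tE; apply: lattice_monotone => n; rewrite /ext.
by case: insub => [j|] //=.
Qed.

Variable phi : B -> bool.
Hypothesis mono : monotone_alg phi.

Lemma monotone_peval (C V : Type) (c : C -> B) (t : pterm ar C V) (e e' : V -> B) :
  (forall v, phi (e v) ==> phi (e' v)) -> phi (peval o c e t) ==> phi (peval o c e' t).
Proof.
move=> ee; elim: t => [v|b|i ts IH] /=; [exact: ee|exact: implybb|].
by apply: (proj2 mono).
Qed.

(** If [x] and [y] differ, compare [p x y y] with [p x x y = y]: it lies below when [y] is the
    bottom and above when [y] is the top, and either way this forces the value [y]. *)
Lemma monotone_diff (p : pterm ar void nat) :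
  (forall x z, term3 o p x x z = z) -> forall x y, term3 o p x y y = y.
Proof.
move=> pxxz x y; have phi_inj : injective phi := proj1 mono; apply: (phi_inj).
case xE: (phi x); case yE: (phi y).
- by rewrite -(phi_inj _ _ (etrans xE (esym yE))) pxxz.
- have := @monotone_peval _ _ (@of_void _) p (env3 x y y) (env3 x x y).
  rewrite -/(term3 _ _ _ _ _) -/(term3 _ _ _ _ _) pxxz yE implybF => H.
  by apply/negbTE/H => -[|[|n]] /=; rewrite ?xE ?yE.
- have := @monotone_peval _ _ (@of_void _) p (env3 x x y) (env3 x y y).
  rewrite -/(term3 _ _ _ _ _) -/(term3 _ _ _ _ _) pxxz yE => H.
  by apply/H => -[|[|n]] /=; rewrite ?xE ?yE.
- by rewrite -(phi_inj _ _ (etrans xE (esym yE))) pxxz.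
Qed.

(** If the value [u] is the top, the constant tuple [u] dominates [e], so the value cannot drop;
    dually for the bottom. *)
Lemma monotone_diagonal (C V : Type) (c : C -> B) (t : pterm ar C V) (e : V -> B) :
  let u := peval o c e t in peval o c (fun _ => u) t = u.
Proof.
move=> u; apply: (proj1 mono); case uE: (phi u).
- have := @monotone_peval _ _ c t e (fun _ => u); rewrite -/u uE; apply => v.
  by rewrite implybT.
- have := @monotone_peval _ _ c t (fun _ => u) e; rewrite -/u uE implybF => H.
  by apply/negbTE/H.
Qed.

End Monotone.

Lemma hom_term3 (I : Type) (ar : I -> nat) (T1 T2 : Type) (o1 : ops_t ar T1)
    (o2 : ops_t ar T2) (h : T1 -> T2) t x y z : is_hom o1 o2 h ->
  h (term3 o1 t x y z) = term3 o2 t (h x) (h y) (h z).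
Proof.
by move=> hh; rewrite /term3 (peval_hom _ _ _ hh); apply: eq_peval => [[]|[|[|n]]].
Qed.

(** * Combining the two factors *)

Section SupernilpotentMaltsev.
Variables (I : Type) (ar : I -> nat) (A : falg ar) (N : Type) (oN : ops_t ar N).
Variables (hN : fcar A -> N) (k : nat).
Hypothesis hNhom : is_hom (fop A) oN hN.
Hypothesis hNsurj : surj hN.
Hypothesis snil : k_supernilpotent oN k.

(** The invariant is nilpotency of [z |-> t x x z], immediate for the first projection. A link that
    preserves [t x y y] instead makes a detour through the other diagonal. *)
Lemma gumm_nilpotent (d : pterm ar void nat) :
  clos_refl_trans _ (gumm_link A) (PVar ar void 0) d ->
  exists m, forall x y, iter m (fun y => term3 oN d x y y) y = x.
Proof.
move=> chain.
pose nil t := (forall x y, term3 oN t x y x = x) /\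
  exists m, forall x z, iter m (term3 oN t x x) z = x.
suff [did dnil] : nil d by apply: nil_VU; eauto; apply: poly_stable_term3.
have nil0 : nil (PVar ar void 0) by split => //; exists 1.
elim: chain nil0 => [t t' [tid t'id L] [_ nilt]|//|t1 t2 t3 _ IH1 _ IH2 /IH1/IH2 //].
have idN s : (forall x y, ground (A := A) (env3 x y x) s = x) ->
    forall x y, term3 oN s x y x = x.
  move=> sid x y; have [x' <-] := hNsurj x; have [y' <-] := hNsurj y.
  by rewrite -(hom_term3 _ _ _ _ hNhom) -[in RHS](sid x' y').
split; first exact: idN.
have nV s : (forall x y, term3 oN s x y x = x) ->
    (exists m, forall x z, iter m (term3 oN s x x) z = x) <->
    (exists m, forall x z, iter m (fun y => term3 oN s x y y) z = x).
  move=> sid; split.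
  - exact: (nil_VU snil (@poly_stable_term3 _ _ _ oN s) sid).
  - exact: (nil_UV snil (@poly_stable_term3 _ _ _ oN s) sid).
case: L => L.
- case: nilt => m Hm; exists m => x z; rewrite -[RHS](Hm x z); apply: eq_iter => w.
  have [x' <-] := hNsurj x; have [w' <-] := hNsurj w.
  by rewrite -!(hom_term3 _ _ _ _ hNhom); congr hN; rewrite /term3 -[LHS]L.
- apply/(nV t' (idN _ t'id)); move/(nV t (idN _ tid)): nilt => -[m Hm].
  exists m => x z; rewrite -[RHS](Hm x z); apply: eq_iter => w.
  have [x' <-] := hNsurj x; have [w' <-] := hNsurj w.
  by rewrite -!(hom_term3 _ _ _ _ hNhom); congr hN; rewrite /term3 -[LHS]L.
Qed.

End SupernilpotentMaltsev.

Fixpoint vars_in (I : Type) (ar : I -> nat) (C : Type) (S : seq nat)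
    (t : pterm ar C nat) : Prop :=
  match t with
  | PVar v => v \in S
  | PConst _ => True
  | POp i ts => forall j, vars_in S (ts j)
  end.

Lemma peval_vars_in (I : Type) (ar : I -> nat) (C T : Type) (o : ops_t ar T)
    (c : C -> T) (S : seq nat) (t : pterm ar C nat) (e e' : nat -> T) :
  vars_in S t -> {in S, e =1 e'} -> peval o c e t = peval o c e' t.
Proof.
move=> + ee; elim: t => [v|b|i ts IH] /= H; [exact: ee|by []|].
by congr (o i _); apply: functional_extensionality => j; apply: IH.
Qed.

Section SparseQuotient.
Variables (I : Type) (ar : I -> nat) (A : falg ar).
Hypothesis modA : gen_variety_cong_modular A.
Variables (N D : falg ar).
Hypothesis snilN : supernilpotent (fop N).
Hypothesis latD : subdirect_2lattices D.
Hypothesis prodA : iso_product A N D.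
Variables (A' : falg ar) (h : fcar A -> fcar A').
Hypothesis hhom : is_hom (fop A) (fop A') h.
Hypothesis hsurj : surj h.

Lemma sparse_quotient_solution (a' : fcar A') :
  exists d, forall (t1 t2 : pterm ar (fcar A') nat) (S : seq nat) (e : nat -> fcar A'),
    uniq S -> vars_in S t1 -> vars_in S t2 ->
    peval (fop A') id e t1 = peval (fop A') id e t2 ->
    exists S' (e' : nat -> fcar A') (c : fcar A'),
      let f v := if v \in S' then e' v else c in
      [/\ subseq S' S, size S' <= d & peval (fop A') id f t1 = peval (fop A') id f t2].
Proof.
have [hN [hD [hNhom hDhom [g gK Kg]]]] := prodA.
have gN n c : hN (g (n, c)) = n by have [] := Kg (n, c).
have gD n c : hD (g (n, c)) = c by have [] := Kg (n, c).
have gE x y : hN x = hN y -> hD x = hD y -> x = y.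
  by move=> E1 E2; rewrite -(gK x) -(gK y) E1 E2.
have [x0 _] := hsurj a'.
have hNsurj : surj hN by move=> n; exists (g (n, hD x0)).
have hDsurj : surj hD by move=> n; exists (g (hN x0, n)).
have [p [d [pxxz pd chain]]] := gumm_terms modA.
have [k snil] := snilN.
have [m nilN] := gumm_nilpotent hNhom hNsurj snil chain.
have pN x y : term3 (fop N) p x y y = term3 (fop N) d x y y.
  have [x' <-] := hNsurj x; have [y' <-] := hNsurj y.
  by rewrite -!(hom_term3 _ _ _ _ hNhom); congr hN; exact: pd.
have {}nilN x y : iter m (fun y => term3 (fop N) p x y y) y = x.
  by rewrite -[RHS](nilN x y); apply: eq_iter => w.
have [J [B [oB [hB [hBhom hBsurj hBinj hBlat]]]]] := latD.
have pD x y : term3 (fop D) p x y y = y.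
  apply: hBinj => j; rewrite (hom_term3 _ _ _ _ (hBhom j)).
  have [phi mono] := polyeq_2lattice_monotone (hBlat j).
  apply: (monotone_diff mono) => u v.
  have [u1 <-] := hBsurj j u; have [v1 <-] := hBsurj j v.
  have [u2 <-] := hDsurj u1; have [v2 <-] := hDsurj v1.
  rewrite -(hom_term3 _ _ _ _ (hBhom j)) -(hom_term3 _ _ _ _ hDhom).
  by congr (hB j (hD _)); apply: pxxz.
have diagD (C : Type) (c : C -> fcar D) (t : pterm ar C nat) e :
    let u := peval (fop D) c e t in peval (fop D) c (fun _ => u) t = u.
  move=> u; apply: hBinj => j; rewrite (peval_hom _ _ _ (hBhom j)) /u.
  have [phi mono] := polyeq_2lattice_monotone (hBlat j).
  rewrite (peval_hom _ _ _ (hBhom j)) -[RHS](monotone_diagonal mono).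
  by apply: eq_peval => // v /=; rewrite (peval_hom _ _ _ (hBhom j)).
(* the term that takes the [N]-component of [x] and the [D]-component of [y] *)
pose mix (T : Type) (o : ops_t ar T) x y := iter m (fun y => term3 o p x y y) y.
have mix_hom (T1 T2 : Type) (o1 : ops_t ar T1) (o2 : ops_t ar T2) f x y :
    is_hom o1 o2 f -> f (mix _ o1 x y) = mix _ o2 (f x) (f y).
  by move=> fh; rewrite /mix; elim: (m) => //= n <-; rewrite (hom_term3 _ _ _ _ fh).
have mixA x y : mix _ (fop A) x y = g (hN x, hD y).
  apply: gE; rewrite ?gN ?gD.
    by rewrite (mix_hom _ _ _ _ _ _ _ hNhom) /mix nilN.
  rewrite (mix_hom _ _ _ _ _ _ _ hDhom) /mix.
  by elim: (m) => //= n ->; rewrite pD.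
have malM : maltsev (fop N) (iter_diff (term3 (fop N) p) m).
  split; first by apply: poly_stable_iter_diff; apply: poly_stable_term3.
  - move=> x z; apply: iter_diff_xxz => {x z} x z.
    have [x' <-] := hNsurj x; have [z' <-] := hNsurj z.
    by rewrite -(hom_term3 _ _ _ _ hNhom); congr hN; apply: pxxz.
  - by move=> x y; rewrite iter_diff_xyy.
have [q Hq] := sparse_solution snil malM (hN x0); exists q => t1 t2 S e uS v1 v2 t12.
(* A section of [h] lifts both the constants of the terms and the given solution to [A]. *)
have [r rP] : exists r : fcar A' -> fcar A, cancel r h.
  exists (fun x => odflt x0 [pick y | h y == x]) => x.
  case: pickP => [y /eqP //|no]; have [y yx] := hsurj x.
  by have := no y; rewrite yx eqxx.
pose ev t (e : nat -> fcar A) := peval (fop A) r e t.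
have hev t e1 : h (ev t e1) = peval (fop A') id (h \o e1) t.
  by rewrite /ev (peval_hom _ _ _ hhom); apply: eq_peval.
have evN t e1 : hN (ev t e1) = peval (fop N) (hN \o r) (hN \o e1) t by exact: peval_hom.
have evD t e1 : hD (ev t e1) = peval (fop D) (hD \o r) (hD \o e1) t by exact: peval_hom.
pose e0 := r \o e.
have hu : h (ev t1 e0) = h (ev t2 e0).
  by rewrite !hev; move: t12; congr (_ = _); apply: eq_peval => // v /=; rewrite rP.
have [S' [S'S szS' E1 E2]] := Hq _ (hN \o r) t1 t2 (hN \o e0) S uS.
pose eN := restrict (hN x0) (hN \o e0) S'.
have sparseN t : vars_in S t ->
    peval (fop N) (hN \o r) eN t = peval (fop N) (hN \o r) (restrict (hN x0) (hN \o e0) S) t ->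
    peval (fop N) (hN \o r) eN t = hN (ev t e0).
  move=> vt ->; rewrite evN; apply: (peval_vars_in _ _ vt) => v vS.
  by rewrite /restrict vS.
pose env u v := g (eN v, hD u).
(* The value of [t] survives the new assignment: on [N] by the choice of [S'], on [D] because the
   constant tuple of a value reproduces that value. *)
have envE t : vars_in S t ->
    peval (fop N) (hN \o r) eN t = peval (fop N) (hN \o r) (restrict (hN x0) (hN \o e0) S) t ->
    ev t (env (ev t e0)) = ev t e0.
  move=> vt Et; apply: gE.
    rewrite -(sparseN t vt Et) evN; apply: eq_peval => // v /=.
    by rewrite /env gN.
  rewrite evD [in RHS]evD -[RHS]diagD; apply: eq_peval => // v /=.
  by rewrite /env gD evD.
(* As a term in [u] and an element that does not depend on [u], [env u v] is seen by [h] only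
   through [h u]. *)
have env_h v : h (env (ev t1 e0) v) = h (env (ev t2 e0) v).
  have E u : env u v = mix _ (fop A) (g (eN v, hD x0)) u by rewrite mixA gN.
  by rewrite !E !(mix_hom _ _ _ _ _ _ _ hhom) hu.
(* Off [S'] the [N]-part is [hN x0], which makes the whole assignment constant there. *)
exists S', (h \o env (ev t1 e0)), (h (g (hN x0, hD (ev t1 e0)))) => f; split => //.
have fE : f =1 h \o env (ev t1 e0).
  by move=> v; rewrite /f /= /env /eN /restrict; case: (v \in S').
rewrite !(eq_peval _ _ (frefl id) fE) -hev envE // hu -[in LHS](envE t2) // hev.
by apply: eq_peval => // v /=; rewrite env_h.
Qed.

End SparseQuotient.

(** * Turing machines *)

Section Machines.
Variable L : finType.

(* Tape symbols: [None] is the blank, the boolean marks the leftmost cell. *)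
Local Notation sym := (option (bool * L)).

(** Halting states return a result of any type, so that machines can be sequenced and looped like
    programs. *)
Record machine (R : Type) := Machine {
  mstate : finType;
  mstart : mstate;
  mhalt : mstate -> option R;
  mdelta : mstate -> sym -> mstate * sym * move }.

Definition mstep (Q : Type) (R : Type) (halt : Q -> option R)
    (delta : Q -> sym -> Q * sym * move) (cfg : Q * seq sym * seq sym) :=
  let: (q, l, r) := cfg in
  if halt q is Some _ then cfg else
  let: (q', a, mv) := delta q (head None r) in
  let r1 := a :: behead r in
  match mv with
  | MoveL => if l is b :: l' then (q', l', b :: r1) else (q', [::], r1)
  | MoveR => (q', a :: l, behead r)
  | Stay => (q', l, r1)
  end.

Definition mrun R (M : machine R) := mstep (@mhalt R M) (@mdelta R M).
Arguments mrun {R} M cfg.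

Definition plain (x : L) : sym := Some (false, x).

Definition cells (w : seq L) : seq sym :=
  if w is x :: w' then Some (true, x) :: map plain w' else [::].

Definition tape (w : seq L) (b : nat) : seq sym := cells w ++ nseq b None.

(** The head comes back to the left end, so that runs can be concatenated. The number of trailing
    blanks is arbitrary at the start because earlier runs may have added some. *)
Definition runs R (M : machine R) (w : seq L) (res : R) (w' : seq L) (t : nat) : Prop :=
  forall b, exists b' q n, [/\ n <= t,
    iter n (mrun M) (mstart M, [::], tape w b) = (q, [::], tape w' b') &
    mhalt q = Some res].

Lemma runs_leq R (M : machine R) w res w' t t' :
  t <= t' -> runs M w res w' t -> runs M w res w' t'.
Proof.
move=> tt' H b; have [b' [q [n [len E hq]]]] := H b.
by exists b', q, n; split => //; apply: leq_trans tt'.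
Qed.

Definition mret R (res : R) : machine R :=
  @Machine R unit tt (fun _ => Some res) (fun q a => (q, a, Stay)).

Lemma runs_ret R (res : R) w : runs (mret res) w res w 0.
Proof. by move=> b; exists b, tt, 0. Qed.

(** Passing control takes one [Stay] step, which rewrites the scanned symbol and thereby adds a
    blank if the tape is empty. *)
Lemma tape_stay w b : exists b', head None (tape w b) :: behead (tape w b) = tape w b'.
Proof.
rewrite /tape; case: w => [|x w] /=; last by exists b.
by case: b => [|b]; [exists 1|exists b.+1].
Qed.

Section Bind.
Variables (R : finType) (R' : Type) (M : machine R) (F : R -> machine R').

Definition bind_state : finType := (mstate M + {res : R & mstate (F res)})%type.

Definition bind_halt (q : bind_state) : option R' :=
  match q with
  | inl _ => None
  | inr (existT res q) => mhalt q
  end.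

Definition bind_delta (q : bind_state) (a : sym) : bind_state * sym * move :=
  match q with
  | inl q =>
    if mhalt q is Some res then (inr (existT _ res (mstart (F res))), a, Stay)
    else let: (q', a', mv) := mdelta q a in (inl q', a', mv)
  | inr (existT res q) =>
    let: (q', a', mv) := mdelta q a in (inr (existT _ res q'), a', mv)
  end.

Definition mbind : machine R' := Machine (inl (mstart M)) bind_halt bind_delta.

(** [M] may reach its halting state before step [n]; the composed machine leaves it right then,
    hence the smaller [n']. *)
Lemma bind_left n q l r q' l' r' res :
  iter n (mrun M) (q, l, r) = (q', l', r') -> mhalt q' = Some res ->
  exists2 n', n' <= n & iter n' (mrun mbind) (inl q, l, r) = (inl q', l', r').
Proof.
elim: n q l r => [|n IH] q l r; first by case=> <- <- <- _; exists 0.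
rewrite iterSr; case hq: (mhalt q) => [res'|].
  rewrite {2}/mrun /= hq => E hq'.
  have fixp m : iter m (mrun M) (q, l, r) = (q, l, r).
    by elim: m => //= m ->; rewrite /mrun /= hq.
  by move: E; rewrite fixp => -[<- <- <-]; exists 0.
have : exists q1 l1 r1, mrun M (q, l, r) = (q1, l1, r1) /\
    mrun mbind (inl q, l, r) = (inl q1, l1, r1).
  rewrite /mrun /= hq; case: mdelta => -[q1 a1] [] /=.
  - by case: l => [|b l]; do 3 eexists; split.
  - by do 3 eexists; split.
  - by do 3 eexists; split.
case=> q1 [l1 [r1 [-> E2]]] E hq'; have [n' len E'] := IH _ _ _ E hq'.
by exists n'.+1 => //; rewrite iterSr E2.
Qed.

Lemma bind_right res n q l r q' l' r' :
  iter n (mrun (F res)) (q, l, r) = (q', l', r') ->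
  iter n (mrun mbind) (inr (existT _ res q), l, r) = (inr (existT _ res q'), l', r').
Proof.
elim: n q l r => [|n IH] q l r; first by case=> <- <- <-.
rewrite !iterSr; case hq: (mhalt q) => [res'|].
  have E1 : mrun (F res) (q, l, r) = (q, l, r) by rewrite /mrun /= hq.
  by rewrite E1 => /IH E; rewrite {2}/mrun /= hq.
have : exists q1 l1 r1, mrun (F res) (q, l, r) = (q1, l1, r1) /\
    mrun mbind (inr (existT _ res q), l, r) = (inr (existT _ res q1), l1, r1).
  rewrite /mrun /= hq; case: mdelta => -[q1 a1] [] /=.
  - by case: l => [|b l]; do 3 eexists; split.
  - by do 3 eexists; split.
  - by do 3 eexists; split.
by case=> q1 [l1 [r1 [-> ->]]]; apply: IH.
Qed.

Lemma runs_bind w res w1 t1 res' w2 t2 :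
  runs M w res w1 t1 -> runs (F res) w1 res' w2 t2 ->
  runs mbind w res' w2 (t1 + t2).+1.
Proof.
move=> H1 H2 b; have [b1 [q1 [n1 [le1 E1 hq1]]]] := H1 b.
have [n1' le1' E1'] := bind_left E1 hq1.
have [b1' bE] := tape_stay w1 b1.
have [b2 [q2 [n2 [le2 E2 hq2]]]] := H2 b1'.
exists b2, (inr (existT _ res q2)), (n2 + n1'.+1); split => //.
  by rewrite addnS ltnS addnC leq_add // (leq_trans le1').
rewrite iterD [iter n1'.+1 _ _]iterS E1' {2}/mrun /= hq1 bE.
exact: bind_right E2.
Qed.

End Bind.

Section Loop.
Variables (R : Type) (M : machine (option R)).

Definition loop_halt (q : mstate M) : option R :=
  if mhalt q is Some (Some res) then Some res else None.

Definition loop_delta (q : mstate M) (a : sym) : mstate M * sym * move :=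
  if mhalt q is Some None then (mstart M, a, Stay) else mdelta q a.

Definition mloop : machine R := Machine (mstart M) loop_halt loop_delta.

Lemma loop_iter n q l r q' l' r' res :
  iter n (mrun M) (q, l, r) = (q', l', r') -> mhalt q' = Some res ->
  exists2 n', n' <= n & iter n' (mrun mloop) (q, l, r) = (q', l', r').
Proof.
elim: n q l r => [|n IH] q l r; first by case=> <- <- <- _; exists 0.
rewrite iterSr; case hq: (mhalt q) => [res'|].
  rewrite {2}/mrun /= hq => E hq'.
  have fixp m : iter m (mrun M) (q, l, r) = (q, l, r).
    by elim: m => //= m ->; rewrite /mrun /= hq.
  by move: E; rewrite fixp => -[<- <- <-]; exists 0.
have : exists q1 l1 r1, mrun M (q, l, r) = (q1, l1, r1) /\
    mrun mloop (q, l, r) = (q1, l1, r1).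
  rewrite /mrun /= /loop_halt /loop_delta hq; case: mdelta => -[q1 a1] [] /=.
  - by case: l => [|b l]; do 3 eexists; split.
  - by do 3 eexists; split.
  - by do 3 eexists; split.
case=> q1 [l1 [r1 [-> E2]]] E hq'; have [n' len E'] := IH _ _ _ E hq'.
by exists n'.+1 => //; rewrite iterSr E2.
Qed.

Lemma runs_loop_stop w res w1 t1 :
  runs M w (Some res) w1 t1 -> runs mloop w res w1 t1.
Proof.
move=> H1 b; have [b1 [q1 [n1 [le1 E1 hq1]]]] := H1 b.
have [n1' le1' E1'] := loop_iter E1 hq1.
exists b1, q1, n1'; split => //; first exact: leq_trans le1.
by rewrite /= /loop_halt hq1.
Qed.

Lemma runs_loop_next w w1 t1 res w2 t2 :
  runs M w None w1 t1 -> runs mloop w1 res w2 t2 ->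
  runs mloop w res w2 (t1 + t2).+1.
Proof.
move=> H1 H2 b; have [b1 [q1 [n1 [le1 E1 hq1]]]] := H1 b.
have [n1' le1' E1'] := loop_iter E1 hq1.
have [b1' bE] := tape_stay w1 b1.
have [b2 [q2 [n2 [le2 E2 hq2]]]] := H2 b1'.
exists b2, q2, (n2 + n1'.+1); split => //.
  by rewrite addnS ltnS addnC leq_add // (leq_trans le1').
rewrite iterD [iter n1'.+1 _ _]iterS E1' {2}/mrun /= /loop_halt /loop_delta hq1 bE.
exact: E2.
Qed.

End Loop.

Section Sweep.
Variables (S : finType) (R : Type) (s0 : S) (f : S -> L -> S * L) (out : S -> R).

(* phase [None]: rewriting rightwards; [Some false]: returning; [Some true]: done *)
Definition sweep_delta (q : option bool * S) (a : sym) : (option bool * S) * sym * move :=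
  match q, a with
  | (None, s), Some (mk, x) => let: (s', y) := f s x in ((None, s'), Some (mk, y), MoveR)
  | (None, s), None => ((Some false, s), None, MoveL)
  | (Some _, s), Some (true, _) => ((Some true, s), a, Stay)
  | (Some _, s), _ => ((Some false, s), a, MoveL)
  end.

Definition sweep_halt (q : option bool * S) : option R :=
  if q is (Some true, s) then Some (out s) else None.

Definition msweep : machine R :=
  @Machine R (option bool * S)%type (None, s0) sweep_halt sweep_delta.

Fixpoint mealy (s : S) (w : seq L) : S * seq L :=
  if w is x :: w' then
    let: (s', y) := f s x in let: (s'', v) := mealy s' w' in (s'', y :: v)
  else (s, [::]).

Lemma size_mealy s w : size (mealy s w).2 = size w.
Proof.
elim: w s => //= x w IH s; case: f => s' y.
by case E: (mealy s' w) => [s'' v] /=; rewrite -(IH s') E.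
Qed.

Lemma sweep_forward s w l b :
  iter (size w) (mrun msweep) ((None, s), l, map plain w ++ nseq b None) =
  ((None, (mealy s w).1), catrev (map plain (mealy s w).2) l, nseq b None).
Proof.
elim: w s l => // x w IH s l; rewrite [size _]/= iterSr.
rewrite {2}/mrun /=; case: (f s x) => s' y /=.
by rewrite IH; case: (mealy s' w).
Qed.

(** The tape stores the rewritten prefix reversed, with the head on its last symbol; the return ends
    at the marked first cell. *)
Lemma sweep_backward s (v : seq L) x r :
  iter (size v).+1 (mrun msweep) ((Some false, s), behead (rcons (map plain v) (Some (true, x))),
     head None (rcons (map plain v) (Some (true, x))) :: r) =
  ((Some true, s), [::], Some (true, x) :: catrev (map plain v) r).
Proof.
elim: v r => [|y v IH] r //; rewrite [size _]/= iterSr -[RHS](IH (plain y :: r)).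
by congr iter; case: v {IH}.
Qed.

Lemma runs_sweep w : w != [::] ->
  runs msweep w (out (mealy s0 w).1) (mealy s0 w).2 (2 * size w + 2).
Proof.
case: w => // x w _ b.
(* Turning round writes a blank, which lengthens the tape only if no blank was left. *)
exists b.-1.+1, (Some true, (mealy s0 (x :: w)).1), ((size w).+1 + (1 + (size w).+1)); split => //.
  by rewrite mul2n -addnn -addnA leq_add2l add1n addn2.
rewrite !iterD.
have -> : iter (size w).+1 (mrun msweep) (mstart msweep, [::], tape (x :: w) b) =
    iter (size w) (mrun msweep) ((None, (f s0 x).1), [:: Some (true, (f s0 x).2)],
      map plain w ++ nseq b None).
  by rewrite iterSr; congr iter; rewrite /mrun /=; case: (f s0 x).
rewrite sweep_forward; case E: (f s0 x) => [s' y].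
case E': (mealy s' w) => [s'' v].
have -> : mealy s0 (x :: w) = (s'', y :: v) by rewrite /= E E'.
rewrite [(s', y).2]/= [(s'', v).1]/= [(s'', v).2]/=.
have -> : catrev (map plain v) [:: Some (true, y)] =
    rcons (map plain (rev v)) (Some (true, y)).
  by rewrite catrevE map_rev cats1.
have sv : size w = size (rev v) by rewrite size_rev -(size_mealy s' w) E'.
set tl := rcons _ _.
have -> : iter 1 (mrun msweep) ((None, s''), tl, nseq b None) =
   ((Some false, s''), behead tl, head None tl :: nseq b.-1.+1 None).
  rewrite /= /mrun /=; have -> : head None (nseq b (None : sym)) = None by case: (b).
  by rewrite /tl; case: (map plain (rev v)) => [|z v'] /=; case: (b).
rewrite sv sweep_backward; congr (_, _, _ :: _).
by rewrite map_rev catrevE revK.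
Qed.

End Sweep.

End Machines.
Arguments mrun {L R} M cfg.

(** * Polynomial time bounds *)

Section PolynomialBounds.

(** With [n.+1] in place of [n], a single monomial absorbs constants, and sums and products stay in
    this form. *)
Definition pbound (f : nat -> nat) : Prop :=
  exists c k, forall n, f n <= c * n.+1 ^ k.

Lemma pbound_const c : pbound (fun _ => c).
Proof. by exists c, 0 => n; rewrite muln1. Qed.

Lemma pbound_id : pbound id.
Proof. by exists 1, 1 => n; rewrite mul1n expn1. Qed.

Lemma pbound_add f g : pbound f -> pbound g -> pbound (fun n => f n + g n).
Proof.
move=> [c [k Hf]] [c' [k' Hg]]; exists (c + c'), (k + k') => n.
rewrite mulnDl leq_add // ?(leq_trans (Hf n)) ?(leq_trans (Hg n)) // leq_mul2l.
  by rewrite leq_pexp2l ?leq_addr ?orbT.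
by rewrite leq_pexp2l ?leq_addl ?orbT.
Qed.

Lemma pbound_mul f g : pbound f -> pbound g -> pbound (fun n => f n * g n).
Proof.
move=> [c [k Hf]] [c' [k' Hg]]; exists (c * c'), (k + k') => n.
by rewrite expnD mulnACA leq_mul.
Qed.

Lemma pbound_affine f : pbound f -> exists c k, forall n, f n <= c * n ^ k + c.
Proof.
move=> [c [k Hf]]; exists (c * 2 ^ k), k => n; apply: leq_trans (Hf n) _.
rewrite -mulnA -[X in _ <= _ + X]muln1 -mulnA -mulnDr leq_mul2l; apply/orP; right.
rewrite -expnMn; case: n => [|n]; first by rewrite exp1n muln1 (leq_trans _ (leq_addl _ _)) // expn_gt0.
rewrite (leq_trans _ (leq_addr _ _)) //; case: k {Hf} => // k.
by rewrite leq_exp2r // mul2n -addnn addSn ltnS leq_addl.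
Qed.

End PolynomialBounds.

Section Decide.
Variables (L : finType) (S X : Type) (enc : X -> seq S) (dom P : X -> Prop).
Variables (raw : S -> L) (M : machine L bool).

Let start_halt (q : option (mstate M)) : option bool :=
  if q is Some q then mhalt q else None.

(** The input has no marked cell; a new initial state marks the leftmost one before [M] starts. *)
Let start_delta (q : option (mstate M)) (a : option (bool * L)) :
    option (mstate M) * option (bool * L) * move :=
  match q with
  | None => (Some (mstart M), if a is Some (_, x) then Some (true, x) else None, Stay)
  | Some q => let: (q', a', mv) := mdelta q a in (Some q', a', mv)
  end.

Lemma start_run n q l r q' l' r' :
  iter n (mrun M) (q, l, r) = (q', l', r') ->
  iter n (tm_step None start_halt start_delta) (Some q, l, r) = (Some q', l', r').
Proof.
elim: n q l r => [|n IH] q l r; first by case=> <- <- <-.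
rewrite !iterSr; case hq: (mhalt q) => [res'|].
  have E1 : mrun M (q, l, r) = (q, l, r) by rewrite /mrun /= hq.
  by rewrite E1 => /IH E; rewrite [tm_step _ _ _ _]/= hq.
have : exists q1 l1 r1, mrun M (q, l, r) = (q1, l1, r1) /\
    tm_step None start_halt start_delta (Some q, l, r) = (Some q1, l1, r1).
  rewrite /mrun /= hq; case: mdelta => -[q1 a1] [] /=.
  - by case: l => [|b l]; do 3 eexists; split.
  - by do 3 eexists; split.
  - by do 3 eexists; split.
by case=> q1 [l1 [r1 [-> ->]]]; apply: IH.
Qed.

Lemma machine_decides (bound : nat -> nat) : pbound bound ->
  (forall x, dom x -> enc x <> [::]) ->
  (forall x, dom x -> exists res w',
     runs M (map raw (enc x)) res w' (bound (size (enc x))) /\ (res <-> P x)) ->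
  poly_time_decides_on enc dom P.
Proof.
move=> pb enc0 HM.
have [c [k Hck]] := pbound_affine (pbound_add (pbound_const 1) pb).
exists (option (mstate M)), (option (bool * L)), (fun s => plain (raw s)), None, None,
  start_halt, start_delta, c, k => x dx w.
have [res [w' [runx resP]]] := HM x dx.
have [b' [q [n [len E hq]]]] := runx 0.
have lt : n.+1 <= c * size w ^ k + c by apply: leq_trans (Hck _); rewrite add1n ltnS.
have E1 : iter n.+1 (tm_step None start_halt start_delta)
    (None, [::], map (fun s => plain (raw s)) w) = (Some q, [::], tape w' b').
  rewrite iterSr; apply: start_run; rewrite -[RHS]E; congr (iter n _ _).
  rewrite /tape /w; case: (enc x) (enc0 x dx) => //= s w0 _.
  by rewrite cats0 -map_comp.
rewrite -(subnK lt) iterD E1.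
have -> m : iter m (tm_step None start_halt start_delta) (Some q, [::], tape w' b')
    = (Some q, [::], tape w' b') by elim: m => //= m ->; rewrite /= hq.
by rewrite /= hq.
Qed.

End Decide.

(** * Tapes made of fields: bits closed by a data cell *)

Section Fields.
Variables (Bt Sp : finType).

Local Notation letter := (Bt + Sp)%type.
Local Notation field := (seq Bt * Sp)%type.

Definition word (fs : seq field) : seq letter :=
  flatten [seq rcons (map inl f.1) (inr f.2) | f <- fs].

Section FieldSweep.
Variables (Sg Be : finType) (R : Type) (b0 : Be) (bstep : Be -> Bt -> Be * Bt).
Variables (g0 : Sg) (sstep : Sg -> Be -> Sp -> Sg * Sp) (out : Sg -> R).

Fixpoint bscan (be : Be) (bs : seq Bt) : Be * seq Bt :=
  if bs is x :: bs' then
    let: (be', y) := bstep be x in let: (be'', ys) := bscan be' bs' in (be'', y :: ys)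
  else (be, [::]).

Definition fstep (g : Sg) (f : field) : Sg * field :=
  let: (be, bs) := bscan b0 f.1 in
  let: (g', s) := sstep g be f.2 in (g', (bs, s)).

Fixpoint fscan (g : Sg) (fs : seq field) : Sg * seq field :=
  if fs is f :: fs' then
    let: (g', f') := fstep g f in let: (g'', fs'') := fscan g' fs' in (g'', f' :: fs'')
  else (g, [::]).

Lemma fscan_cat g fs fs' :
  fscan g (fs ++ fs') =
  ((fscan (fscan g fs).1 fs').1, (fscan g fs).2 ++ (fscan (fscan g fs).1 fs').2).
Proof.
elim: fs g => [|f fs IH] g /=; first by case: (fscan g fs').
case: fstep => g' f'; rewrite IH.
by case: (fscan g' fs).
Qed.

(** The bit state starts afresh at [b0] in every field and is handed to the cell that closes it;
    only the state in [Sg] passes from field to field. *)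
Definition field_delta (s : Sg * Be) (x : letter) : (Sg * Be) * letter :=
  match x with
  | inl b => let: (be, b') := bstep s.2 b in ((s.1, be), inl b')
  | inr t => let: (g, t') := sstep s.1 s.2 t in ((g, b0), inr t')
  end.

Definition fsweep : machine (Bt + Sp)%type R :=
  msweep (g0, b0) field_delta (fun s => out s.1).

Lemma mealy_word g fs :
  mealy field_delta (g, b0) (word fs) = (((fscan g fs).1, b0), word (fscan g fs).2).
Proof.
elim: fs g => [|f fs IH] g //=.
rewrite /fstep /word /= -/(word fs); case: f => bs s /=.
suff H be : mealy field_delta (g, be) (rcons (map inl bs) (inr s) ++ word fs) =
    let: (be', bs') := bscan be bs in let: (g', s') := sstep g be' s in
    let: (q, v) := mealy field_delta (g', b0) (word fs) in
    (q, rcons (map inl bs') (inr s') ++ v).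
  rewrite H; case: bscan => be' bs'; case: sstep => g' s'; rewrite IH.
  by case: fscan.
elim: bs be => [|x bs IHb] be /=.
  by case: sstep => g' s'; case: mealy.
case: bstep => be' y /=; rewrite IHb; case: bscan => be'' ys.
by case: sstep => g' s'; case: mealy.
Qed.

Lemma size_word_fscan g fs : size (word (fscan g fs).2) = size (word fs).
Proof. by rewrite -(size_mealy field_delta (g, b0) (word fs)) mealy_word. Qed.

Lemma runs_fsweep fs : fs != [::] ->
  runs fsweep (word fs) (out (fscan g0 fs).1) (word (fscan g0 fs).2)
    (2 * size (word fs) + 2).
Proof.
move=> fs0; have w0 : word fs != [::] by case: fs fs0 => // -[[|b bs] s] fs.
have := runs_sweep (g0, b0) field_delta (fun s => out s.1) w0.
by rewrite mealy_word.
Qed.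

End FieldSweep.
End Fields.

(** * Searching for a sparse solution *)

Inductive role (I T : Type) (K : nat) : Type :=
| ROut of bool
| RTag
| RVar
| RConst of T
| ROp of I
| RArg of I & 'I_K.
Arguments ROut {I T K}. Arguments RTag {I T K}. Arguments RVar {I T K}.
Arguments RConst {I T K}. Arguments ROp {I T K}. Arguments RArg {I T K}.

Definition role_code (I T : Type) (K : nat) (r : role I T K) :
    bool + bool + (T + (I + I * 'I_K)) :=
  match r with
  | ROut b => inl (inl b)
  | RTag => inl (inr true)
  | RVar => inl (inr false)
  | RConst a => inr (inl a)
  | ROp i => inr (inr (inl i))
  | RArg i j => inr (inr (inr (i, j)))
  end.

Definition role_decode (I T : Type) (K : nat) (c : bool + bool + (T + (I + I * 'I_K))) :
    role I T K :=
  match c with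
  | inl (inl b) => ROut b
  | inl (inr true) => RTag
  | inl (inr false) => RVar
  | inr (inl a) => RConst a
  | inr (inr (inl i)) => ROp i
  | inr (inr (inr (i, j))) => RArg i j
  end.

Lemma role_codeK (I T : Type) (K : nat) : cancel (@role_code I T K) (@role_decode I T K).
Proof. by case. Qed.

HB.instance Definition _ (I T : finType) (K : nat) :=
  Equality.copy (role I T K) (can_type (@role_codeK I T K)).
HB.instance Definition _ (I T : finType) (K : nat) :=
  Choice.copy (role I T K) (can_type (@role_codeK I T K)).
HB.instance Definition _ (I T : finType) (K : nat) :=
  Countable.copy (role I T K) (can_type (@role_codeK I T K)).
HB.instance Definition _ (I T : finType) (K : nat) :=
  Finite.copy (role I T K) (can_type (@role_codeK I T K)).

(* The data kept at the end of a number: its role, the value assigned to it if it is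
   a variable, the value received if it is an argument of a gate, the value of the node
   that ends here, whether that value is final, whether the node is the first or the
   second output, whether the number is shorter than the pattern it is compared with,
   and the pointers that have already passed it. *)
Record cell (I T : Type) (K D : nat) : Type := Cell {
  crole : role I T K;
  casg : T;
  crecv : option T;
  cval : T;
  cdone : bool;
  cfst : bool;
  csnd : bool;
  cshort : bool;
  cused : {set 'I_D} }.

Definition cell_code (I T : Type) (K D : nat) (s : cell I T K D) :=
  (crole s, casg s, crecv s, cval s, (cdone s, cfst s, csnd s), cshort s, cused s).

Definition cell_decode (I T : Type) (K D : nat)
    (c : role I T K * T * option T * T * (bool * bool * bool) * bool * {set 'I_D}) :=
  let: (r, a, v, w, (d, f, g), m, u) := c in Cell r a v w d f g m u.

Lemma cell_codeK (I T : Type) (K D : nat) :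
  cancel (@cell_code I T K D) (@cell_decode I T K D).
Proof. by case. Qed.

HB.instance Definition _ (I T : finType) (K D : nat) :=
  Equality.copy (cell I T K D) (can_type (@cell_codeK I T K D)).
HB.instance Definition _ (I T : finType) (K D : nat) :=
  Choice.copy (cell I T K D) (can_type (@cell_codeK I T K D)).
HB.instance Definition _ (I T : finType) (K D : nat) :=
  Countable.copy (cell I T K D) (can_type (@cell_codeK I T K D)).
HB.instance Definition _ (I T : finType) (K D : nat) :=
  Finite.copy (cell I T K D) (can_type (@cell_codeK I T K D)).

(* A bit cell holds the bit of the input, a working copy, and the result of its
   comparison with a pattern, if done. *)
Definition bitc : finType := (bool * bool * option bool)%type.
Definition orig (x : bitc) : bool := x.1.1.
Definition work (x : bitc) : bool := x.1.2.
Definition mark (x : bitc) : option bool := x.2.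

(** * Assigning values and moving pointers *)

Section Sweeps.
Variables (I T : finType) (K D : nat).

Local Notation Cl := (cell I T K D).
Local Notation field := (seq bitc * Cl)%type.
Local Notation mach := (machine (bitc + Cl)%type).

Definition origs (f : field) : seq bool := map orig f.1.
(** What an attempt leaves unchanged; pointers move only between attempts. *)
Definition core (f : field) : seq bool * role I T K * {set 'I_D} :=
  (origs f, crole f.2, cused f.2).
Definition is_var (f : field) : bool := crole f.2 == RVar.

Definition sw (n : nat) : nat := 2 * n + 2.

Lemma size_word_core (fs fs' : seq field) :
  map core fs = map core fs' -> size (word fs) = size (word fs').
Proof.
have E (gs : seq field) :
    size (word gs) = sumn [seq (size c.1.1).+1 | c <- map core gs].
  rewrite size_flatten /shape -!map_comp; congr sumn; apply: eq_map => f /=.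
  by rewrite size_rcons !size_map.
by rewrite !E => ->.
Qed.

Lemma core_nonempty (fs fs' : seq field) :
  map core fs = map core fs' -> fs != [::] -> fs' != [::].
Proof. by case: fs => //; case: fs'. Qed.

Section Core.
Variables (Sg Be : finType) (b0 : Be) (bstep : Be -> bitc -> Be * bitc).
Variable sstep : Sg -> Be -> Cl -> Sg * Cl.

Lemma fscan_core g fs :
  (forall be x, orig (bstep be x).2 = orig x) ->
  (forall g be s, crole (sstep g be s).2 = crole s) ->
  (forall g be s, cused (sstep g be s).2 = cused s) ->
  map core (fscan b0 bstep sstep g fs).2 = map core fs.
Proof.
move=> Hb Hr Hu; elim: fs g => //= -[bs s] fs IH g; rewrite /fstep /=.
have Ho be : map orig (bscan bstep be bs).2 = map orig bs.
  elim: bs be => //= x bs IHb be; have := Hb be x.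
  by case: bstep => be' y /= <-; have := IHb be'; case: bscan => be'' ys /= ->.
have := Ho b0; case: bscan => be' bs' /= E.
have := Hr g be' s; have := Hu g be' s; case: sstep => g' s' /= E1 E2.
have := IH g'; case: fscan => g'' fs' /= ->.
by rewrite {1}/core /origs /= E E1 E2.
Qed.

Lemma fscan_all g fs (P Q : pred field) :
  (forall g f, P f -> Q (fstep b0 bstep sstep g f).2) ->
  all P fs -> all Q (fscan b0 bstep sstep g fs).2.
Proof.
move=> H; elim: fs g => //= f fs IH g /andP[Pf Pfs].
have := H g f Pf; case: fstep => g' f' /= Qf.
by have := IH g' Pfs; case: fscan => g'' fs' /= ->; rewrite Qf.
Qed.

End Core.

(* Pointer [l] stands at the first variable that it has not passed. *)
Definition unread (l : 'I_D) (f : field) : bool := is_var f && (l \notin cused f.2).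
Definition unreads (l : 'I_D) (fs : seq field) : seq (seq bool) :=
  [seq origs f | f <- fs & unread l f].

Lemma unreads_core l fs fs' : map core fs = map core fs' -> unreads l fs = unreads l fs'.
Proof.
pose P (c : seq bool * role I T K * {set 'I_D}) := (c.1.2 == RVar) && (l \notin c.2).
have E gs : unreads l gs = [seq c.1.1 | c <- filter P (map core gs)].
  by rewrite filter_map -map_comp.
by rewrite !E => ->.
Qed.

(** Keyed by bit strings, so that all occurrences of a variable carry the same value. *)
Definition assigned (rho : seq bool -> T) : pred field :=
  fun f => is_var f ==> (casg f.2 == rho (origs f)).

Definition idb (be : unit) (x : bitc) : unit * bitc := (be, x).

Lemma bscan_idb be bs : bscan idb be bs = (be, bs).
Proof. by elim: bs => //= x bs ->. Qed.

Definition set_asg (a : T) (s : Cl) : Cl :=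
  Cell (crole s) a (crecv s) (cval s) (cdone s) (cfst s) (csnd s) (cshort s) (cused s).
Definition set_short (m : bool) (s : Cl) : Cl :=
  Cell (crole s) (casg s) (crecv s) (cval s) (cdone s) (cfst s) (csnd s) m (cused s).
Definition set_used (u : {set 'I_D}) (s : Cl) : Cl :=
  Cell (crole s) (casg s) (crecv s) (cval s) (cdone s) (cfst s) (csnd s) (cshort s) u.

Definition assign_all (a : T) : mach unit :=
  fsweep tt idb tt (fun _ _ s => (tt, set_asg a s)) id.

Lemma runs_assign_all a fs : fs != [::] -> exists fs',
  [/\ runs (assign_all a) (word fs) tt (word fs') (sw (size (word fs))),
      map core fs' = map core fs & all (assigned (fun _ => a)) fs'].
Proof.
move=> fs0.
have := runs_fsweep tt idb tt (fun (_ _ : unit) s => (tt, set_asg a s)) id fs0.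
case: (fscan _ _ _ _ _).1 => R; eexists; split; first exact: R.
- exact: fscan_core.
- apply: (fscan_all _ (P := predT)); last exact: all_predT.
  by move=> g [bs s] _; rewrite /fstep bscan_idb /assigned /= eqxx implybT.
Qed.

(** Bits beyond the pattern stay unmarked and betray a number that is longer; one that is shorter is
    recognised by the flag [cshort]. *)
Fixpoint marks (src bits : seq bool) : seq (option bool) :=
  match bits, src with
  | b :: bits', a :: src' => Some (b == a) :: marks src' bits'
  | _, _ => [seq None | _ <- bits]
  end.

Definition compared (src : seq bool) : pred field :=
  fun f => (map mark f.1 == marks src (origs f)) && (cshort f.2 == (size f.1 < size src)).

Definition clear_marks : mach unit :=
  fsweep tt (fun be x => (be, (x.1, None))) tt (fun _ _ s => (tt, set_short false s)) id.

Lemma runs_clear_marks rho fs : fs != [::] -> all (assigned rho) fs -> exists fs',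
  [/\ runs clear_marks (word fs) tt (word fs') (sw (size (word fs))),
      map core fs' = map core fs, all (assigned rho) fs' & all (compared [::]) fs'].
Proof.
move=> fs0 asg.
have bE (be : unit) (bs : seq bitc) :
    bscan (fun be x => (be, (x.1, None))) be bs = (be, [seq (x.1, None) : bitc | x <- bs]).
  by elim: bs => //= x bs ->.
have := runs_fsweep tt (fun be (x : bitc) => (be, (x.1, None) : bitc)) tt
   (fun (_ _ : unit) s => (tt, set_short false s)) id fs0.
case: (fscan _ _ _ _ _).1 => R; eexists; split; first exact: R.
- exact: fscan_core.
- apply: fscan_all asg => g [bs s]; rewrite /fstep bE /assigned /is_var /origs /=.
  by rewrite -map_comp.
- apply: (fscan_all _ (P := predT)); last exact: all_predT.
  move=> g [bs s] _; rewrite /fstep bE /compared /origs /= -!map_comp ltn0 eqxx andbT.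
  by case: bs => //= x bs; rewrite -map_comp.
Qed.

(** The field under the pointer has been compared with a prefix of its own number, so its first
    unmarked bit is the next bit of the pattern. The outer [None] reports that the pointer has no
    variable left, the inner one that the pattern is complete. *)
Definition next_bit (l : 'I_D) : mach (option (option bool)) :=
  fsweep None
    (fun be x => (if be is None then if mark x is None then Some (orig x) else be else be, x))
    None
    (fun g be s => (if g is None then
        if (crole s == RVar) && (l \notin cused s) then Some be else g else g, s)) id.

Lemma unmarked (bs : seq bitc) src : map mark bs = marks src (map orig bs) ->
  [seq orig x | x <- bs & mark x == None] = drop (size src) (map orig bs).
Proof.
elim: bs src => [|x bs IH] [|a src] //=.
- case=> -> E; rewrite /= -[X in _ = _ :: X](drop0) -(IH [::]) //=.
  by rewrite E; case: (bs).
- by case=> -> /IH.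
Qed.

Lemma runs_next_bit l src fs : fs != [::] -> all (compared src) fs ->
  runs (next_bit l) (word fs)
    (omap (fun bits => ohead (drop (size src) bits)) (ohead (unreads l fs)))
    (word fs) (sw (size (word fs))).
Proof.
move=> fs0 cmp; have := runs_fsweep None
    (fun be x => (if be is None then if mark x is None then Some (orig x) else be else be, x))
    None
    (fun g be (s : Cl) => (if g is None then
        if (crole s == RVar) && (l \notin cused s) then Some be else g else g, s)) id fs0.
set bst := fun be x => _; set sst := fun g be s => _.
have bE be bs : bscan bst be bs =
    (if be is None then ohead [seq orig x | x <- bs & mark x == None] else be, bs).
  elim: bs be => [|x bs IH] [b|] //=; rewrite IH //.
  by rewrite /bst; case: (mark x).
suff -> : fscan None bst sst None fs =
    (omap (fun bits => ohead (drop (size src) bits)) (ohead (unreads l fs)), fs) by [].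
have some g gs : fscan None bst sst (Some g) gs = (Some g, gs).
  elim: gs g => //= -[bs s] gs IH g; rewrite /fstep bE /= IH //.
elim: fs {fs0} cmp => //= -[bs s] fs IH /andP[/andP[/eqP cb _] cfs].
rewrite /fstep bE /= /sst /unreads /= /unread /is_var /=.
case: ifP => E /=; first by rewrite some (unmarked cb).
by rewrite IH.
Qed.

Definition match_bit (b : bool) : mach (option unit) :=
  fsweep false
    (fun be x => if be then (be, x) else
       if mark x is None then (true, (x.1, Some (orig x == b))) else (be, x))
    tt (fun _ (be : bool) s => (tt, if be then s else set_short true s)) (fun _ => None).

Lemma runs_match_bit b src rho fs : fs != [::] -> all (compared src) fs ->
  all (assigned rho) fs -> exists fs',
  [/\ runs (match_bit b) (word fs) None (word fs') (sw (size (word fs))),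
      map core fs' = map core fs, all (assigned rho) fs' & all (compared (rcons src b)) fs'].
Proof.
move=> fs0 cmp asg; have := runs_fsweep false
    (fun be (x : bitc) => if be then (be, x) else
       if mark x is None then (true, (x.1, Some (orig x == b)) : bitc) else (be, x))
    tt (fun _ (be : bool) (s : Cl) => (tt, if be then s else set_short true s))
    (fun _ : unit => None : option unit) fs0.
set bst := fun be x => _; set sst := fun g be s => _ => R.
have bT bs : bscan bst true bs = (true, bs) by elim: bs => //= x bs ->.
have bo be x : orig (bst be x).2 = orig x by rewrite /bst; case: be => //; case: mark.
have co : map core (fscan false bst sst tt fs).2 = map core fs.
  by apply: fscan_core => // g [].
have bo' be bs : map orig (bscan bst be bs).2 = map orig bs.
  elim: bs be => //= x bs IHb be; have := bo be x.
  by case: (bst be x) => be' y /= <-; have := IHb be'; case: bscan => be'' ys /= ->.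
eexists; split; [exact: R|exact: co| |].
- apply: fscan_all asg => g [bs s]; rewrite /fstep.
  have := bo' false bs; case: bscan => be bs' /= E.
  by rewrite /assigned /is_var /origs /= E; case: be.
- apply: fscan_all cmp => g [bs s]; rewrite /fstep.
  have := bo' false bs; case E: (bscan bst false bs) => [be bs'] /= E1.
  rewrite /compared /origs /= => /andP[/eqP mE /eqP sE].
  have sz : size bs' = size bs by rewrite -(size_map orig) E1 size_map.
  have [E2 E3] : map mark bs' = marks (rcons src b) (map orig bs) /\ be = (size src < size bs).
    elim: bs src be bs' mE E {sE E1 sz} => [|x bs IH] src be bs' /=.
      by case: src => [|a src] _ [<- <-].
    case: src => [|a src] /=.
      case=> mx mE; rewrite /bst mx -/bst bT => -[<- <-] /=; split => //.
      by rewrite mE; case: (bs).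
    case=> mx mE; rewrite {1}/bst mx.
    case E: bscan => [be1 bs1] [<- <-] /=; have [-> ->] := IH src be1 bs1 mE E.
    by rewrite mx.
  rewrite E1 E2 eqxx /= sz size_rcons ltnS {}E3; case: ltnP => //= le.
  by rewrite sE ltnNge (ltnW le).
Qed.

Definition assign_matched (a : T) : mach (option unit) :=
  fsweep true (fun be x => (be && (mark x == Some true), x)) tt
    (fun _ (be : bool) s => (tt, if [&& crole s == RVar, be & ~~ cshort s]
       then set_asg a s else s)) (fun _ => Some tt).

Definition override (rho : seq bool -> T) (src : seq bool) (a : T) (bits : seq bool) : T :=
  if bits == src then a else rho bits.

Lemma marks_eq src bits :
  all (pred1 (Some true)) (marks src bits) && ~~ (size bits < size src) = (bits == src).
Proof.
elim: bits src => [|b bits IH] [|a src] //=.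
by rewrite eqseq_cons -IH ltnS; case: (b == a).
Qed.

Lemma runs_assign_matched a src rho fs : fs != [::] -> all (compared src) fs ->
  all (assigned rho) fs -> exists fs',
  [/\ runs (assign_matched a) (word fs) (Some tt) (word fs') (sw (size (word fs))),
      map core fs' = map core fs & all (assigned (override rho src a)) fs'].
Proof.
move=> fs0 cmp asg; have := runs_fsweep true
    (fun be (x : bitc) => (be && (mark x == Some true), x)) tt
    (fun _ (be : bool) (s : Cl) => (tt, if [&& crole s == RVar, be & ~~ cshort s]
       then set_asg a s else s)) (fun _ : unit => Some tt) fs0.
set bst := fun be x => _; set sst := fun g be s => _ => R.
have bE be bs : bscan bst be bs = (be && all (pred1 (Some true)) (map mark bs), bs).
  by elim: bs be => [|x bs IH] be /=; rewrite ?andbT // IH andbA.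
eexists; split; first exact: R.
- by apply: fscan_core => // g be s; rewrite /sst /=; case: ifP.
- have both : all (predI (compared src) (assigned rho)) fs by rewrite all_predI cmp.
  apply: fscan_all both => g [bs s] /= /andP[/andP[/eqP mE /eqP sE]].
  rewrite /fstep bE /sst /= mE sE -(size_map orig) marks_eq.
  rewrite /assigned /is_var /origs /override /=; case Es: (crole s == RVar) => /=.
    by case: (map orig bs == src); rewrite /= Es //= eqxx.
  by rewrite Es.
Qed.

Definition overwrite_step (l : 'I_D) (a : T) : mach (option unit) :=
  mbind (next_bit l) (fun r =>
    match r with
    | None => mret _ (Some tt)
    | Some None => assign_matched a
    | Some (Some b) => match_bit b
    end).

(** A number does not fit into the finite control, so it is matched bit by bit: one sweep fetches a
    bit, the next compares it in all fields at once. *)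
Definition overwrite (l : 'I_D) (a : T) : mach unit :=
  mbind clear_marks (fun _ => mloop (overwrite_step l a)).

(** At most [n] rounds match a bit and one more assigns; a round takes two sweeps and two steps that
    pass control. *)
Definition overwrite_time (n : nat) : nat := sw n + n.+1 * (2 * sw n + 2) + 1.

Definition override_head (rho : seq bool -> T) (srcs : seq (seq bool)) (a : T) :=
  if srcs is src :: _ then override rho src a else rho.

Lemma runs_overwrite l a rho fs : fs != [::] -> all (assigned rho) fs -> exists fs',
  [/\ runs (overwrite l a) (word fs) tt (word fs') (overwrite_time (size (word fs))),
      map core fs' = map core fs & all (assigned (override_head rho (unreads l fs) a)) fs'].
Proof.
move=> fs0 asg; have [fs1 [R1 co1 asg1 cmp1]] := runs_clear_marks fs0 asg.
set n := size (word fs) in R1 *.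
suff [fs2 [R2 co2 asg2]] : exists fs',
   [/\ runs (mloop (overwrite_step l a)) (word fs1) tt (word fs') (n.+1 * (2 * sw n + 2)),
      map core fs' = map core fs1 & all (assigned (override_head rho (unreads l fs) a)) fs'].
  exists fs2; split => //; last by rewrite co2.
  by apply: runs_leq (runs_bind R1 R2); rewrite /overwrite_time addn1.
have fs10 := core_nonempty (esym co1) fs0.
have n1 : size (word fs1) = n by apply: size_word_core.
have := unreads_core l (esym co1); case E: (unreads l fs) => [|src rest] E1.
  exists fs1; split => //; apply: runs_loop_stop.
  have := runs_next_bit l fs10 cmp1; rewrite -E1 /= n1 => R.
  have RB : runs (overwrite_step l a) (word fs1) (Some tt) (word fs1) (sw n + 0).+1.
    by apply: (runs_bind R); apply: runs_ret.
  apply: runs_leq RB.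
  by rewrite mulSn (leq_trans _ (leq_addr _ _)) // addn0 addn2 ltnS mul2n -addnn ltnW // ltnS leq_addr.
suff H m r : size src - r = m -> r <= size src -> forall fs1,
    map core fs1 = map core fs -> all (assigned rho) fs1 -> all (compared (take r src)) fs1 ->
    exists fs', [/\ runs (mloop (overwrite_step l a)) (word fs1) tt (word fs') (m.+1 * (2 * sw n + 2)),
      map core fs' = map core fs1 & all (assigned (override rho src a)) fs'].
  have [|fs2 [R2 co2 asg2]] := H _ 0 (erefl _) (leq0n _) fs1 co1 asg1.
    by rewrite take0.
  exists fs2; split => //; apply: runs_leq R2; rewrite leq_mul2r ltnS subn0.
  suff -> : size src <= n by rewrite orbT.
  have : src \in unreads l fs by rewrite E inE eqxx.
  case/mapP => f; rewrite mem_filter => /andP[_ /= ffs] ->; rewrite /n /word size_flatten.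
  rewrite /shape /origs size_map; elim: (fs) ffs => //= f' fs' IH; rewrite inE => /orP[/eqP <-|/IH le].
    by rewrite size_rcons size_map (leq_trans (leqnSn _)) // leq_addr.
  by rewrite (leq_trans le) // leq_addl.
elim: m r => [|m IH] r sr ler gs cog asgg cmpg.
  have rE : r = size src by apply/eqP; rewrite eqn_leq ler /= -subn_eq0 sr.
  have gs0 := core_nonempty (esym cog) fs0.
  have ng : size (word gs) = n by apply: size_word_core.
  have := runs_next_bit l gs0 cmpg; rewrite (unreads_core l cog) E /= rE take_size drop_size ng.
  move=> R; rewrite rE take_size in cmpg.
  have [gs' [R' co' asg']] := runs_assign_matched a gs0 cmpg asgg.
  exists gs'; split => //; apply: runs_loop_stop.
  rewrite ng in R'.
  have RB : runs (overwrite_step l a) (word gs) (Some tt) (word gs') (sw n + sw n).+1.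
    exact: (runs_bind R).
  apply: runs_leq RB.
  by rewrite mul1n mul2n -addnn addn2.
have lt : r < size src by rewrite -subn_gt0 sr.
have gs0 := core_nonempty (esym cog) fs0.
have ng : size (word gs) = n by apply: size_word_core.
have := runs_next_bit l gs0 cmpg; rewrite (unreads_core l cog) E /= ng.
rewrite size_takel // (drop_nth false lt) /= => R.
have [gs' [R' co' asg' cmp']] := runs_match_bit (nth false src r) gs0 cmpg asgg.
rewrite -take_nth // in cmp'; rewrite ng in R'.
have [||gs2 [R2 co2 asg2]] := IH r.+1 _ lt gs' _ asg' cmp'.
- by rewrite subnS sr.
- by rewrite co'.
exists gs2; split => //; last by rewrite co2.
have RB : runs (overwrite_step l a) (word gs) None (word gs') (sw n + sw n).+1.
  exact: (runs_bind R).
apply: runs_leq (runs_loop_next RB R2).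
by rewrite [m.+2 * _]mulSn mul2n -addnn addn2 !addSn.
Qed.

Definition pointer_init (l : 'I_D) : mach unit :=
  fsweep tt idb tt (fun _ _ s => (tt, set_used (cused s :\ l) s)) id.

(** The position of a pointer is stored on the tape, at the variables it has passed. The result
    tells whether it stands at a variable again. *)
Definition pointer_next (l : 'I_D) : mach bool :=
  fsweep tt idb None (fun g _ s =>
    if (crole s == RVar) && (l \notin cused s) then
      if g is None then (Some false, set_used (l |: cused s) s) else (Some true, s)
    else (g, s)) (fun g => g == Some true).

(** The part of [core] that moving the pointers preserves as well. *)
Definition static (fs : seq field) : seq (seq bool * role I T K) :=
  [seq (origs f, crole f.2) | f <- fs].

Definition var_numbers (st : seq (seq bool * role I T K)) : seq (seq bool) :=
  [seq c.1 | c <- st & c.2 == RVar].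

Lemma static_core fs fs' : map core fs = map core fs' -> static fs = static fs'.
Proof.
have E gs : static gs = [seq c.1 | c <- map core gs] by rewrite -map_comp.
by rewrite !E => ->.
Qed.

Lemma size_word_static fs fs' : static fs = static fs' -> size (word fs) = size (word fs').
Proof.
have E (gs : seq field) : size (word gs) = sumn [seq (size c.1).+1 | c <- static gs].
  rewrite size_flatten /shape -!map_comp; congr sumn; apply: eq_map => f /=.
  by rewrite size_rcons !size_map.
by rewrite !E => ->.
Qed.

Lemma static_nonempty fs fs' : static fs = static fs' -> fs != [::] -> fs' != [::].
Proof. by case: fs => //; case: fs'. Qed.

Lemma runs_pointer_init l fs : fs != [::] -> exists fs',
  [/\ runs (pointer_init l) (word fs) tt (word fs') (sw (size (word fs))),
      static fs' = static fs, unreads l fs' = var_numbers (static fs) &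
      forall l', l' != l -> unreads l' fs' = unreads l' fs].
Proof.
move=> fs0.
have := runs_fsweep tt idb tt (fun (_ _ : unit) s => (tt, set_used (cused s :\ l) s)) id fs0.
case: (fscan _ _ _ _ _).1.
have -> : (fscan tt idb (fun (_ _ : unit) s => (tt, set_used (cused s :\ l) s)) tt fs).2 =
    [seq (f.1, set_used (cused f.2 :\ l) f.2) | f <- fs].
  by elim: fs {fs0} => //= f fs <-; rewrite /fstep bscan_idb; case: fscan.
move=> R; eexists; split; first exact: R.
- by rewrite /static -map_comp.
- rewrite /unreads /var_numbers /static !filter_map -!map_comp; congr map.
  by apply: eq_filter => f; rewrite /= /unread /is_var /= !inE eqxx andbT.
- move=> l' l'l; rewrite /unreads !filter_map -!map_comp; congr map.
  by apply: eq_filter => f; rewrite /= /unread /is_var /= !inE l'l.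
Qed.

Lemma runs_pointer_next l fs : fs != [::] -> exists fs',
  [/\ runs (pointer_next l) (word fs) (behead (unreads l fs) != [::]) (word fs')
        (sw (size (word fs))),
      static fs' = static fs, unreads l fs' = behead (unreads l fs) &
      forall l', l' != l -> unreads l' fs' = unreads l' fs].
Proof.
move=> fs0; have := runs_fsweep tt idb None (fun g (_ : unit) (s : Cl) =>
    if (crole s == RVar) && (l \notin cused s) then
      if g is None then (Some false, set_used (l |: cused s) s) else (Some true, s)
    else (g, s)) (fun g => g == Some true) fs0.
set sst := fun g be s => _; move=> R.
have uE l' (f : field) gs : unreads l' (f :: gs) =
    if unread l' f then origs f :: unreads l' gs else unreads l' gs.
  by rewrite /unreads /=; case: ifP.
have rest b gs : fscan tt idb sst (Some b) gs = (Some (b || (unreads l gs != [::])), gs).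
  elim: gs b => [|f gs IH] b /=; first by rewrite orbF.
  rewrite uE /fstep bscan_idb /sst /unread /is_var; case: f => bs s /=.
  by case: ifP => _; rewrite IH /= ?orbT.
suff [E1 [E2 E3 E4]] : ((fscan tt idb sst None fs).1 == Some true) = (behead (unreads l fs) != [::]) /\
   [/\ static (fscan tt idb sst None fs).2 = static fs,
     unreads l (fscan tt idb sst None fs).2 = behead (unreads l fs) &
      forall l', l' != l -> unreads l' (fscan tt idb sst None fs).2 = unreads l' fs].
  by eexists; split; [rewrite -E1; exact: R|exact: E2|exact: E3|exact: E4].
elim: fs {fs0 R} => //= f fs [E1 [E2 E3 E4]].
rewrite /fstep bscan_idb /sst; case: f => bs s /=.
case: ifP => E.
  rewrite rest /= !uE; have -> : unread l (bs, s) by [].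
  split; first by case: (unreads l fs).
  split => //.
    by rewrite /unread /is_var /= !inE eqxx andbF.
  by move=> l' l'l; rewrite !uE /unread /is_var /= !inE (negbTE l'l).
move: E1 E2 E3 E4; case: fscan => g fs' /= E1 E2 E3 E4.
rewrite !uE; have -> : unread l (bs, s) = false by exact: E.
split => //; split => //; first by rewrite /static /= -/(static _) E2.
by move=> l' l'l; rewrite !uE E4.
Qed.

End Sweeps.

(** * Evaluating a circuit node by node *)

Fixpoint bval (bs : seq bool) : nat := if bs is b :: bs' then b + (bval bs').*2 else 0.

Lemma bval_nat_bits n : bval (nat_bits n) = n.
Proof.
rewrite /nat_bits -[RHS]bin_of_natK; case: (bin_of_nat n) => //= p.
elim: p => /= [p ->|p ->|] //; rewrite ?NatTrec.doubleE //.
Qed.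

Lemma nat_bits_inj : injective nat_bits.
Proof. exact: can_inj bval_nat_bits. Qed.

Section Evaluate.
Variables (I : finType) (ar : I -> nat) (T : finType) (o : ops_t ar T) (t0 : T).
Variables (K D : nat).

Local Notation role := (role I T K.+1).
Local Notation Cl := (cell I T K.+1 D).
Local Notation field := (seq bitc * Cl)%type.
Local Notation mach := (machine (bitc + Cl)%type).

Definition set_recv (r : option T) (s : Cl) : Cl :=
  Cell (crole s) (casg s) r (cval s) (cdone s) (cfst s) (csnd s) (cshort s) (cused s).
Definition set_result (v : T) (d x y : bool) (s : Cl) : Cl :=
  Cell (crole s) (casg s) (crecv s) v d x y (cshort s) (cused s).

(** Binary decrement, least significant bit first, with the borrow as state. A borrow left over at
    the end of the number shows that the counter was zero. *)
Definition dec_bit (be : bool) (x : bitc) : bool * bitc :=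
  if be then (~~ work x, (orig x, ~~ work x, mark x)) else (be, x).

(* The state of an evaluation sweep: the value found, the arguments of the current
   gate, and which outputs refer to the node evaluated in this sweep. *)
Local Notation estate := (option T * {ffun 'I_K.+1 -> T} * (bool * bool))%type.

(** The first pending node, met while no value has been found, is the node of this sweep; its cell
    also records which outputs point to it. *)
Definition finish (g : estate) (v : T) (s : Cl) : estate * Cl :=
  if g.1.1 is None then
    if cdone s then (g, s) else ((Some v, g.1.2, g.2), set_result v true g.2.1 g.2.2 s)
  else (g, s).

Definition gate_value (i : I) (acc : {ffun 'I_K.+1 -> T}) : T :=
  @o i (fun j => acc (inord j)).

(** The output references precede all nodes, so on arrival at a node it is known whether an output
    points to it. The default [t0] for a missing argument can affect only gates behind the node of
    this sweep, and their value is discarded. *)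
Definition eval_cell (g : estate) (z : bool) (s : Cl) : estate * Cl :=
  match crole s with
  | ROut b =>
    if z && ~~ cdone s then
      ((g.1, if b then (true, g.2.2) else (g.2.1, true)),
       set_result (cval s) true (cfst s) (csnd s) s)
    else (g, s)
  | RTag => (g, s)
  | RVar => finish g (casg s) s
  | RConst a => finish g a s
  | ROp i => if ar i == 0 then finish g (gate_value i g.1.2) s else (g, s)
  | RArg i j =>
    let s' := if crecv s is None then if z then set_recv g.1.1 s else s else s in
    let acc := [ffun x => if x == j then odflt t0 (crecv s') else g.1.2 x] in
    let g' := (g.1.1, acc, g.2) in
    if j.+1 == ar i then finish g' (gate_value i acc) s' else (g', s')
  end.

Let g0 : estate := (None, [ffun=> t0], (false, false)).

(* Sweep number [p] evaluates node [p] and decrements the working copy of every pending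
   reference; a reference whose working copy is already zero points to node [p]. *)
Definition eval_sweep : mach (option unit) :=
  fsweep true dec_bit g0 eval_cell (fun g => if g.1.1 is None then Some tt else None).

Lemma finish_role g v s : crole (finish g v s).2 = crole s.
Proof. by rewrite /finish; case: (g.1.1) => //; case: (cdone s). Qed.
Lemma finish_asg g v s : casg (finish g v s).2 = casg s.
Proof. by rewrite /finish; case: (g.1.1) => //; case: (cdone s). Qed.
Lemma finish_used g v s : cused (finish g v s).2 = cused s.
Proof. by rewrite /finish; case: (g.1.1) => //; case: (cdone s). Qed.
Lemma finish_recv g v s : crecv (finish g v s).2 = crecv s.
Proof. by rewrite /finish; case: (g.1.1) => //; case: (cdone s). Qed.

Lemma eval_cell_static g z s :
  [/\ crole (eval_cell g z s).2 = crole s, casg (eval_cell g z s).2 = casg s &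
      cused (eval_cell g z s).2 = cused s].
Proof.
rewrite /eval_cell; case E: (crole s) => [b|||a|i|i j];
  rewrite ?finish_role ?finish_asg ?finish_used //.
- by case: ifP; rewrite /= ?E.
- by case: ifP; rewrite ?finish_role ?finish_asg ?finish_used.
- set s' := if crecv s is None then _ else _.
  have [E1 E2 E3] : [/\ crole s' = crole s, casg s' = casg s & cused s' = cused s].
    by rewrite /s'; case: (crecv s) => //; case: ifP.
  by case: ifP => _; rewrite ?finish_role ?finish_asg ?finish_used /= E1 E2 E3 -E.
Qed.

Lemma dec_bit_orig be x : orig (dec_bit be x).2 = orig x.
Proof. by rewrite /dec_bit; case: be. Qed.

Lemma eval_core g fs :
  map (@core I T K.+1 D) (fscan true dec_bit eval_cell g fs).2 = map (@core I T K.+1 D) fs.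
Proof.
by apply: fscan_core => [be x|g' be s|g' be s]; rewrite ?dec_bit_orig //;
  case: (eval_cell_static g' be s).
Qed.

Lemma bscan_dec (bs : seq bitc) :
  let r := bscan dec_bit true bs in
  [/\ r.1 = (bval (map work bs) == 0), map orig r.2 = map orig bs &
      (0 < bval (map work bs) -> bval (map work r.2) = (bval (map work bs)).-1)].
Proof.
elim: bs => // x bs /=.
have F : bscan dec_bit false bs = (false, bs) by elim: bs => //= y bs ->.
case E: bscan => [be bs'] /= [E1 E2 E3].
case: (boolP (work x)) => wx; rewrite /= ?F ?E /=.
  by rewrite {2}/work /= add0n.
rewrite add0n double_eq0 E1 E2; split => // h; rewrite double_gt0 in h.
by rewrite E3 // /work /= -/(work x); case: (bval _) h.
Qed.

Section Invariant.
Variables (vs : seq T) (out1 out2 : nat).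

Definition numeral (f : field) : nat := bval (origs f).

(** Nothing is claimed once the counter has been decremented past zero; the reference has been
    served by then. *)
Definition counter (p : nat) (f : field) : bool :=
  (p <= numeral f) ==> (bval (map work f.1) == numeral f - p).

Definition ended (p k : nat) (s : Cl) : bool :=
  [&& cdone s == (k < p), (k < p) ==> (cval s == nth t0 vs k),
      cfst s == (k < p) && (k == out1) & csnd s == (k < p) && (k == out2)].

(** The state of a field of node [k] before sweep [p]: nodes below [p] are done, and references to
    them have received their values. *)
Definition evf (p k : nat) (f : field) : bool :=
  match crole f.2 with
  | ROut _ => (cdone f.2 == (numeral f < p)) && counter p f
  | RTag => true
  | RVar | RConst _ => ended p k f.2
  | ROp i => (ar i == 0) ==> ended p k f.2
  | RArg i j =>
    [&& crecv f.2 == if numeral f < p then Some (nth t0 vs (numeral f)) else None,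
        counter p f & (j.+1 == ar i) ==> ended p k f.2]
  end.

(** The state of sweep [p] on arrival at node [k], the output fields having been read. *)
Definition gst (p k : nat) (g : estate) : Prop :=
  g.1.1 = (if p < k then Some (nth t0 vs p) else None) /\ g.2 = (out1 == p, out2 == p).

(** A node before [p] is done already, a node after [p] is met when the value has been found, and
    node [p] itself is evaluated now. *)
Lemma finish_correct p k g v s : gst p k g -> (k = p -> v = nth t0 vs k) ->
  ended p k s ->
  gst p k.+1 (finish g v s).1 /\ ended p.+1 k (finish g v s).2.
Proof.
move=> [g1 g2] vE /and4P[/eqP d /implyP cv /eqP f1 /eqP f2].
rewrite /finish g1 /gst /ended; have [lt|gt|E] := ltngtP p k.
- have e1 : p < k.+1 by rewrite ltnS ltnW.
  have e2 : (k < p.+1) = false by rewrite ltnS leqNgt lt.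
  have e3 : (k < p) = false by rewrite ltnNge ltnW.
  by rewrite /= g1 g2 e1 e2 lt d f1 f2 e3.
- have e1 : (p < k.+1) = false by rewrite ltnS leqNgt gt.
  have e2 : k < p.+1 by rewrite ltnS ltnW.
  have e3 : (p < k) = false by rewrite ltnNge ltnW.
  by rewrite /= d gt /= g1 g2 e1 e2 e3 d f1 f2 gt /= cv // !eqxx.
- by rewrite /= d -E ltnn /= ltnSn /= g2 vE // -E /= !eqxx ![_ == p]eq_sym !eqxx.
Qed.

Lemma counter_step p (f : field) s' : counter p f ->
  let r := bscan dec_bit true f.1 in
  counter p.+1 (r.2, s') /\ (p <= numeral f -> r.1 = (numeral f == p)).
Proof.
rewrite /counter /numeral /origs /= => /implyP H.
have [E1 E2 E3] := bscan_dec f.1; rewrite E2; split.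
  apply/implyP => lt; have := H (ltnW lt) => /eqP E; rewrite E3 E ?subn_gt0 //.
  by rewrite subnS.
by move=> le; have /eqP E := H le; rewrite E1 E subn_eq0 eqn_leq le andbT.
Qed.

Lemma eval_arg p k g (f : field) i j :
  crole f.2 = RArg i j -> numeral f < k -> evf p k f -> gst p k g ->
  let r := fstep true dec_bit eval_cell g f in
  let acc := [ffun x => if x == j then (if numeral f <= p then nth t0 vs (numeral f) else t0)
                        else g.1.2 x] in
  (j.+1 != ar i -> r.1 = (g.1.1, acc, g.2) /\ evf p.+1 k r.2) /\
  (j.+1 == ar i -> (k = p -> gate_value i acc = nth t0 vs k) ->
     gst p k.+1 r.1 /\ evf p.+1 k r.2).
Proof.
move=> fr mk; rewrite {1}/evf fr => /and3P[/eqP rv ct /implyP en] [g1 g2].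
rewrite /fstep; have [ct' beE] := counter_step f.2 ct; have [_ E2 _] := bscan_dec f.1.
move: ct' beE E2; case: (bscan dec_bit true f.1) => be bs' /= ct' beE E2.
have {}ct' t : counter p.+1 (bs', t) by exact: ct'.
rewrite /eval_cell fr.
set s' := if crecv f.2 is None then _ else _.
have sE : crecv s' = if numeral f <= p then Some (nth t0 vs (numeral f)) else None.
  rewrite /s' rv; have [lt|gt|E] := ltngtP (numeral f) p.
  - by rewrite rv lt.
  - by rewrite beE ?(ltnW gt) // (gtn_eqF gt) rv ltnNge (ltnW gt).
  (* A reference to node [p] occurs in a later node, so the value of node [p] is at hand when the
     reference is reached. *)
  - by rewrite beE ?E // eqxx /= g1 -E mk.
have [rs [ds [vs' [fs' ss]]]] : crole s' = crole f.2 /\ cdone s' = cdone f.2 /\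
    cval s' = cval f.2 /\ cfst s' = cfst f.2 /\ csnd s' = csnd f.2.
  by rewrite /s'; case: (crecv f.2) => //; case: ifP.
have endE p' : ended p' k s' = ended p' k f.2 by rewrite /ended ds vs' fs' ss.
have -> : [ffun x => if x == j then odflt t0 (crecv s') else g.1.2 x] =
    [ffun x => if x == j then if numeral f <= p then nth t0 vs (numeral f) else t0
               else g.1.2 x].
  by apply/ffunP => x; rewrite !ffunE sE; case: (numeral f <= p).
have nE t : numeral (bs', t) = numeral f by rewrite /numeral /origs /= E2.
split => jE; rewrite ?(negbTE jE) ?jE.
  split => //=; rewrite /evf /= rs fr nE sE ltnS eqxx ct' /=.
  by rewrite (negbTE jE).
move=> vE; have := en jE; rewrite -endE => en'.
set g' := (_, _, g.2); have gg' : gst p k g' by split.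
have [] := finish_correct gg' vE en'.
have := finish_role g' (gate_value i g'.1.2) s'; have := finish_recv g' (gate_value i g'.1.2) s'.
case: finish => g'' s'' /= rE rrE gs es; split => //.
by rewrite /evf /= rrE rs fr nE rE sE ltnS eqxx ct' jE es.
Qed.

Definition node_fields (n : cnode ar T) : seq (nat * role) :=
  match n with
  | CVar v => [:: (0, RTag); (v, RVar)]
  | CConst a => [:: (1, RTag); (nat_of_ord (enum_rank a), RConst a)]
  | CGate i ch => [:: (2, RTag); (nat_of_ord (enum_rank i), ROp i)] ++
      [seq (ch j, RArg i (inord j)) | j <- enum 'I_(ar i)]
  end.

Definition as_bits (st : seq (nat * role)) : seq (seq bool * role) :=
  [seq (nat_bits c.1, c.2) | c <- st].

Hypothesis arK : forall i, ar i <= K.+1.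

Lemma static_cons (fl : seq field) m r st : static fl = as_bits ((m, r) :: st) ->
  exists f fl', [/\ fl = f :: fl', numeral f = m, origs f = nat_bits m, crole f.2 = r &
    static fl' = as_bits st].
Proof.
case: fl => //= f fl' [E1 E2 E3]; exists f, fl'; split => //.
by rewrite /numeral E1 bval_nat_bits.
Qed.

Lemma eval_args p k g i (ch : 'I_(ar i) -> nat) n (fl : seq field) :
  n < ar i ->
  static fl = as_bits [seq (ch j, RArg i (inord j)) | j <- drop n (enum 'I_(ar i))] ->
  (forall j, ch j < k) -> (k = p -> nth t0 vs k = @o i (fun j => nth t0 vs (ch j))) ->
  all (evf p k) fl -> gst p k g ->
  (k = p -> forall j : 'I_(ar i), j < n -> g.1.2 (inord j) = nth t0 vs (ch j)) ->
  let r := fscan true dec_bit eval_cell g fl in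
  gst p k.+1 r.1 /\ all (evf p.+1 k) r.2.
Proof.
elim: {n}(ar i - n) {-2}n (erefl (ar i - n)) fl g => [|q IH] n nE fl g ltn.
  by move: ltn; rewrite -subn_gt0 nE.
have -> : drop n (enum 'I_(ar i)) = Ordinal ltn :: drop n.+1 (enum 'I_(ar i)).
  rewrite (drop_nth (Ordinal ltn)) ?size_enum_ord //; congr cons.
  by apply: val_inj; rewrite /= nth_enum_ord.
move=> /static_cons[f [fl' [-> fn _ fr fst]]] chk vE /= /andP[ef efl] gg accP.
have ltK : n < K.+1 by exact: leq_trans (ltn) (arK i).
have inK (j : 'I_(ar i)) : (inord j : 'I_K.+1) = j :> nat.
  by rewrite inordK // (leq_trans (ltn_ord j)).
have mk : numeral f < k by rewrite fn.
have := eval_arg fr mk ef gg; case: fstep => g' f'.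
set acc := finfun _ => /= -[H1 H2].
have accP' : k = p -> forall j : 'I_(ar i), j < n.+1 -> acc (inord j) = nth t0 vs (ch j).
  move=> kp j; rewrite ltnS leq_eqVlt /acc ffunE fn => jn.
  have -> : ((inord j : 'I_K.+1) == inord (Ordinal ltn)) = (j == n :> nat).
    by rewrite -val_eqE /= inK inordK.
  case/orP: jn => [/eqP jn|jn]; last by rewrite (ltn_eqF jn) accP.
  have -> : Ordinal ltn = j by apply: val_inj; rewrite /= jn.
  by rewrite jn eqxx -kp ltnW.
rewrite inordK // in H1 H2.
have [last|nlast] := eqVneq n.+1 (ar i).
  have vE' : k = p -> gate_value i acc = nth t0 vs k.
    move=> kp; rewrite vE // /gate_value; congr (o _).
    apply: functional_extensionality => j; apply: accP' => //.
    by rewrite last.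
  have [gs ef'] := H2 (introT eqP last) vE'.
  have -> : fl' = [::].
    apply/eqP; rewrite -size_eq0 -(size_map (fun f : field => (origs f, crole f.2))) -/(static _) fst.
    by rewrite /as_bits !size_map size_drop size_enum_ord last subnn.
  by rewrite /= ef'.
have [gE ef'] := H1 nlast.
have ltn' : n.+1 < ar i by rewrite ltn_neqAle nlast.
have gg' : gst p k g' by rewrite gE; exact: gg.
have [||gs es] := IH n.+1 _ fl' g' ltn' fst chk vE efl gg'.
- by rewrite subnS nE.
- by rewrite gE /= => kp; apply: accP'.
by move: gs es; case: fscan => g'' fl'' /= gs ->; rewrite ef'.
Qed.

Lemma fstepE g (f : field) : fstep true dec_bit eval_cell g f =
  ((eval_cell g (bscan dec_bit true f.1).1 f.2).1,
   ((bscan dec_bit true f.1).2, (eval_cell g (bscan dec_bit true f.1).1 f.2).2)).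
Proof. by rewrite /fstep; case: bscan => be bs /=; case: eval_cell. Qed.

Lemma eval_node p k g (e : nat -> T) (rho : seq bool -> T) n (fl : seq field) :
  static fl = as_bits (node_fields n) ->
  (forall v, e v = rho (nat_bits v)) -> all (assigned rho) fl ->
  (if n is CGate i ch then forall j, ch j < k else True) ->
  (k = p -> nth t0 vs k = node_val o e (take k vs) n) -> k <= size vs ->
  all (evf p k) fl -> gst p k g ->
  let r := fscan true dec_bit eval_cell g fl in
  gst p k.+1 r.1 /\ all (evf p.+1 k) r.2.
Proof.
case: n => [v|a|i ch] st eE asg wf vE szk.
- have [f [fl0 [E _ _ fr /static_cons[f1 [fl1 [E1 _ fo1 fr1 st1]]]]]] := static_cons st.
  have {}st1 : fl1 = [::] by case: (fl1) st1.
  subst => /= /and3P[_ ef _] gg; move: asg => /= /and3P[_ asg _].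
  rewrite !fstepE /eval_cell fr /= fr1.
  have vE' : k = p -> casg f1.2 = nth t0 vs k.
    move=> kp; rewrite vE //= eE -fo1; apply/eqP; move: asg.
    by rewrite /assigned /is_var fr1 eqxx.
  have := ef; rewrite /evf fr1 => en.
  have := finish_correct gg vE' en; have := finish_role g (casg f1.2) f1.2.
  by case: finish => g' s' /= rE [gs es]; rewrite /evf /= fr rE fr1 es.
- have [f [fl0 [E _ _ fr /static_cons[f1 [fl1 [E1 _ fo1 fr1 st1]]]]]] := static_cons st.
  have {}st1 : fl1 = [::] by case: (fl1) st1.
  subst => /= /and3P[_ ef _] gg.
  rewrite !fstepE /eval_cell fr /= fr1.
  have vE' : k = p -> a = nth t0 vs k by move=> kp; rewrite vE.
  have := ef; rewrite /evf fr1 => en.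
  have := finish_correct gg vE' en; have := finish_role g a f1.2.
  by case: finish => g' s' /= rE [gs es]; rewrite /evf /= fr rE fr1 es.
have [f [fl0 [E _ _ fr /static_cons[f1 [fl1 [E1 _ fo1 fr1 st1]]]]]] := static_cons st.
have {}st1 : static fl1 = as_bits [seq (ch j, RArg i (inord j)) | j <- enum 'I_(ar i)] := st1.
have {}vE : k = p -> nth t0 vs k = @o i (fun j => nth t0 vs (ch j)).
  move=> kp; rewrite vE //=; congr (o _); apply: functional_extensionality => j.
  rewrite nth_take // (set_nth_default t0) //.
  exact: leq_trans (wf j) szk.
subst => /= /and3P[_ ef efl] gg.
have tagE z : eval_cell g z f.2 = (g, f.2) by rewrite /eval_cell fr.
have opE z : eval_cell g z f1.2 =
    if ar i == 0 then finish g (gate_value i g.1.2) f1.2 else (g, f1.2).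
  by rewrite /eval_cell fr1.
rewrite fstepE tagE /= fstepE opE.
have [ar0|ar0] := eqVneq (ar i) 0.
  have {}st1 : fl1 = [::].
    apply/eqP; rewrite -size_eq0 -(size_map (fun f : field => (origs f, crole f.2))) -/(static _) st1.
    by rewrite /as_bits size_map size_map size_enum_ord ar0.
  subst; have vE' : k = p -> gate_value i g.1.2 = nth t0 vs k.
    move=> kp; rewrite vE // /gate_value; congr (o _).
    by apply: functional_extensionality => j; have := ltn_ord j; rewrite {2}ar0.
  have := ef; rewrite /evf fr1 ar0 /= => en.
  have := finish_correct gg vE' en; have := finish_role g (gate_value i g.1.2) f1.2.
  by case: finish => g' s' /= rE [gs es]; rewrite /evf /= fr rE fr1 ar0 es.
have lt0 : 0 < ar i by rewrite lt0n.
rewrite -[enum _]drop0 in st1.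
have [//|gs es] := eval_args lt0 st1 wf vE efl gg.
move: gs es; case: fscan => g' fl' /= gs ->.
by rewrite /evf /= fr fr1 (negbTE ar0).
Qed.

Lemma eval_out p g (f : field) b : crole f.2 = ROut b -> evf p 0 f ->
  let r := fstep true dec_bit eval_cell g f in
  evf p.+1 0 r.2 /\
  r.1 = (g.1, if b then (g.2.1 || (numeral f == p), g.2.2)
              else (g.2.1, g.2.2 || (numeral f == p))).
Proof.
move=> fr; rewrite {1}/evf fr => /andP[/eqP dn ct].
have [ct' beE] := counter_step f.2 ct; have [_ E2 _] := bscan_dec f.1.
rewrite fstepE; move: ct' beE E2; case: (bscan dec_bit true f.1) => be bs' /= ct' beE E2.
have nE t : numeral (bs', t) = numeral f by rewrite /numeral /origs /= E2.
have {}ct' t : counter p.+1 (bs', t) by exact: ct'.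
rewrite /eval_cell fr dn /evf; have [lt|gt|E] := ltngtP (numeral f) p.
- have e1 : numeral f < p.+1 by rewrite ltnS ltnW.
  rewrite andbF /= fr nE dn lt e1 ct' !orbF; split => //.
  by case: g => [? [? ?]]; case: b {fr}.
- have e1 : (numeral f < p.+1) = false by rewrite ltnS leqNgt gt.
  have e2 : (numeral f < p) = false by rewrite ltnNge ltnW.
  rewrite beE ?(ltnW gt) // (gtn_eqF gt) /= fr nE dn e1 e2 ct' !orbF; split => //.
  by case: g => [? [? ?]]; case: b {fr}.
- by rewrite beE ?E // eqxx /= fr nE ct' E ltnS leqnn !orbT; split.
Qed.

Definition is_final (r : role) : bool :=
  match r with
  | RVar | RConst _ => true
  | ROp i => ar i == 0
  | RArg i j => j.+1 == ar i
  | _ => false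
  end.

(** Values and output flags are kept in the last field of a node only; hence the final comparison
    reads each node once. *)
Lemma node_fields_final n : exists st c, [/\ node_fields n = rcons st c,
  all (fun c => ~~ is_final c.2) st & is_final c.2].
Proof.
case: n => [v|a|i ch] /=; first by exists [:: (0, RTag)], (v, RVar).
  by exists [:: (1, RTag)], (nat_of_ord (enum_rank a), RConst a).
have [ar0|ar0] := posnP (ar i).
  have -> : enum 'I_(ar i) = [::] by apply/eqP; rewrite -size_eq0 size_enum_ord ar0.
  by exists [:: (2, RTag)], (nat_of_ord (enum_rank i), ROp i); rewrite /= ar0.
have iE : iota 0 (ar i) = rcons (iota 0 (ar i).-1) (ar i).-1.
  by rewrite -cats1 -{1}(prednK ar0) -addn1 iotaD.
have := val_enum_ord (ar i); rewrite iE; case/lastP: (enum 'I_(ar i)) => [|js j].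
  by case: (iota 0 _).
rewrite map_rcons => /rcons_inj[E1 E2].
exists ((2, RTag) :: (nat_of_ord (enum_rank i), ROp i) ::
   [seq (ch j, RArg i (inord j)) | j <- js]), (ch j, RArg i (inord j)).
have inK (j' : 'I_(ar i)) : (inord j' : 'I_K.+1) = j' :> nat.
  by rewrite inordK // (leq_trans (ltn_ord j')).
split; first by rewrite map_rcons.
- rewrite /= -lt0n ar0 all_map /=; apply/allP => j' j'js /=.
  have : val j' \in iota 0 (ar i).-1 by rewrite -E1 map_f.
  by rewrite mem_iota inK /= add0n => lt; rewrite ltn_eqF //; move: lt; rewrite -ltnS prednK.
- by rewrite /= inK E2 prednK.
Qed.

Lemma evf_ended p k (f : field) : is_final (crole f.2) -> evf p k f -> ended p k f.2.
Proof.
rewrite /evf; case: (crole f.2) => //= [i ->//|i j jE].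
by rewrite jE => /and3P[].
Qed.

Fixpoint evnodes (p k : nat) (ns : seq (cnode ar T)) (fs : seq field) : Prop :=
  if ns is n :: ns' then
    exists fl fs', [/\ fs = fl ++ fs', static fl = as_bits (node_fields n),
      all (evf p k) fl & evnodes p k.+1 ns' fs']
  else fs = [::].

Lemma static_eval g fs : static (fscan true dec_bit eval_cell g fs).2 = static fs.
Proof. by apply: static_core; apply: eval_core. Qed.

Lemma assigned_eval rho g fs : all (assigned rho) fs ->
  all (assigned rho) (fscan true dec_bit eval_cell g fs).2.
Proof.
apply: fscan_all => g' f; rewrite fstepE /assigned /is_var /origs /=.
have [_ -> _] := bscan_dec f.1.
by have [-> -> _] := eval_cell_static g' (bscan dec_bit true f.1).1 f.2.
Qed.

Lemma eval_nodes p (e : nat -> T) rho ns k g fs :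
  (forall v, e v = rho (nat_bits v)) -> all (assigned rho) fs ->
  (forall j, j < size ns ->
     [/\ if nth (CVar ar T 0) ns j is CGate i ch then forall j', ch j' < k + j else True,
         nth t0 vs (k + j) = node_val o e (take (k + j) vs) (nth (CVar ar T 0) ns j) &
         k + j <= size vs]) ->
  evnodes p k ns fs -> gst p k g ->
  let r := fscan true dec_bit eval_cell g fs in
  gst p (k + size ns) r.1 /\ evnodes p.+1 k ns r.2.
Proof.
move=> eE; elim: ns k g fs => [|n ns IH] k g fs asg H.
  by move=> -> /=; rewrite addn0.
move=> [fl [fs' [fsE st ev evs]]] gg.
move: asg; rewrite fsE all_cat => /andP[asg1 asg2].
have [wf vE sz] := H 0 isT; rewrite addn0 in wf vE sz.
have [gs es] := eval_node st eE asg1 wf (fun _ => vE) sz ev gg.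
rewrite fscan_cat /= addnS -addSn.
have [|gs' es'] := IH k.+1 _ fs' asg2 _ evs gs.
  by move=> j lt; have := H j.+1 lt; rewrite addnS -addSn.
split => //; exists (fscan true dec_bit eval_cell g fl).2; eexists; split => //.
by rewrite static_eval.
Qed.

Definition check_cell (g : option T * option T) (be : unit) (s : Cl) :=
  ((if is_final (crole s) then
     (if cfst s then Some (cval s) else g.1, if csnd s then Some (cval s) else g.2)
   else g), s).

Definition check : mach bool :=
  fsweep tt idb (None, None) check_cell (fun g => g.1 == g.2).

Lemma check_nodes p k ns fs g : k + size ns <= p -> evnodes p k ns fs ->
  fscan tt idb check_cell g fs =
  ((if k <= out1 < k + size ns then Some (nth t0 vs out1) else g.1,
    if k <= out2 < k + size ns then Some (nth t0 vs out2) else g.2), fs).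
Proof.
elim: ns k fs g => [|n ns IH] k fs g /=.
  move=> _ ->; rewrite addn0 !ltnNge !andbN /=; by case: g.
move=> le [fl [fs' [-> st ev evs]]]; rewrite fscan_cat.
have stepE g' (f : field) : fstep tt idb check_cell g' f = ((check_cell g' tt f.2).1, f).
  by rewrite /fstep bscan_idb /=; case: f.
have -> : fscan tt idb check_cell g fl =
   ((if k == out1 then Some (nth t0 vs out1) else g.1,
     if k == out2 then Some (nth t0 vs out2) else g.2), fl).
  have [cs [c [nE ncs fc]]] := node_fields_final n.
  move: st ev; rewrite nE /as_bits map_rcons.
  case/lastP: fl => [|fl f]; first by case: (cs).
  rewrite /static map_rcons => /rcons_inj[E1 _ E2].
  rewrite all_rcons => /andP[evfl _].
  rewrite -cats1 fscan_cat.
  have -> : fscan tt idb check_cell g fl = (g, fl).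
    have : all (fun f : field => ~~ is_final (crole f.2)) fl.
      rewrite -(all_map (fun f : field => (origs f, crole f.2)) (fun c => ~~ is_final c.2)).
      by rewrite E1 all_map.
    elim: (fl) => //= f' fl' IHl /andP[nf nfl].
    by rewrite stepE /check_cell (negbTE nf) IHl.
  rewrite /= stepE /check_cell.
  have ff : is_final (crole f.2) by rewrite E2.
  have := evf_ended ff evfl; rewrite /ended.
  have -> : k < p by apply: leq_trans le; rewrite -addn1 leq_add2l.
  rewrite /= => /and4P[_ /eqP -> /eqP -> /eqP ->]; rewrite ff.
  by congr (_, _, _); case: eqP => // ->.
rewrite (IH k.+1 fs') //; last by rewrite addSn -addnS.
rewrite addSn -addnS /=; congr (_, _, _).
- by case: (ltngtP k out1) => //= ->; rewrite addnS ltnS leq_addr.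
- by case: (ltngtP k out2) => //= ->; rewrite addnS ltnS leq_addr.
Qed.

End Invariant.
End Evaluate.

Section CircuitSearch.
Variables (I : finType) (ar : I -> nat) (T : finType) (o : ops_t ar T) (t0 : T).
Variables (K D : nat).
Hypothesis arK : forall i, ar i <= K.+1.

Local Notation role := (role I T K.+1).
Local Notation Cl := (cell I T K.+1 D).
Local Notation field := (seq bitc * Cl)%type.
Local Notation mach := (machine (bitc + Cl)%type).

Definition run_nodes (e : nat -> T) (ns : seq (cnode ar T)) : seq T :=
  foldl (fun prev n => rcons prev (node_val o e prev n)) [::] ns.

Lemma run_nodes_rcons e ns n :
  run_nodes e (rcons ns n) = rcons (run_nodes e ns) (node_val o e (run_nodes e ns) n).
Proof. by rewrite /run_nodes -cats1 foldl_cat. Qed.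

Lemma size_run_nodes e ns : size (run_nodes e ns) = size ns.
Proof. by elim/last_ind: ns => // ns n IH; rewrite run_nodes_rcons !size_rcons IH. Qed.

Lemma nth_run_nodes e ns x n0 k : k < size ns ->
  nth x (run_nodes e ns) k = node_val o e (take k (run_nodes e ns)) (nth n0 ns k).
Proof.
elim/last_ind: ns => // ns n IH; rewrite run_nodes_rcons size_rcons ltnS leq_eqVlt.
rewrite !nth_rcons size_run_nodes => /orP[/eqP ->|lt].
  by rewrite ltnn eqxx -cats1 takel_cat ?size_run_nodes // take_oversize ?size_run_nodes.
by rewrite lt IH // -cats1 takel_cat // size_run_nodes ltnW.
Qed.

Definition circuit_fields (c : circuit ar T) : seq (nat * role) :=
  [:: (cout1 c, ROut true); (cout2 c, ROut false)] ++
  flatten [seq node_fields K n | n <- cnodes c].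

Definition set_rewound (s : Cl) : Cl :=
  Cell (crole s) (casg s) None (cval s) false false false (cshort s) (cused s).

(** Evaluation uses up the counters; the original bits serve to restore them for the next
    attempt. *)
Definition rewind : mach unit :=
  fsweep tt (fun be x => (be, (orig x, orig x, mark x))) tt
    (fun _ _ s => (tt, set_rewound s)) id.

Lemma runs_rewind vs out1 out2 rho (fs : seq field) : fs != [::] ->
  all (assigned rho) fs -> exists fs',
  [/\ runs rewind (word fs) tt (word fs') (sw (size (word fs))),
      map (@core I T K.+1 D) fs' = map (@core I T K.+1 D) fs, all (assigned rho) fs' &
      forall k, all (evf ar t0 vs out1 out2 0 k) fs'].
Proof.
move=> fs0 asg.
have bE (be : unit) (bs : seq bitc) :
    bscan (fun be x => (be, (orig x, orig x, mark x))) be bs =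
    (be, [seq (orig x, orig x, mark x) : bitc | x <- bs]).
  by elim: bs => //= x bs ->.
have := runs_fsweep tt (fun be (x : bitc) => (be, (orig x, orig x, mark x) : bitc)) tt
   (fun (_ _ : unit) s => (tt, set_rewound s)) id fs0.
case: (fscan _ _ _ _ _).1 => R; eexists; split; first exact: R.
- exact: fscan_core.
- apply: fscan_all asg => g [bs s]; rewrite /fstep bE /assigned /is_var /origs /=.
  by rewrite -map_comp.
- move=> k; apply: (fscan_all _ (P := predT)); last exact: all_predT.
  move=> g [bs s] _; rewrite /fstep bE /=.
  have ct t : counter 0 ([seq (orig x, orig x, mark x) : bitc | x <- bs], t : Cl).
    rewrite /counter /numeral /origs subn0; apply/implyP => _; apply/eqP.
    by rewrite -!map_comp.
  by rewrite /evf /=; case: (crole s) => [b|||a|i|i j] /=; rewrite ?ct ?implybT.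
Qed.

Definition evaluate : mach bool :=
  mbind rewind (fun _ => mbind (mloop (eval_sweep o t0 K D)) (fun _ => check ar T K D)).

Definition evaluate_time (n : nat) : nat := sw n + n.+1 * (sw n + 1) + sw n + 2.

Definition verdict (c : circuit ar T) (rho : seq bool -> T) : bool :=
  let vs := circuit_vals o (fun v => rho (nat_bits v)) c in
  nth t0 vs (cout1 c) == nth t0 vs (cout2 c).

(** The hypothesis is for every [k] because a freshly rewound field satisfies [evf] whatever node it
    belongs to. *)
Lemma split_nodes vs out1 out2 p k (ns : seq (cnode ar T)) (fs : seq field) :
  static fs = as_bits (flatten [seq node_fields K n | n <- ns]) ->
  (forall k, all (evf ar t0 vs out1 out2 p k) fs) ->
  evnodes t0 vs out1 out2 p k ns fs.
Proof.
elim: ns k fs => [|n ns IH] k fs /=; first by case: fs.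
move=> st ev; set m := size (node_fields K n).
have szE : size fs = m + size (flatten [seq node_fields K n | n <- ns]).
  by rewrite -(size_map (fun f : field => (origs f, crole f.2))) -/(static _) st
    /as_bits map_cat size_cat !size_map.
exists (take m fs), (drop m fs).
have stt : static (take m fs) = as_bits (node_fields K n).
  by rewrite /static map_take -/(static _) st /as_bits map_cat take_size_cat ?size_map.
split => //; first by rewrite cat_take_drop.
- by have := ev k; rewrite -{1}(cat_take_drop m fs) all_cat => /andP[].
- apply: IH.
    by rewrite /static map_drop -/(static _) st /as_bits map_cat drop_size_cat ?size_map.
  by move=> k'; have := ev k'; rewrite -{1}(cat_take_drop m fs) all_cat => /andP[].
Qed.

Lemma runs_evaluate c rho (fs : seq field) : wf_circuit c ->
  static fs = as_bits (circuit_fields c) -> all (assigned rho) fs -> exists fs',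
  [/\ runs evaluate (word fs) (verdict c rho) (word fs') (evaluate_time (size (word fs))) &
      map (@core I T K.+1 D) fs' = map (@core I T K.+1 D) fs].
Proof.
move=> [wf1 wf2 wf] st asg; have fs0 : fs != [::] by case: (fs) st.
set n := size (word fs).
pose e v := rho (nat_bits v).
pose vs := circuit_vals o e c; pose ns := cnodes c.
have [fs1 [R1 co1 asg1 ev1]] := runs_rewind vs (cout1 c) (cout2 c) fs0 asg.
have szvs : size vs = size ns by exact: size_run_nodes.
pose inv p (gs : seq field) := [/\ map (@core I T K.+1 D) gs = map (@core I T K.+1 D) fs,
  all (assigned rho) gs &
  exists f1 f2 rest, [/\ gs = [:: f1, f2 & rest],
    evf ar t0 vs (cout1 c) (cout2 c) p 0 f1, evf ar t0 vs (cout1 c) (cout2 c) p 0 f2 &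
    evnodes t0 vs (cout1 c) (cout2 c) p 0 ns rest]].
have inv0 : inv 0 fs1.
  split => //; have := static_core co1; rewrite st.
  case: (fs1) ev1 => [|f1 [|f2 rest]] // ev1 [_ _ _ _ st1].
  exists f1, f2, rest; split => //; try by have := ev1 0; case/and3P.
  by apply: split_nodes => // k; have := ev1 k; case/and3P.
have step p gs : inv p gs -> exists gs', inv p.+1 gs' /\
    runs (eval_sweep o t0 K D) (word gs) (if p < size ns then None else Some tt) (word gs') (sw n).
  move=> [cog asgg [f1 [f2 [rest [gsE e1 e2 er]]]]].
  have gs0 := core_nonempty (esym cog) fs0.
  have ng : size (word gs) = n by apply: size_word_core.
  have := static_core cog; rewrite st gsE => -[o1 r1 o2 r2 str].
  pose g0 : option T * {ffun 'I_K.+1 -> T} * (bool * bool) := (None, [ffun=> t0], (false, false)).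
  have R := runs_fsweep true dec_bit g0 (eval_cell o t0 (D := D))
     (fun g => if g.1.1 is None then Some tt else None) gs0.
  set r := fscan true dec_bit (eval_cell o t0 (D := D)) g0 gs.
  have [E1 E2] := eval_out o g0 r1 e1.
  have [E3 E4] := eval_out o (fstep true dec_bit (eval_cell o t0 (D := D)) g0 f1).1 r2 e2.
  have nf1 : numeral f1 = cout1 c by rewrite /numeral o1 bval_nat_bits.
  have nf2 : numeral f2 = cout2 c by rewrite /numeral o2 bval_nat_bits.
  pose g1 := (fstep true dec_bit (eval_cell o t0 (D := D)) g0 f1).1.
  pose g2 := (fstep true dec_bit (eval_cell o t0 (D := D)) g1 f2).1.
  have gg : gst t0 vs (cout1 c) (cout2 c) p 0 g2.
    by rewrite /g2 E4 /gst /= E2 /= nf1 nf2.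
  have asgr : all (assigned rho) rest by move: asgg; rewrite gsE => /and3P[].
  have wfn j : j < size ns ->
     [/\ if nth (CVar ar T 0) ns j is CGate i ch then forall j', ch j' < 0 + j else True,
         nth t0 vs (0 + j) = node_val o e (take (0 + j) vs) (nth (CVar ar T 0) ns j) &
         0 + j <= size vs].
    move=> lt; split; [exact: wf|exact: nth_run_nodes|by rewrite szvs ltnW].
  have [gE erE] := eval_nodes (o := o) arK (fun v => erefl (e v)) asgr wfn er gg.
  have rE : r = ((fscan true dec_bit (eval_cell o t0 (D := D)) g2 rest).1,
     [:: (fstep true dec_bit (eval_cell o t0 (D := D)) g0 f1).2,
         (fstep true dec_bit (eval_cell o t0 (D := D)) g1 f2).2 &
         (fscan true dec_bit (eval_cell o t0 (D := D)) g2 rest).2]).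
    rewrite /r gsE /= /g2 /g1; case: (fstep _ _ _ g0 f1) => ga fa /=.
    by case: fstep => gb fb /=; case: fscan.
  exists r.2; split.
    split; [by rewrite eval_core|exact: assigned_eval|].
    by rewrite rE; do 3 eexists; split; first reflexivity.
  have outE : (if r.1.1.1 is None then Some tt else None) =
      if p < size ns then None else Some tt.
    by rewrite rE /=; case: gE => -> _; rewrite add0n; case: (p < _).
  by rewrite -outE -gsE; rewrite ng in R; exact: R.
(* Sweep [p] evaluates a node while [p < size ns]; one further sweep finds all nodes done and ends
   the loop. *)
have loop q p gs : size ns - p = q -> inv p gs -> exists gs', inv (p + q).+1 gs' /\
    runs (mloop (eval_sweep o t0 K D)) (word gs) tt (word gs') (q.+1 * (sw n + 1)).
  elim: q p gs => [|q IH] p gs pq ig; have [gs' [ig' R]] := step p gs ig.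
    exists gs'; rewrite addn0; split => //; apply: runs_loop_stop.
    rewrite ltnNge -subn_eq0 pq eqxx /= in R; apply: runs_leq R.
    by rewrite mul1n leq_addr.
  have lt : p < size ns by rewrite -subn_gt0 pq.
  have [|gs2 [ig2 R2]] := IH p.+1 gs' _ ig'; first by rewrite subnS pq.
  exists gs2; split; first by rewrite addnS -addSn.
  rewrite lt in R; apply: runs_leq (runs_loop_next R R2).
  by rewrite [q.+2 * _]mulSn addn1.
have [fs2 [i2 R2]] := loop _ 0 fs1 (erefl _) inv0; rewrite subn0 add0n in i2 R2.
have [co2 asg2 [f1 [f2 [rest [fsE _ _ er]]]]] := i2.
have fs20 := core_nonempty (esym co2) fs0.
have n2 : size (word fs2) = n by apply: size_word_core.
have := static_core co2; rewrite st fsE => -[_ r1 _ r2 _].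
have R3 := runs_fsweep tt idb (None, None) (@check_cell _ ar T K D) (fun g => g.1 == g.2) fs20.
exists fs2; split => //.
have scanE : fscan tt idb (@check_cell _ ar T K D) (None, None) fs2 =
    ((Some (nth t0 vs (cout1 c)), Some (nth t0 vs (cout2 c))), fs2).
  rewrite fsE /= /fstep !bscan_idb /= r1 r2 /=.
  have le2 : 0 + size ns <= (size ns).+1 by rewrite add0n.
  by rewrite (check_nodes arK _ le2 er) add0n /= wf1 wf2; case: (f1) (f2) => [? ?] [? ?].
rewrite n2 scanE /= in R3.
have le : size ns <= n.
  rewrite /n; apply: (@leq_trans (size fs)).
    rewrite -(size_map (fun f : field => (origs f, crole f.2))) -/(static _) st size_map.
    rewrite /circuit_fields size_cat (leq_trans _ (leq_addl _ _)) //.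
    rewrite size_flatten /shape -map_comp -/ns; elim: (ns) => //= nd ns' IH.
    by rewrite -add1n leq_add //; case: (nd).
  rewrite /word size_flatten /shape -map_comp; elim: (fs) => //= f fs' IH.
  by rewrite size_rcons -add1n leq_add.
have RR : runs (mbind (mloop (eval_sweep o t0 K D)) (fun _ => check ar T K D)) (word fs1)
    (verdict c rho) (word fs2) (n.+1 * (sw n + 1) + sw n).+1.
  apply: runs_leq (runs_bind R2 R3).
  by rewrite ltnS leq_add2r leq_mul2r ltnS le orbT.
apply: runs_leq (runs_bind R1 RR).
by rewrite /evaluate_time addnS addn2 addnA.
Qed.

End CircuitSearch.

(** * Enumerating pointer positions and values *)

Section Search.
Variables (I : finType) (ar : I -> nat) (T : finType) (o : ops_t ar T) (t0 : T).
Variables (K D : nat).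
Hypothesis arK : forall i, ar i <= K.+1.

Local Notation role := (role I T K.+1).
Local Notation Cl := (cell I T K.+1 D).
Local Notation field := (seq bitc * Cl)%type.
Local Notation mach := (machine (bitc + Cl)%type).
Local Notation ptrs fs := (fun l : 'I_D => unreads l fs).
Local Notation cores := (map (@core I T K.+1 D)).

Fixpoint overwrite_all (ls : seq 'I_D) (ts : 'I_D -> T) : mach bool :=
  if ls is l :: ls' then mbind (overwrite I K.+1 l (ts l)) (fun _ => overwrite_all ls' ts)
  else evaluate o t0 K D.

Definition override_all (rho : seq bool -> T) (ls : seq 'I_D) (ts : 'I_D -> T)
    (U : 'I_D -> seq (seq bool)) : seq bool -> T :=
  foldl (fun rho l => override_head rho (U l) (ts l)) rho ls.

Definition attempt (x : T * {ffun 'I_D -> T}) : mach bool :=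
  mbind (assign_all I K.+1 D x.1) (fun _ => overwrite_all (enum 'I_D) x.2).

Definition attempt_env (x : T * {ffun 'I_D -> T}) (U : 'I_D -> seq (seq bool)) :=
  override_all (fun _ => x.1) (enum 'I_D) x.2 U.

Definition attempt_time (n : nat) : nat :=
  sw n + (D * (overwrite_time n).+1 + evaluate_time n) + 1.

Lemma runs_attempt c x (fs : seq field) : wf_circuit c ->
  static fs = as_bits (circuit_fields K c) -> exists fs',
  runs (attempt x) (word fs) (verdict o t0 c (attempt_env x (ptrs fs))) (word fs')
    (attempt_time (size (word fs))) /\ cores fs' = cores fs.
Proof.
move=> wf st; have fs0 : fs != [::] by case: (fs) st.
have [fs1 [R1 co1 asg1]] := runs_assign_all x.1 fs0; set n := size (word fs) in R1 *.
suff [fs2 [R2 co2]] : exists fs',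
    runs (overwrite_all (enum 'I_D) x.2) (word fs1)
      (verdict o t0 c (attempt_env x (ptrs fs))) (word fs')
      (D * (overwrite_time n).+1 + evaluate_time n) /\ cores fs' = cores fs.
  by exists fs2; split => //; apply: runs_leq (runs_bind R1 R2); rewrite /attempt_time addn1.
have -> : D * (overwrite_time n).+1 = size (enum 'I_D) * (overwrite_time n).+1.
  by rewrite size_enum_ord.
rewrite /attempt_env.
elim: (enum 'I_D) (fun _ => x.1) fs1 co1 asg1 {R1} => [|l ls IH] rho gs cog asgg /=.
  have stg : static gs = as_bits (circuit_fields K c) by rewrite -st; apply: static_core.
  have [gs' [R co]] := runs_evaluate o t0 arK wf stg asgg.
  exists gs'; rewrite mul0n add0n /n -(size_word_core cog); split => //.
  by rewrite co.
have gs0 := core_nonempty (esym cog) fs0.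
have [gs1 [R1 co1 asg1]] := runs_overwrite l (x.2 l) gs0 asgg.
rewrite (unreads_core l cog) (size_word_core cog) -/n in R1 asg1.
have [|gs2 [R2 co2]] := IH _ gs1 _ asg1; first by rewrite co1.
exists gs2; split => //; apply: runs_leq (runs_bind R1 R2).
by rewrite mulSn -addnA addSn.
Qed.

Fixpoint try_all (X : Type) (F : X -> mach bool) (xs : seq X) : mach bool :=
  if xs is x :: xs' then mbind (F x) (fun b => if b then mret _ true else try_all F xs')
  else mret _ false.

(** The number of choices of values depends on [T] and [D] only, so they are enumerated by the
    finite control. *)
Definition body : mach bool := try_all attempt (enum {: T * {ffun 'I_D -> T}}).

Definition body_time (n : nat) : nat :=
  #|{: T * {ffun 'I_D -> T}}| * (attempt_time n + 1).

Definition good (c : circuit ar T) (U : 'I_D -> seq (seq bool)) : bool :=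
  has (fun x => verdict o t0 c (attempt_env x U)) (enum {: T * {ffun 'I_D -> T}}).

Lemma runs_body c (fs : seq field) : wf_circuit c ->
  static fs = as_bits (circuit_fields K c) -> exists fs',
  runs body (word fs) (good c (ptrs fs)) (word fs') (body_time (size (word fs))) /\
  cores fs' = cores fs.
Proof.
move=> wf st; rewrite /body_time cardE /good /body; set n := size (word fs).
suff H gs : cores gs = cores fs -> exists fs',
  runs (try_all attempt (enum {: T * {ffun 'I_D -> T}})) (word gs)
   (has (fun x => verdict o t0 c (attempt_env x (ptrs fs))) (enum {: T * {ffun 'I_D -> T}}))
   (word fs') (size (enum {: T * {ffun 'I_D -> T}}) * (attempt_time n + 1)) /\
  cores fs' = cores fs by exact: H.
elim: (enum _) gs => [|x xs IH] gs cog /=.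
  by exists gs; split => //; apply: runs_ret.
have stg : static gs = as_bits (circuit_fields K c) by rewrite -st; apply: static_core.
have [gs1 [R1 co1]] := runs_attempt x wf stg.
have UE : ptrs gs = ptrs fs.
  by apply: functional_extensionality => l; apply: unreads_core.
rewrite UE (size_word_core cog) -/n in R1.
case V: (verdict _ _ _ _) R1 => R1 /=.
  exists gs1; split; last by rewrite co1.
  have R2 : runs (mret _ true) (word gs1) true (word gs1) 0 by apply: runs_ret.
  by apply: runs_leq (runs_bind (F := fun b : bool => if b then mret _ true else _) R1 R2);
    rewrite addn0 mulSn addn1 leq_addr.
have [gs2 [R2 co2]] := IH gs1 (etrans co1 cog).
exists gs2; split => //.
apply: runs_leq (runs_bind (F := fun b : bool => if b then mret _ true else _) R1 R2).
by rewrite mulSn addn1 addSn.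
Qed.

Definition search_step (l : 'I_D) (M : mach bool) : mach (option bool) :=
  mbind M (fun b => if b then mret _ (Some true) else
    mbind (pointer_next I T K.+1 l) (fun b' => mret _ (if b' then None else Some false))).

(** One nested loop per pointer, so the degree of the running time grows with the length of [ls]. *)
Fixpoint search (ls : seq 'I_D) : mach bool :=
  if ls is l :: ls' then
    mbind (pointer_init I T K.+1 l) (fun _ => mloop (search_step l (search ls')))
  else body.

Fixpoint search_time (ls : seq 'I_D) (n : nat) : nat :=
  if ls is l :: ls' then sw n + n.+1 * (search_time ls' n + sw n + 3) + 1
  else body_time n.

Definition upd (U : 'I_D -> seq (seq bool)) (l : 'I_D) (W : seq (seq bool)) :=
  fun l' => if l' == l then W else U l'.

Section OneCircuit.
Variables (c : circuit ar T) (wf : wf_circuit c).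
Let vars := var_numbers (as_bits (circuit_fields K c)).

(** The case [n == 0] is listed apart because a loop runs its body once even when the circuit has no
    variables. *)
Fixpoint reaches (ls : seq 'I_D) (U : 'I_D -> seq (seq bool)) : Prop :=
  if ls is l :: ls' then
    exists n, (n == 0) || (n < size vars) /\ reaches ls' (upd U l (drop n vars))
  else good c U.

(** Every loop resets its own pointer, so only the positions of the outer pointers matter. *)
Lemma reaches_ext ls U U' : (forall l, l \notin ls -> U l = U' l) ->
  reaches ls U -> reaches ls U'.
Proof.
elim: ls U U' => [|l ls IH] U U' E /=.
  by rewrite (_ : U = U') //; apply: functional_extensionality => l; apply: E.
case=> n [nv H]; exists n; split => //; apply: IH H => l' l'ls; rewrite /upd.
by case: eqP => // /eqP ne; apply: E; rewrite inE negb_or ne.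
Qed.

Lemma runs_search ls (fs : seq field) : uniq ls ->
  static fs = as_bits (circuit_fields K c) -> exists b fs',
  [/\ runs (search ls) (word fs) b (word fs') (search_time ls (size (word fs))),
      static fs' = static fs, (forall l, l \notin ls -> unreads l fs' = unreads l fs) &
      b <-> reaches ls (ptrs fs)].
Proof.
elim: ls fs => [|l ls IH] fs.
  move=> _ st; have [fs' [R co]] := runs_body wf st; do 2 eexists; split; first exact: R.
  - exact: static_core.
  - by move=> l _; apply: unreads_core.
  - by [].
rewrite cons_uniq => /andP[lls uls] st.
have fs0 : fs != [::] by case: (fs) st.
have [fs1 [R1 st1 un1 ot1]] := runs_pointer_init l fs0.
set n := size (word fs) in R1 *; rewrite st -/vars in un1.
have n1 : size (word fs1) = n by apply: size_word_static.
suff [b [fs2 [R2 st2 ot2 bP]]] : exists b fs',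
  [/\ runs (mloop (search_step l (search ls))) (word fs1) b (word fs')
        (n.+1 * (search_time ls n + sw n + 3)),
      static fs' = static fs1, (forall l', l' \notin l :: ls -> unreads l' fs' = unreads l' fs1) &
      b <-> exists q, (q == 0) || (q < size vars) /\ reaches ls (upd (ptrs fs) l (drop q vars))].
  exists b, fs2; split => //.
  - by apply: runs_leq (runs_bind R1 R2); rewrite /= addn1.
  - by rewrite st2.
  - move=> l' l'ls; rewrite ot2 // ot1 //.
    by move: l'ls; rewrite inE negb_or => /andP[].
have svars : size vars <= n.
  rewrite /vars -st /var_numbers size_map size_filter (leq_trans (count_size _ _)) //.
  rewrite size_map /n size_flatten /shape -map_comp; elim: (fs) => //= f fs' le.
  by rewrite size_rcons -add1n leq_add.
(* Induction on the number of positions still ahead of pointer [l], which stands at position [q]. *)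
have aux m : forall q gs, size vars - q = m -> (q == 0) || (q < size vars) ->
    static gs = static fs -> unreads l gs = drop q vars ->
    (forall l', l' \notin l :: ls -> unreads l' gs = unreads l' fs) -> exists b gs',
    [/\ runs (mloop (search_step l (search ls))) (word gs) b (word gs')
        (m.+1 * (search_time ls n + sw n + 3)),
      static gs' = static fs, (forall l', l' \notin l :: ls -> unreads l' gs' = unreads l' fs) &
      b <-> exists q', [/\ q <= q', (q' == q) || (q' < size vars) &
              reaches ls (upd (ptrs fs) l (drop q' vars))]].
  elim/ltn_ind: m => m IHm q gs mE qv stg ung otg.
  have ng : size (word gs) = n by apply: size_word_static.
  have [b1 [gs1 [R1' st1' ot1' bP1]]] := IH gs uls (etrans stg st); rewrite ng in R1'.
  have reachE : reaches ls (ptrs gs) <-> reaches ls (upd (ptrs fs) l (drop q vars)).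
    by split; apply: reaches_ext => l' l'ls; rewrite /upd; case: eqP => [->|/eqP ne] //;
      rewrite ?otg // inE negb_or ne.
  have ot2' l' : l' \notin l :: ls -> unreads l' gs1 = unreads l' fs.
    move=> l'ls; rewrite ot1' ?otg //.
    by move: l'ls; rewrite inE negb_or => /andP[].
  case: b1 R1' bP1 => R1' bP1.
    exists true, gs1; split => //.
    - apply: runs_loop_stop.
      have RB : runs (search_step l (search ls)) (word gs) (Some true) (word gs1)
          (search_time ls n + 0).+1 by apply: (runs_bind R1'); apply: runs_ret.
      apply: runs_leq RB; rewrite mulSn (leq_trans _ (leq_addr _ _)) //.
      by rewrite addn0 addn3 ltnS -addnS -addnS leq_addr.
    - by rewrite st1'.
    - by split => // _; exists q; rewrite leqnn eqxx; split => //; apply/reachE/bP1.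
  have gs10 : gs1 != [::] by apply: static_nonempty fs0; rewrite st1' stg.
  have n1' : size (word gs1) = n by apply: size_word_static; rewrite st1'.
  have [gs2 [R2 st2 un2 ot2]] := runs_pointer_next l gs10.
  rewrite ot1' // ung -drop1 drop_drop add1n in R2 un2; rewrite n1' in R2.
  have nE : (drop q.+1 vars != [::]) = (q.+1 < size vars).
    by rewrite -size_eq0 size_drop subn_eq0 -ltnNge.
  rewrite nE in R2.
  have ot3 l' : l' \notin l :: ls -> unreads l' gs2 = unreads l' fs.
    move=> l'ls; rewrite ot2 ?ot2' //.
    by move: l'ls; rewrite inE negb_or => /andP[].
  have RB : runs (search_step l (search ls)) (word gs)
      (if q.+1 < size vars then None else Some false) (word gs2)
      (search_time ls n + (sw n + 0).+1).+1.
    apply: (runs_bind R1'); apply: (runs_bind R2); exact: runs_ret.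
  have no_q : ~ reaches ls (upd (ptrs fs) l (drop q vars)).
    by move=> /reachE/bP1.
  case: ltnP RB => [lt|ge] RB.
    have lt' : size vars - q.+1 < m by rewrite -mE ltn_sub2l // ltnW.
    have [||b [gs3 [R3 st3 ot3' bP3]]] := IHm _ lt' q.+1 gs2 (erefl _) _ _ un2 ot3.
    - by rewrite lt orbT.
    - by rewrite st2 st1'.
    exists b, gs3; split => //.
      apply: runs_leq (runs_loop_next RB R3).
      rewrite -[X in _ <= X.+1 * _]mE -[size vars - q](subnSK (ltnW lt)) [in X in _ <= X]mulSn.
      by rewrite addn0 addnS addn3 -addSn leq_add2r.
    apply: (iff_trans bP3); split => -[q' [le q'v H]]; exists q'; split => //.
    - exact: ltnW.
    - by case/orP: q'v => [/eqP ->|->]; rewrite ?lt orbT.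
    - rewrite ltn_neqAle le andbT; apply/eqP => E.
      by apply: no_q; rewrite E.
    - case/orP: q'v => [/eqP E|->]; last by rewrite orbT.
      by case: no_q; rewrite -E.
  exists false, gs2; split => //.
  - apply: runs_loop_stop; apply: runs_leq RB.
    rewrite mulSn (leq_trans _ (leq_addr _ _)) // addn0 addnS addn3.
    exact: leqnSn.
  - by rewrite st2 st1'.
  - split => // -[q' [le q'v H]]; case/orP: q'v => [/eqP E|lt].
      by case: no_q; rewrite -E.
    have E : q' = q.
      by apply/eqP; rewrite eqn_leq le andbT -ltnS (leq_trans lt).
    by case: no_q; rewrite -E.
have otl l' : l' \notin l :: ls -> unreads l' fs1 = unreads l' fs.
  by rewrite inE negb_or => /andP[ne _]; apply: ot1.
have un1' : unreads l fs1 = drop 0 vars by rewrite drop0.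
have [b [fs2 [R2 st2 ot2 bP]]] := aux _ 0 fs1 (erefl _) isT st1 un1' otl.
exists b, fs2; split.
- apply: runs_leq R2; rewrite leq_mul2r ltnS subn0 svars orbT //.
- by rewrite st2 st1.
- by move=> l' l'ls; rewrite ot2 // otl.
- apply: (iff_trans bP); split => -[q']; first by case=> _ q'v H; exists q'.
  by case=> q'v H; exists q'.
Qed.

Lemma reaches_sound ls U : reaches ls U -> exists U', good c U'.
Proof.
elim: ls U => [|l ls IH] U /=; first by exists U.
by case=> n [_ /IH].
Qed.

Lemma reaches_complete (w : 'I_D -> nat) ls U :
  (forall l, (w l == 0) || (w l < size vars)) ->
  (forall l, l \notin ls -> U l = drop (w l) vars) ->
  good c (fun l => drop (w l) vars) -> reaches ls U.
Proof.
move=> wP; elim: ls U => [|l ls IH] U UE gc /=.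
  by rewrite (_ : U = fun l => drop (w l) vars) //; apply: functional_extensionality => l; apply: UE.
exists (w l); split => //; apply: IH => // l' l'ls; rewrite /upd.
by case: eqP => [->|/eqP ne] //; apply: UE; rewrite inE negb_or ne.
Qed.

End OneCircuit.
End Search.

(** * Recovering the roles of the numbers from the input *)

Inductive expected (I : Type) (K : nat) : Type :=
| KOut of bool
| KTag
| KVar
| KConst
| KOp
| KArg of I & 'I_K.
Arguments KOut {I K}. Arguments KTag {I K}. Arguments KVar {I K}.
Arguments KConst {I K}. Arguments KOp {I K}. Arguments KArg {I K}.

Definition expected_code (I : Type) (K : nat) (g : expected I K) :
    bool + bool * bool + I * 'I_K :=
  match g with
  | KOut b => inl (inl b)
  | KTag => inl (inr (false, false))
  | KVar => inl (inr (false, true))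
  | KConst => inl (inr (true, false))
  | KOp => inl (inr (true, true))
  | KArg i j => inr (i, j)
  end.

Definition expected_decode (I : Type) (K : nat) (c : bool + bool * bool + I * 'I_K) :
    expected I K :=
  match c with
  | inl (inl b) => KOut b
  | inl (inr (false, false)) => KTag
  | inl (inr (false, true)) => KVar
  | inl (inr (true, false)) => KConst
  | inl (inr (true, true)) => KOp
  | inr (i, j) => KArg i j
  end.

Lemma expected_codeK (I : Type) (K : nat) :
  cancel (@expected_code I K) (@expected_decode I K).
Proof. by case. Qed.

HB.instance Definition _ (I : finType) (K : nat) :=
  Equality.copy (expected I K) (can_type (@expected_codeK I K)).
HB.instance Definition _ (I : finType) (K : nat) :=
  Choice.copy (expected I K) (can_type (@expected_codeK I K)).
HB.instance Definition _ (I : finType) (K : nat) :=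
  Countable.copy (expected I K) (can_type (@expected_codeK I K)).
HB.instance Definition _ (I : finType) (K : nat) :=
  Finite.copy (expected I K) (can_type (@expected_codeK I K)).

(** Saturating after every operation agrees with saturating once at the end, so bounded registers
    suffice to read a number. *)
Lemma saturated_step (m a w : nat) (b : bool) :
  minn m (minn m a + b * minn m w) = minn m (a + b * w).
Proof. by case: b; rewrite ?mul1n ?mul0n; lia. Qed.

Lemma saturated_double (m w : nat) : minn m (minn m w).*2 = minn m w.*2.
Proof. lia. Qed.

Section Annotate.
Variables (I : finType) (ar : I -> nat) (T : finType) (t0 : T) (K D : nat).
Hypothesis arK : forall i, ar i <= K.+1.

Local Notation role := (role I T K.+1).
Local Notation Cl := (cell I T K.+1 D).
Local Notation field := (seq bitc * Cl)%type.
Local Notation mach := (machine (bitc + Cl)%type).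
Local Notation M := (2 + #|T| + #|I|).

(* Numbers are read off up to saturation at [M], beyond all tags and ranks. *)
Definition read_bit (be : 'I_M.+1 * 'I_M.+1) (x : bitc) : ('I_M.+1 * 'I_M.+1) * bitc :=
  ((inord (minn M (be.1 + orig x * be.2)), inord (minn M be.2.*2)), x).

Lemma read_bits (bs : seq bitc) (a w : nat) be :
  nat_of_ord be.1 = minn M a -> nat_of_ord be.2 = minn M w ->
  nat_of_ord (bscan read_bit be bs).1.1 = minn M (a + w * bval (map orig bs)) /\
  (bscan read_bit be bs).2 = bs.
Proof.
elim: bs a w be => [|x bs IH] a w be aE wE /=; first by rewrite muln0 addn0.
have [||E1 E2] := IH (a + orig x * w) w.*2 (read_bit be x).1.
- by rewrite /read_bit /= inordK ?ltnS ?geq_minl // aE wE saturated_step.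
- by rewrite /read_bit /= inordK ?ltnS ?geq_minl // wE saturated_double.
move: E1 E2; rewrite [(read_bit be x).1]/=; case: bscan => be' bs' /= -> ->.
split => //; congr minn.
by rewrite mulnDr -addnA -!mul2n mulnA [w * 2]mulnC [w * orig x]mulnC.
Qed.

(** The transitions of a finite automaton whose state says what the next number means. A rank
    without an element falls back to [KTag]; the encoding of a circuit never leads there. *)
Definition expect (g : expected I K.+1) (m : nat) : expected I K.+1 * role :=
  match g with
  | KOut b => (if b then KOut false else KTag, ROut b)
  | KTag => (if m == 0 then KVar else if m == 1 then KConst else KOp, RTag)
  | KVar => (KTag, RVar)
  | KConst => (KTag, if [pick a : T | enum_rank a == m :> nat] is Some a
                     then RConst a else RTag)
  | KOp => if [pick i : I | enum_rank i == m :> nat] is Some i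
           then (if ar i == 0 then KTag else KArg i ord0, ROp i) else (KTag, RTag)
  | KArg i j => (if j.+1 < ar i then KArg i (inord j.+1) else KTag, RArg i j)
  end.

Definition set_role (r : role) (s : Cl) : Cl :=
  Cell r (casg s) (crecv s) (cval s) (cdone s) (cfst s) (csnd s) (cshort s) (cused s).

Definition annotate_cell (g : expected I K.+1) (be : 'I_M.+1 * 'I_M.+1) (s : Cl) :
    expected I K.+1 * Cl :=
  let: (g', r) := expect g be.1 in (g', set_role r s).

Definition annotate : mach unit :=
  fsweep (ord0, inord 1) read_bit (KOut true) annotate_cell (fun _ => tt).

Definition raw_cell : Cl := Cell RTag t0 None t0 false false false false set0.
Definition raw (s : option bool) : bitc + Cl :=
  if s is Some b then inl (b, b, None) else inr raw_cell.
Definition raw_field (m : nat) : field :=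
  ([seq (b, b, None) : bitc | b <- nat_bits m], raw_cell).

Fixpoint parses (g : expected I K.+1) (st : seq (nat * role)) (g' : expected I K.+1) :
    Prop :=
  if st is c :: st' then
    exists g1, expect g (minn M c.1) = (g1, c.2) /\ parses g1 st' g'
  else g = g'.

Lemma parses_cat g st1 g1 st2 g2 :
  parses g st1 g1 -> parses g1 st2 g2 -> parses g (st1 ++ st2) g2.
Proof.
elim: st1 g => [|c st1 IH] g /=; first by move=> ->.
by case=> g' [E H] H2; exists g'; split => //; apply: IH.
Qed.

Lemma parses_static g st g' : parses g st g' ->
  static (fscan (ord0, inord 1) read_bit annotate_cell g [seq raw_field c.1 | c <- st]).2
  = as_bits st.
Proof.
elim: st g => //= -[m r] st IH g [g1 [E H]] /=.
rewrite /fstep /=; set bs := map _ _.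
have origE : map orig bs = nat_bits m by rewrite -map_comp map_id.
have [||E1 E2] := @read_bits bs 0 1 (ord0, inord 1) => //.
  by rewrite /= inordK.
move: E1 E2; rewrite origE bval_nat_bits mul1n add0n; case: bscan => be bs' /= E1 E2.
rewrite /annotate_cell E1 E /=; have := IH _ H; case: fscan => g2 fs /= <-.
by rewrite /static /= /origs /= E2 origE.
Qed.

Lemma parses_node (n : cnode ar T) : parses KTag (node_fields K n) KTag.
Proof.
have minE m : m <= M -> minn M m = m by move=> le; apply/minn_idPr.
case: n => [v|a|i ch].
- by exists KVar; split; first (rewrite minE //); exists KTag.
- exists KConst; split; first by rewrite minE.
  exists KTag; split => //=; rewrite minE; last first.
    exact: leq_trans (ltnW (ltn_ord _)) (leq_trans (leq_addl 2 _) (leq_addr _ _)).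
  case: pickP => [b /eqP/val_inj/enum_rank_inj -> //|/(_ a)].
  by rewrite eqxx.
exists KOp; split; first by rewrite minE.
exists (if ar i == 0 then KTag else KArg i ord0); split.
  rewrite /= minE; last first.
    exact: leq_trans (ltnW (ltn_ord _)) (leq_addl _ _).
  case: pickP => [b /eqP/val_inj/enum_rank_inj -> //|/(_ i)].
  by rewrite eqxx.
have H m n : ar i - n = m ->
    parses (if n < ar i then KArg i (inord n) else KTag)
      [seq (ch j, RArg i (inord j)) | j <- drop n (enum 'I_(ar i))] KTag.
  elim: m n => [|m IH] n nE.
    have le : ar i <= n by rewrite -subn_eq0 nE.
    by rewrite drop_oversize ?size_enum_ord //= ltnNge le.
  have lt : n < ar i by rewrite -subn_gt0 nE.
  rewrite lt; have -> : drop n (enum 'I_(ar i)) = Ordinal lt :: drop n.+1 (enum 'I_(ar i)).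
    rewrite (drop_nth (Ordinal lt)) ?size_enum_ord //; congr cons.
    by apply: val_inj; rewrite /= nth_enum_ord.
  rewrite /= inordK; last exact: leq_trans lt (arK i).
  by eexists; split; [reflexivity|apply: IH; rewrite subnS nE].
have := H _ 0 (erefl _); rewrite drop0 lt0n; case: eqP => //= _.
by rewrite (_ : inord 0 = ord0) //; apply: val_inj; rewrite /= inordK.
Qed.

Lemma parses_circuit (c : circuit ar T) : parses (KOut true) (circuit_fields K c) KTag.
Proof.
rewrite /circuit_fields; apply: (@parses_cat _ _ KTag).
  by exists (KOut false); split => //; exists KTag.
elim: (cnodes c) => //= n ns IH; apply: parses_cat IH; exact: parses_node.
Qed.

(** Separators turn into data cells, so a number together with its separator becomes one field. *)
Lemma raw_word (c : circuit ar T) :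
  map raw (enc_circuit c) = word [seq raw_field x.1 | x <- circuit_fields K c].
Proof.
have natE m : map raw (enc_nat m) = rcons (map inl (raw_field m).1) (inr (raw_field m).2).
  by rewrite /enc_nat map_cat /= cats1 -!map_comp.
have listE (st : seq (nat * role)) :
    map raw (flatten [seq enc_nat x.1 | x <- st]) = word [seq raw_field x.1 | x <- st].
  rewrite map_flatten /word -!map_comp; congr flatten; apply: eq_map => x.
  by rewrite /= natE.
rewrite -listE; congr (map raw _); rewrite /enc_circuit /circuit_fields.
rewrite map_cat flatten_cat /= cats0 -catA; congr (_ ++ (_ ++ _)).
elim: (cnodes c) => //= n ns ->; rewrite map_cat flatten_cat; congr (_ ++ _).
case: n => [v|a|i ch] //=; rewrite ?cats0 //.
by rewrite -map_comp -catA.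
Qed.

Lemma runs_annotate (c : circuit ar T) : exists fs',
  [/\ runs annotate (map raw (enc_circuit c)) tt (word fs') (sw (size (enc_circuit c))),
      size (word fs') = size (enc_circuit c) & static fs' = as_bits (circuit_fields K c)].
Proof.
pose fs := [seq raw_field x.1 | x <- circuit_fields K c].
have fs0 : fs != [::] by [].
have R := runs_fsweep (ord0, inord 1) read_bit (KOut true) annotate_cell (fun _ => tt) fs0.
rewrite -raw_word size_map in R.
eexists; split; first exact: R.
  by rewrite size_word_fscan /fs -raw_word size_map.
exact: parses_static (parses_circuit c).
Qed.

End Annotate.

(** * Circuits as terms *)

Section Terms.
Variables (I : Type) (ar : I -> nat) (T : Type) (o : ops_t ar T).

(** Unfolding shared gates can be exponential; these terms only link circuits to the algebraic
    result, and the machine never builds them. *)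
Definition node_term (prev : seq (pterm ar T nat)) (n : cnode ar T) : pterm ar T nat :=
  match n with
  | CVar v => PVar _ _ v
  | CConst a => PConst _ _ a
  | CGate i ch => POp (fun j => nth (PVar _ _ 0) prev (ch j))
  end.

Definition node_terms (ns : seq (cnode ar T)) : seq (pterm ar T nat) :=
  foldl (fun prev n => rcons prev (node_term prev n)) [::] ns.

Lemma node_terms_rcons ns n :
  node_terms (rcons ns n) = rcons (node_terms ns) (node_term (node_terms ns) n).
Proof. by rewrite /node_terms -cats1 foldl_cat. Qed.

Lemma peval_node_terms e (c : circuit ar T) :
  circuit_vals o e c = map (peval o id e) (node_terms (cnodes c)).
Proof.
rewrite /circuit_vals; elim/last_ind: (cnodes c) => // ns n IH.
rewrite -{1}cats1 foldl_cat /= IH node_terms_rcons map_rcons; congr rcons.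
case: n => //= i ch; congr (o _); apply: functional_extensionality => j.
have [lt|ge] := ltnP (ch j) (size (node_terms ns)).
  by rewrite (nth_map (PVar _ _ 0)).
by rewrite !nth_default ?size_map.
Qed.

Lemma size_node_terms ns : size (node_terms ns) = size ns.
Proof. by elim/last_ind: ns => // ns n IH; rewrite node_terms_rcons !size_rcons IH. Qed.

Definition node_vars (ns : seq (cnode ar T)) : seq nat :=
  pmap (fun n => if n is CVar v then Some v else None) ns.

Lemma mem_node_vars n0 (ns : seq (cnode ar T)) k v :
  k < size ns -> nth n0 ns k = CVar ar T v -> v \in node_vars ns.
Proof.
elim: ns k => // n ns IH [|k] /=; first by move=> _ ->; rewrite /= inE eqxx.
by rewrite ltnS => lt /(IH k lt) H; case: n => //= v'; rewrite inE H orbT.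
Qed.

Lemma vars_in_node_terms (S : seq nat) ns :
  (forall k, k < size ns -> match nth (CVar ar T 0) ns k with
     | CVar v => is_true (v \in S)
     | CGate i ch => forall j, ch j < k
     | _ => True
     end) ->
  forall k, k < size ns -> vars_in S (nth (PVar _ _ 0) (node_terms ns) k).
Proof.
elim/last_ind: ns => // ns n IH H k; rewrite size_rcons ltnS node_terms_rcons.
have {}IH k' : k' < size ns -> vars_in S (nth (PVar _ _ 0) (node_terms ns) k').
  apply: IH => k'' lt; have := H k''; rewrite size_rcons ltnS nth_rcons lt.
  by apply; apply: ltnW.
rewrite nth_rcons size_node_terms leq_eqVlt => /orP[/eqP ->|lt]; last by rewrite lt; apply: IH.
rewrite ltnn eqxx; have := H (size ns); rewrite size_rcons ltnSn nth_rcons ltnn eqxx.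
by move=> /(_ isT); case: n {H} => //= i ch chk j; apply: IH.
Qed.

End Terms.

Lemma pbound_succ f : pbound f -> pbound (fun n => (f n).+1).
Proof.
move=> pf; have [c [k H]] := pbound_add (pbound_const 1) pf.
by exists c, k => n; apply: leq_trans (H n); rewrite add1n.
Qed.

Lemma pbound_sw : pbound sw.
Proof.
apply: pbound_add (pbound_const 2); apply: pbound_mul pbound_id; exact: pbound_const.
Qed.

Lemma pbound_overwrite_time : pbound overwrite_time.
Proof.
apply: pbound_add (pbound_const 1); apply: pbound_add pbound_sw _.
apply: pbound_mul; first exact: pbound_succ pbound_id.
apply: pbound_add (pbound_const 2); apply: pbound_mul pbound_sw; exact: pbound_const.
Qed.

Lemma pbound_evaluate_time : pbound evaluate_time.
Proof.
apply: pbound_add (pbound_const 2); apply: pbound_add pbound_sw.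
apply: pbound_add pbound_sw _; apply: pbound_mul; first exact: pbound_succ pbound_id.
exact: pbound_add pbound_sw (pbound_const 1).
Qed.

Lemma pbound_attempt_time D : pbound (attempt_time D).
Proof.
apply: pbound_add (pbound_const 1); apply: pbound_add pbound_sw _.
apply: pbound_add pbound_evaluate_time; apply: pbound_mul (pbound_const D) _.
exact: pbound_succ pbound_overwrite_time.
Qed.

Lemma pbound_search_time (T : finType) (D : nat) (ls : seq 'I_D) :
  pbound (search_time T ls).
Proof.
elim: ls => [|l ls IH] /=.
  apply: pbound_mul (pbound_const _) _.
  exact: pbound_add (pbound_attempt_time D) (pbound_const 1).
apply: pbound_add (pbound_const 1); apply: pbound_add pbound_sw _.
apply: pbound_mul; first exact: pbound_succ pbound_id.
apply: pbound_add (pbound_const 3); exact: pbound_add pbound_sw.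
Qed.

(** * The decision procedure *)

Section SparseInP.
Variables (I : finType) (ar : I -> nat) (T : finType) (o : ops_t ar T) (t0 : T) (D : nat).

Local Notation K := (\max_i ar i).

Lemma var_numbers_circuit (c : circuit ar T) :
  var_numbers (as_bits (circuit_fields K c)) = map nat_bits (node_vars (cnodes c)).
Proof.
have E st : var_numbers (as_bits st) =
    [seq nat_bits x.1 | x <- st & x.2 == (RVar : role I T K.+1)].
  by rewrite /var_numbers /as_bits filter_map -map_comp.
rewrite E /circuit_fields /=; elim: (cnodes c) => //= n ns IH.
rewrite filter_cat map_cat IH; case: n => //= i ch.
rewrite (_ : [seq x <- _ | _] = [::]) //; apply/eqP; rewrite -[_ == _]negbK -has_filter has_map.
by apply/hasPn => j _.
Qed.

Lemma verdict_csat (c : circuit ar T) rho :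
  wf_circuit c -> verdict o t0 c rho -> csat o c.
Proof.
move=> [l1 l2 _] /eqP E; exists (fun v => rho (nat_bits v)).
rewrite -[LHS](set_nth_default _ t0) -?[RHS](set_nth_default _ t0) //;
  by rewrite size_run_nodes.
Qed.

Lemma sparse_attempt (c : circuit ar T) (S : seq nat) (e : nat -> T) (a : T) :
  wf_circuit c -> {subset S <= node_vars (cnodes c)} -> size S <= D ->
  let f v := if v \in S then e v else a in
  nth t0 (circuit_vals o f c) (cout1 c) = nth t0 (circuit_vals o f c) (cout2 c) ->
  reaches o t0 K c (enum 'I_D) (fun _ => [::]).
Proof.
move=> wf SV szS f E.
pose vs := node_vars (cnodes c).
(* Pointers in excess of the size of [S] are parked at the first variable. *)
pose v0 := head 0 vs.
pose v_ (l : 'I_D) := nth v0 S l.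
(* Every pointer writes the value of [f] at its own variable, so pointers that coincide do not
   conflict. *)
pose x : T * {ffun 'I_D -> T} := (a, [ffun l => f (v_ l)]).
pose w l := index (v_ l) vs.
have v_vs l : vs != [::] -> v_ l \in vs.
  move=> vs0; have [lt|ge] := ltnP l (size S); first by apply: SV; apply: mem_nth.
  by rewrite /v_ nth_default // /v0; case: (vs) vs0 => //= v vs' _; rewrite inE eqxx.
apply: (reaches_complete (w := w)).
- move=> l; rewrite var_numbers_circuit size_map -/vs /w; case: eqVneq => //= ne.
  rewrite index_mem v_vs //; apply: contra_neq ne => ->. by [].
- by move=> l; rewrite mem_enum.
rewrite /good; apply/hasP; exists x; first by rewrite mem_enum.
rewrite /verdict; set rho := attempt_env x _.
suff -> : (fun v => rho (nat_bits v)) = f by apply/eqP.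
apply: functional_extensionality => v.
have H ls (rho0 : seq bool -> T) :
    foldl (fun rho l => override_head rho
       (drop (w l) (var_numbers (as_bits (circuit_fields K c)))) (x.2 l)) rho0 ls (nat_bits v) =
    if (vs != [::]) && (v \in map v_ ls) then f v else rho0 (nat_bits v).
  elim: ls rho0 => [|l ls IH] rho0 /=; first by rewrite andbF.
  rewrite IH var_numbers_circuit -/vs inE; case: (eqVneq vs [::]) => [-> //|vs0] /=.
  case: (v \in map v_ ls); rewrite ?orbT //= orbF.
  have lt : w l < size vs by rewrite index_mem v_vs.
  rewrite -map_drop (drop_nth 0 lt) nth_index ?v_vs //= /override.
  rewrite (inj_eq nat_bits_inj) ffunE; by case: eqP => // ->.
rewrite /rho /attempt_env /override_all H; case: ifP => // vnot /=.
rewrite /f; case: ifP => // vS; case/negP: vnot; have -> /= : vs != [::] by have := SV _ vS; rewrite -/vs; case: (vs).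
have lt : index v S < D by apply: leq_trans szS; rewrite index_mem.
apply/mapP; exists (Ordinal lt); rewrite ?mem_enum //.
by rewrite /v_ nth_index.
Qed.

Lemma csat_in_P :
  (forall c : circuit ar T, wf_circuit c -> csat o c ->
     exists S (e : nat -> T) (a : T), let f v := if v \in S then e v else a in
     [/\ {subset S <= node_vars (cnodes c)}, size S <= D &
        nth t0 (circuit_vals o f c) (cout1 c) = nth t0 (circuit_vals o f c) (cout2 c)]) ->
  poly_time_decides_on (@enc_circuit I ar T) (@wf_circuit I ar T) (csat o).
Proof.
move=> sparse.
have arK i : ar i <= K.+1 by apply: leqW; apply: leq_bigmax.
pose M := mbind (annotate ar T K D) (fun _ => search o t0 K (enum 'I_D)).
pose bound n := (sw n + search_time T (enum 'I_D) n).+1.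
have pb : pbound bound.
  by apply: pbound_succ; apply: pbound_add pbound_sw _; apply: pbound_search_time.
apply: (machine_decides (raw := raw I t0 K D) (M := M) pb).
  move=> c _; rewrite /enc_circuit /enc_nat.
  by case: (nat_bits (cout1 c)).
move=> c wf; have [fs1 [R1 sz1 st1]] := runs_annotate t0 D arK c.
have [b [fs2 [R2 st2 _ bP]]] := runs_search o t0 arK wf (enum_uniq 'I_D) st1.
exists b, (word fs2); split.
  by apply: runs_leq (runs_bind R1 R2); rewrite /bound sz1.
apply: (iff_trans bP); split => [/reaches_sound[U /hasP[x _ /verdict_csat]]|]; first exact.
move=> /(sparse _ wf)[S [e [a [SV szS E]]]].
apply: reaches_ext (sparse_attempt wf SV szS E) => l.
by rewrite mem_enum.
Qed.

End SparseInP.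

(** Over an empty universe there is no assignment, and the machine rejects at once. *)
Lemma empty_csat_in_P (I : finType) (ar : I -> nat) (T : finType) (o : ops_t ar T) :
  (T -> False) ->
  poly_time_decides_on (@enc_circuit I ar T) (@wf_circuit I ar T) (csat o).
Proof.
move=> noT; exists unit, (option bool), id, None, tt, (fun _ => Some false),
  (fun q a => (q, a, Stay)), 0, 0 => c _ /=.
by split => // -[e _]; case: (noT (e 0)).
Qed.

Theorem theorem9p2 (I : finType) (ar : I -> nat) (A : falg ar) :
  gen_variety_cong_modular A ->
  (exists N D : falg ar,
      [/\ supernilpotent (fop N), subdirect_2lattices D & iso_product A N D]) ->
  forall (A' : falg ar) (h : fcar A -> fcar A'),
    is_hom (fop A) (fop A') h -> surj h -> CSAT_in_P A'.
Proof.
move=> modA [N [D [sn lat prodA]]] A' h hh hs.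
case: (pickP (fun _ : fcar A' => true)) => [a' _|no]; last first.
  by apply: empty_csat_in_P => a; have := no a.
have [d Hd] := sparse_quotient_solution modA sn lat prodA hh hs a'.
rewrite /CSAT_in_P; apply: (@csat_in_P _ _ _ (fop A') a' d) => c wf [e E]; have [l1 l2 wfn] := wf.
(* Repetitions are removed since the deletion argument works on lists of distinct variables. *)
pose S := undup (node_vars (cnodes c)).
pose t k := nth (PVar ar (fcar A') 0) (node_terms (cnodes c)) k.
have valE f x k : k < size (cnodes c) ->
    nth x (circuit_vals (fop A') f c) k = peval (fop A') id f (t k).
  by move=> lt; rewrite peval_node_terms (nth_map (PVar _ _ 0)) // size_node_terms.
have varsE k : k < size (cnodes c) -> vars_in S (t k).
  apply: vars_in_node_terms => j lt; have := wfn j lt; case En: nth => [v||] // _.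
  by rewrite mem_undup; apply: mem_node_vars lt En.
rewrite !valE // in E.
have [S' [e' [a [sub sz E']]]] := Hd _ _ S e (undup_uniq _) (varsE _ l1) (varsE _ l2) E.
exists S', e', a => f; split => //; last by rewrite !valE.
by move=> v /(mem_subseq sub); rewrite mem_undup.
Qed.
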